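(* Let $k$ be an algebraically closed field of characteristic $p \ge 0$ and let $\mathcal{C}$ be a (reduced, irreducible) smooth projective curve over $k$. Let $G_1, G_2$ be finite subgroups of $\mathrm{Aut}(\mathcal{C})$ and let $P_1, P_2$ be different points of $\mathcal{C}$ such that (a) $\mathcal{C}/G_1 \cong \mathbb{P}^1$ and $\mathcal{C}/G_2 \cong \mathbb{P}^1$; (b) $G_1 \cap G_2 = \{1\}$; (c) $P_1 + \sum_{\sigma \in G_1} \sigma(P_2) = P_2 + \sum_{\tau \in G_2} \tau(P_1)$ as divisors on $\mathcal{C}$. Let $H$ be a finite subgroup of $\mathrm{Aut}(\mathcal{C})$. If the three conditions (d) $H \cap G_1G_2 = \{1\}$, where $G_1G_2=\{\sigma\tau : \sigma \in G_1, \tau \in G_2\}$; (e) $HG_1 = H \rtimes G_1$ and $HG_2 = H \rtimes G_2$; (f) $HP_1 \ne HP_2$ (the $H$-orbits are different) are satisfied, then there exists a birational embedding $\psi: \mathcal{C}/H \to \mathbb{P}^2$ of degree $|G_1|+1$ such that $\psi(\overline{P_1})$ and $\psi(\overline{P_2})$ are different inner Galois points for $\psi(\mathcal{C}/H)$ and $G_{\psi(\overline{P_i})} \cong G_i$ for $i=1,2$.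
   Context: A birational embedding $\psi: \mathcal{D} \to \mathbb{P}^2$ of a smooth projective curve $\mathcal{D}$ is a morphism that is birational onto its image; its degree is the degree of the plane curve $\psi(\mathcal{D})$. For a plane curve $C \subset \mathbb{P}^2$, a point $P \in \mathbb{P}^2$ is a Galois point for $C$ if the function field extension $k(C)/\pi_P^*k(\mathbb{P}^1)$ induced by the projection $\pi_P: C \dashrightarrow \mathbb{P}^1$ from $P$ is Galois; the associated Galois group is denoted $G_P$. A Galois point $P$ is called inner if $P$ is a smooth point of $C$ (in particular $P \in C$). For a finite subgroup $H \subset \mathrm{Aut}(\mathcal{C})$, $f_H: \mathcal{C} \to \mathcal{C}/H$ is the quotient map and, for $Q \in \mathcal{C}$, $\overline{Q} := f_H(Q)$. The notation $HG_i = H \rtimes G_i$ means that the product set $HG_i$ is a subgroup of $\mathrm{Aut}(\mathcal{C})$ which is the internal semidirect product of $H$ and $G_i$, with $H$ as the normal factor. *)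

(* Defs.v *)
From HB Require Import structures.
From mathcomp Require Import all_boot all_order all_algebra.
From mathcomp Require Import finmap boolp classical_sets functions.
From mathcomp Require Import freeg mpoly.
From mathcomp Require Import generic_quotient fraction.

Set Implicit Arguments.
Unset Strict Implicit.
Unset Printing Implicit Defensive.

Import GRing.Theory.
Local Open Scope ring_scope.
Local Open Scope quotient_scope.

Record subfield (F : fieldType) := Subfield {
  sf_mem :> {pred F};
  sf_closed : divring_closed sf_mem }.

HB.instance Definition _ (F : fieldType) (S : subfield F) :=
  GRing.isDivringClosed.Build F (sf_mem S) (sf_closed S).

Record sf_type (F : fieldType) (S : subfield F) := SfElt {
  sf_val :> F;
  sf_valP : sf_val \in sf_mem S }.

HB.instance Definition _ (F : fieldType) (S : subfield F) :=
  [isSub for @sf_val F S].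
HB.instance Definition _ (F : fieldType) (S : subfield F) :=
  [Choice of sf_type S by <:].
HB.instance Definition _ (F : fieldType) (S : subfield F) :=
  [SubChoice_isSubIntegralDomain of sf_type S by <:].
HB.instance Definition _ (F : fieldType) (S : subfield F) :=
  [SubIntegralDomain_isSubField of sf_type S by <:].

Record kfield (k : fieldType) := KField {
  kf_car :> fieldType;
  kf_const : {rmorphism k -> kf_car} }.
Arguments kf_const {k} _.

Section KField.
Variables (k : fieldType) (L : kfield k).
Local Notation "p ^k" := (map_poly (kf_const L) p) (at level 2, format "p ^k").

Definition transcendental (x : L) := forall p : {poly k}, root p^k x -> p = 0.

(* k(x) *)
Definition kx_mem (x : L) : {pred L} := fun y =>
  `[< exists p q : {poly k}, q^k.[x] != 0 /\ y = p^k.[x] / q^k.[x] >].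

Lemma kx_closed x : divring_closed (kx_mem x).
Proof.
split.
- by apply/asboolP; exists 1, 1; rewrite rmorph1 hornerC oner_neq0 divr1.
- move=> y z /asboolP[p [q [q0 ->]]] /asboolP[p' [q' [q'0 ->]]].
  apply/asboolP; exists (p * q' - p' * q), (q * q').
  rewrite !(rmorphM, rmorphB) !(hornerM, hornerN, hornerD) mulf_neq0 //; split=> //.
  by rewrite -mulNr addf_div // mulNr.
- move=> y z /asboolP[p [q [q0 ->]]] /asboolP[p' [q' [q'0 ->]]].
  have [p'0|p'0] := eqVneq p'^k.[x] 0.
    by apply/asboolP; exists 0, 1; rewrite rmorph0 rmorph1 !hornerC oner_neq0 p'0 mul0r invr0 mulr0 mul0r.
  apply/asboolP; exists (p * q'), (q * p').
  rewrite !rmorphM !hornerM mulf_neq0 //; split=> //.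
  by rewrite invf_div mulf_div.
Qed.

Definition kx (x : L) : subfield L := Subfield (kx_closed x).

(* A finite extension of k(x) with x transcendental; b spans it over k(x).    *)
Definition function_field := exists x : L, transcendental x /\
  exists (n : nat) (b : 'I_n -> L), forall y : L,
    exists2 c : 'I_n -> L, (forall i, c i \in sf_mem (kx x))
                         & y = \sum_(i < n) c i * b i.
End KField.

(* Smooth projective curves over an algebraically closed field k are encoded  *)
(* as abstract nonsingular curves: a curve is a function field of one         *)
(* variable over k, its points are the valuation rings of that field over k,  *)
(* and isomorphisms are the k-isomorphisms of function fields.                *)
Record curve (k : fieldType) := Curve {
  curve_ff :> kfield k;
  curveP : function_field curve_ff }.

Lemma span_dependent (E V : fieldType) (e : {rmorphism E -> V}) m n
    (b : 'I_n -> V) (w : 'I_m -> V) (A : 'I_m -> 'I_n -> E) :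
    (n < m)%N -> (forall i, w i = \sum_j e (A i j) * b j) ->
  exists2 u : 'I_m -> E, exists i, u i != 0 & \sum_i e (u i) * w i = 0.
Proof.
move=> lt_nm wE; pose M := \matrix_(i, j) A i j.
have /rowV0Pn[u /sub_kermxP uM u0] : kermx M != 0.
  rewrite -mxrank_eq0 mxrank_ker subn_eq0 -ltnNge.
  exact: leq_ltn_trans (rank_leq_col M) lt_nm.
exists (u 0).
  by case/rV0Pn: u0 => i ui; exists i.
under eq_bigr => i _ do rewrite wE mulr_sumr.
rewrite exchange_big big1 // => j _.
under eq_bigr => i _ do rewrite mulrA -rmorphM.
rewrite -mulr_suml -raddf_sum /=.
have -> : \sum_i u 0 i * A i j = 0.
  move/rowP/(_ j): uM; rewrite !mxE => uMj; rewrite -[RHS]uMj.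
  by apply: eq_bigr => i _; rewrite mxE.
by rewrite rmorph0 mul0r.
Qed.

Lemma subspace_span (E F L : fieldType) (e : {rmorphism E -> F})
    (j : {rmorphism F -> L}) n (v : 'I_n -> L) :
    (forall y, exists c : 'I_n -> E, y = \sum_i j (e (c i)) * v i) ->
  exists m (b : 'I_m -> F),
    forall f, exists c : 'I_m -> E, f = \sum_i e (c i) * b i.
Proof.
move=> spanL.
pose indep m (b : 'I_m -> F) := forall c : 'I_m -> E,
  \sum_i e (c i) * b i = 0 -> forall i, c i = 0.
pose P m := `[< exists b : 'I_m -> F, indep m b >].
have P0 : P 0%N by apply/asboolP; exists (fun=> 0) => c _ [].
have Pn m : P m -> (m <= n)%N.
  move=> /asboolP[b b_ind]; rewrite leqNgt; apply/negP => lt_nm.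
  have /choice[A AE] : forall i, exists c : 'I_n -> E, j (b i) = \sum_k j (e (c k)) * v k.
    by move=> i; apply: spanL.
  have [u [i ui0] uE] := span_dependent (e := j \o e) lt_nm AE.
  have : j (\sum_i e (u i) * b i) = 0.
    rewrite rmorph_sum -[RHS]uE; apply: eq_bigr => i' _.
    by rewrite rmorphM.
  move/eqP; rewrite fmorph_eq0 => /eqP/b_ind/(_ i) ui.
  by rewrite ui eqxx in ui0.
have exP : exists m, P m by exists 0%N.
have [m /asboolP[b b_ind] m_max] := ex_maxnP exP Pn.
exists m, b => f.
have [/asboolP [c ->]|noc] := boolP `[< exists c : 'I_m -> E, f = \sum_i e (c i) * b i >].
  by exists c.
have /m_max : P m.+1; last by rewrite ltnn.
apply/asboolP; exists (fun i => if unlift ord0 i is Some i' then b i' else f) => c.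
rewrite big_ord_recl unlift_none /=.
under eq_bigr => i _ do rewrite liftK.
move=> c0; have cz : c ord0 = 0.
  apply/eqP; apply: contraNT noc => cn0; apply/asboolP.
  exists (fun i => - (c (fintype.lift ord0 i) / c ord0)).
  apply: (mulfI (x := e (c ord0))); first by rewrite fmorph_eq0.
  move/eqP: c0; rewrite addr_eq0 => /eqP ->.
  rewrite mulr_sumr -sumrN; apply: eq_bigr => i _.
  rewrite mulrA -rmorphM mulrN mulrCA divff // mulr1.
  by rewrite rmorphN mulNr.
move: c0; rewrite cz rmorph0 mul0r add0r => /b_ind cl i.
by case: (unliftP ord0 i) => [i' ->|->//]; apply: cl.
Qed.

Lemma adjoin_span (E L : fieldType) (e : {rmorphism E -> L}) (z : L) :
    algebraicOver e z ->
  exists m, forall p q : {poly E}, (map_poly e q).[z] != 0 ->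
    exists2 r : {poly E}, (size r <= m)%N &
      (map_poly e p).[z] / (map_poly e q).[z] = (map_poly e r).[z].
Proof.
case=> p0 p0n0 p0z.
pose P m := `[< exists r : {poly E}, [/\ r != 0, root (map_poly e r) z & size r = m] >].
have exP : exists m, P m by exists (size p0); apply/asboolP; exists p0.
have [m /asboolP[r [rn0 rz rm]] m_min] := ex_minnP exP.
have {}m_min (s : {poly E}) : s != 0 -> root (map_poly e s) z -> (m <= size s)%N.
  by move=> s0 sz; apply: m_min; apply/asboolP; exists s.
exists m => p q qz.
have cop : coprimep q r.
  have gr := dvdp_gcdr q r; have gq := dvdp_gcdl q r.
  have gn0 : gcdp q r != 0 by rewrite gcdp_eq0 (negPf rn0) andbF.
  have gz : ~~ root (map_poly e (gcdp q r)) z.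
    apply: contra qz => gz; move: gq => /dvdpP[s ->].
    by rewrite rmorphM hornerM (eqP gz) mulr0.
  case/dvdpP: (gr) => s rE.
  have sn0 : s != 0 by apply: contraNneq rn0 => s0; rewrite rE s0 mul0r.
  have sz : root (map_poly e s) z.
    by move: rz; rewrite {1}rE rmorphM rootM (negPf gz) orbF.
  have := m_min _ sn0 sz; rewrite -rm {1}rE size_mul //.
  rewrite -subn1 leq_subLR addnC leq_add2r /coprimep => le1.
  by rewrite eqn_leq le1 lt0n size_poly_eq0.
case/Bezout_eq1_coprimepP: cop => -[u v] /= uv.
exists ((p * u) %% r); first by rewrite -rm ltnW // ltn_modpN0.
apply: (mulIf qz); rewrite divfK //.
have -> : (map_poly e ((p * u) %% r)).[z] = (map_poly e (p * u)).[z].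
  rewrite {2}(divp_eq (p * u) r) rmorphD rmorphM hornerD hornerM.
  by rewrite (eqP rz) mulr0 add0r.
have /(congr1 (fun s => (map_poly e s).[z])) := uv.
rewrite rmorphD !rmorphM hornerD !hornerM (eqP rz) mulr0 addr0 rmorph1 hornerC => uq.
by rewrite -mulrA uq mulr1.
Qed.

Section KAut.
Variables (k : fieldType) (L : kfield k).

Record kaut := KAut {
  kaut_fun :> {rmorphism L -> L};
  kaut_inv : L -> L;
  kautK : cancel kaut_fun kaut_inv;
  kautKV : cancel kaut_inv kaut_fun;
  kaut_const : forall c, kaut_fun (kf_const L c) = kf_const L c }.

Lemma kaut_eq (s t : kaut) : s =1 t -> s = t.
Proof.
case: s t => [s si sK sKV sc] [t ti tK tKV tc] /= st.
have {}st : s = t.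
  case: s t st {sK sKV tK tKV sc tc} => [s [[sa] [sm]]] [t [[ta] [tm]]] /= /funext st.
  case: _ / st in sa sm ta tm *.
  by rewrite (Prop_irrelevance sa ta) (Prop_irrelevance sm tm).
case: _ / st in sK sKV sc tK tKV tc *.
have si_ti : si = ti by apply: funext => y; rewrite -{2}[y]sKV tK.
case: _ / si_ti in sK sKV sc tK tKV tc *.
by rewrite (Prop_irrelevance sK tK) (Prop_irrelevance sKV tKV) (Prop_irrelevance sc tc).
Qed.

HB.instance Definition _ := gen_eqMixin kaut.
HB.instance Definition _ := gen_choiceMixin kaut.

Definition kaut_one : kaut :=
  @KAut idfun id (fun=> erefl) (fun=> erefl) (fun=> erefl).

Fact kaut_mul_const (s t : kaut) c : (s \o t) (kf_const L c) = kf_const L c.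
Proof. by rewrite /= !kaut_const. Qed.
(* The group law is composition, so that automorphisms act on the left.       *)
Definition kaut_mul (s t : kaut) : kaut :=
  @KAut (s \o t) (kaut_inv t \o kaut_inv s)
    (can_comp (kautK s) (kautK t)) (can_comp (kautKV t) (kautKV s))
    (kaut_mul_const s t).

Fact kaut_inv_zmod (s : kaut) : zmod_morphism (kaut_inv s).
Proof. by move=> x y; apply: (can_inj (kautK s)); rewrite rmorphB !kautKV. Qed.
Fact kaut_inv_monoid (s : kaut) : monoid_morphism (kaut_inv s).
Proof.
split=> [|x y]; apply: (can_inj (kautK s)).
  by rewrite rmorph1 kautKV.
by rewrite rmorphM !kautKV.
Qed.
HB.instance Definition _ (s : kaut) :=
  GRing.isZmodMorphism.Build L L (kaut_inv s) (kaut_inv_zmod s).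
HB.instance Definition _ (s : kaut) :=
  GRing.isMonoidMorphism.Build L L (kaut_inv s) (kaut_inv_monoid s).

Fact kaut_inv_const (s : kaut) c : kaut_inv s (kf_const L c) = kf_const L c.
Proof. by rewrite -{1}(kaut_const s) kautK. Qed.
Definition kaut_V (s : kaut) : kaut :=
  @KAut (kaut_inv s) s (kautKV s) (kautK s) (kaut_inv_const s).

Fact kaut_mulA : associative kaut_mul. Proof. by move=> s t u; exact: kaut_eq. Qed.
Fact kaut_mul1 : left_id kaut_one kaut_mul. Proof. by move=> s; exact: kaut_eq. Qed.
Fact kaut_mulr1 : right_id kaut_one kaut_mul. Proof. by move=> s; exact: kaut_eq. Qed.
Fact kaut_mulV : left_inverse kaut_one kaut_V kaut_mul.
Proof. by move=> s; apply: kaut_eq => x /=; rewrite kautK. Qed.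
Fact kaut_mulrV : right_inverse kaut_one kaut_V kaut_mul.
Proof. by move=> s; apply: kaut_eq => x /=; rewrite kautKV. Qed.

HB.instance Definition _ := isGroup.Build kaut
  kaut_mulA kaut_mul1 kaut_mulr1 kaut_mulV kaut_mulrV.
End KAut.

Record finsubgroup (gT : groupType) := FinSubgroup {
  fsg_set :> {fset gT};
  fsg_closed : group_closed (mem fsg_set) }.

Section SubKfield.
Variables (k : fieldType) (L : kfield k) (S : subfield L).
Hypothesis const_S : forall c, kf_const L c \in sf_mem S.

Definition sub_const c : sf_type S := SfElt (const_S c).
Fact sub_const_zmod : zmod_morphism sub_const.
Proof. by move=> a b; apply/val_inj; rewrite /= rmorphB. Qed.
Fact sub_const_monoid : monoid_morphism sub_const.
Proof. by split=> [|a b]; apply/val_inj; rewrite /= ?rmorph1 ?rmorphM. Qed.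
HB.instance Definition _ :=
  GRing.isZmodMorphism.Build k (sf_type S) sub_const sub_const_zmod.
HB.instance Definition _ :=
  GRing.isMonoidMorphism.Build k (sf_type S) sub_const sub_const_monoid.

Definition sub_kfield : kfield k := KField sub_const.
End SubKfield.

Lemma kx_eval (k : fieldType) (L : kfield k) (x : L) (p : {poly k}) :
  (map_poly (kf_const L) p).[x] \in sf_mem (kx x).
Proof.
by apply/asboolP; exists p, 1; rewrite rmorph1 hornerC oner_neq0 divr1.
Qed.

Lemma kx_const (k : fieldType) (L : kfield k) (x : L) c :
  kf_const L c \in sf_mem (kx x).
Proof. by have := kx_eval x c%:P; rewrite map_polyC hornerC. Qed.

Section FixedField.
Variables (k : fieldType) (L : kfield k) (H : finsubgroup (kaut L)).

Definition fixed_mem : {pred L} := fun f => all (fun s : kaut L => s f == f) H.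

Lemma fixedP f : reflect (forall s, s \in fsg_set H -> s f = f) (f \in fixed_mem).
Proof. by apply: (iffP allP) => fH s sH; apply/eqP/fH. Qed.

Lemma fixed_closed : divring_closed fixed_mem.
Proof.
split=> [|x y /fixedP xH /fixedP yH|x y /fixedP xH /fixedP yH]; apply/fixedP => s sH.
- exact: rmorph1.
- by rewrite rmorphB xH ?yH.
- by rewrite fmorph_div xH ?yH.
Qed.

Definition fixed : subfield L := Subfield fixed_closed.

Lemma const_fixed c : kf_const L c \in sf_mem fixed.
Proof. by apply/fixedP => s _; apply: kaut_const. Qed.

Definition fixed_kfield : kfield k := sub_kfield const_fixed.

Definition orbit_poly (x : L) : {poly L} := \prod_(s <- H) ('X - (s x)%:P).

Lemma orbit_poly_monic x : orbit_poly x \is monic.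
Proof. exact: monic_prod_XsubC. Qed.

Lemma orbit_poly_root x : root (orbit_poly x) x.
Proof.
have [H1 _] := fsg_closed H.
by rewrite /orbit_poly -(big_map (fun s : kaut L => s x) xpredT (fun y => 'X - y%:P)) root_prod_XsubC;
   apply/mapP; exists 1%g.
Qed.

Lemma orbit_poly_fixed x : exists2 q : {poly fixed_kfield},
  q \is monic & orbit_poly x = map_poly val q.
Proof.
have pH i : (orbit_poly x)`_i \in sf_mem fixed.
  apply/fixedP => s sH; rewrite -coef_map; congr (_`_ i).
  rewrite /orbit_poly rmorph_prod /=.
  under eq_bigr => t _ do rewrite rmorphB /= map_polyX map_polyC /=.
  have gH := fsg_closed H; have [H1 _] := gH.
  rewrite -(big_map (fun t : kaut L => (s * t)%g) xpredT (fun t : kaut L => 'X - (t x)%:P)).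
  rewrite (perm_big (enum_fset H)) //; apply: uniq_perm.
  - by rewrite map_inj_uniq ?fset_uniq //; apply: mulgI.
  - exact: fset_uniq.
  - move=> t; apply/mapP/idP => [[u uH ->]|tH].
      exact: (group_closedM gH).
    exists (s^-1 * t)%g; last by rewrite mulgA mulgV mul1g.
    by apply: (group_closedM gH) => //; apply: (group_closedV gH).
exists (\poly_(i < size (orbit_poly x)) (SfElt (pH i) : fixed_kfield)).
  rewrite monicE lead_coef_poly /=.
  - by apply/eqP/val_inj; rewrite /= -/(lead_coef _) (monicP (orbit_poly_monic x)).
  - by rewrite size_poly_gt0 monic_neq0 // orbit_poly_monic.
  - apply/negP => /eqP/(congr1 val)/=; rewrite -/(lead_coef _) (monicP (orbit_poly_monic x)).
    by move/eqP; rewrite oner_eq0.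
apply/polyP => i; rewrite coef_map coef_poly.
by case: ltnP => [//|/leq_sizeP->].
Qed.
End FixedField.

Lemma nonconstant_transcendental (k : closedFieldType) (L : kfield k) (y : L) :
  (forall c, y <> kf_const L c) -> transcendental y.
Proof.
move=> ync p py; apply/eqP; rewrite -lead_coef_eq0; apply/negP => /negP lp0.
have [r pE] := closed_field_poly_normal p.
move: py; rewrite pE map_polyZ /= rootZ ?fmorph_eq0 // rmorph_prod /=.
under eq_bigr => a _ do rewrite rmorphB /= map_polyX map_polyC /=.
rewrite -(big_map (kf_const L) xpredT (fun a => 'X - a%:P)) root_prod_XsubC.
by case/mapP => c _; apply: ync.
Qed.

Lemma fixed_transcendental (k : closedFieldType) (L : kfield k)
    (H : finsubgroup (kaut L)) (x : L) :
  transcendental x -> exists y : fixed_kfield H, transcendental y.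
Proof.
move=> xt; have [q qmon qE] := orbit_poly_fixed H x.
have [[y ync]|allc] := pselect (exists y : fixed_kfield H, forall c, y <> kf_const _ c).
  by exists y; apply: nonconstant_transcendental.
have /choice[h hE] : forall y : fixed_kfield H, exists c, y = kf_const _ c.
  by move=> y; apply: contrapT => nc; apply: allc; exists y => c yc; apply: nc; exists c.
pose p : {poly k} := \poly_(i < size q) h q`_i.
have pq : map_poly (kf_const L) p = map_poly val q.
  apply/polyP => i; rewrite !coef_map coef_poly.
  case: ltnP => [_|/leq_sizeP/(_ i (leqnn i)) ->].
    by rewrite [in RHS](hE q`_i).
  exact: (etrans (rmorph0 (kf_const L))) (erefl _).
have p0 : p = 0 by apply: xt; rewrite pq -qE orbit_poly_root.
have /eqP := qE; rewrite -pq p0 rmorph0 => /eqP orb0.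
by have := orbit_poly_monic H x; rewrite orb0 monicE lead_coef0 eq_sym oner_eq0.
Qed.

Lemma kx_common_denominator (k : fieldType) (L : kfield k) (x : L) m
    (u : 'I_m -> L) : (forall i, u i \in sf_mem (kx x)) ->
  exists (d : L) (a : 'I_m -> {poly k}), d != 0 /\
    forall i, u i * d = (map_poly (kf_const L) (a i)).[x].
Proof.
move=> uk.
have /choice[p /choice[q pqE]] : forall i, exists p q : {poly k},
    (map_poly (kf_const L) q).[x] != 0 /\
    u i = (map_poly (kf_const L) p).[x] / (map_poly (kf_const L) q).[x].
  by move=> i; have /asboolP := uk i.
exists (\prod_i (map_poly (kf_const L) (q i)).[x]).
exists (fun i => p i * \prod_(j | j != i) q j); split.
  by apply/prodf_neq0 => i _; case: (pqE i).
move=> i; rewrite (bigD1 i) //= rmorphM hornerM rmorph_prod horner_prod.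
by have [qi0 ->] := pqE i; rewrite mulrA divfK.
Qed.

Lemma horner_map_poly_def (E F : fieldType) (f : {rmorphism E -> F}) n
    (a : nat -> E) (x : F) :
  (map_poly f (\poly_(i < n) a i)).[x] = \sum_(i < n) f (a i) * x ^+ i.
Proof.
rewrite (horner_coef_wide _ (n := n)) ?size_map_poly ?size_poly //.
by apply: eq_bigr => i _; rewrite coef_map coef_poly ltn_ord.
Qed.

Section FixedFunctionField.
Variables (k : closedFieldType) (L : kfield k) (H : finsubgroup (kaut L)).
Let F := fixed_kfield H.
Variable (y : F).
Let E := sub_kfield (kx_const y).
Let e : {rmorphism E -> F} := val.
Let j : {rmorphism F -> L} := val.

Let jconst c : j (kf_const F c) = kf_const L c. Proof. by []. Qed.
Let econst c : e (kf_const E c) = kf_const F c. Proof. by []. Qed.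

Lemma fixed_algebraic (x : L) n (b : 'I_n -> L) : transcendental y ->
  (forall z : L, exists2 c : 'I_n -> L, (forall i, c i \in sf_mem (kx x))
                         & z = \sum_(i < n) c i * b i) ->
  algebraicOver (j \o e) x.
Proof.
move=> yt spanL; pose Ex := sub_kfield (kx_const x).
have /choice[A AE] : forall i : 'I_n.+1, exists c : 'I_n -> Ex,
    j y ^+ i = \sum_l val (c l) * b l.
  move=> i; have [c ck ->] := spanL (j y ^+ i).
  by exists (fun l => SfElt (ck l)).
have [u [i0 ui0] u0] := span_dependent (e := val : {rmorphism Ex -> L}) (leqnn _) AE.
have [d [a [d0 aE]]] := kx_common_denominator (fun i => valP (u i)).
have sum0 : \sum_i (map_poly (kf_const L) (a i)).[x] * j y ^+ i = 0.
  under eq_bigr => i _ do rewrite -aE mulrAC.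
  by rewrite -mulr_suml u0 mul0r.
have ai0 : a i0 != 0.
  apply: contra_neq ui0 => a0; apply/val_inj/(mulIf d0).
  by rewrite aE a0 rmorph0 horner0 mul0r.
pose N := \max_i size (a i).
have aN i : (size (a i) <= N)%N by rewrite /N (bigD1 i) //= leq_maxl.
pose t l : {poly k} := \poly_(i < n.+1) (a (inord i))`_l.
pose g (p : {poly k}) : E := SfElt (kx_eval y p).
pose r : {poly E} := \poly_(l < N) g (t l).
exists r.
  pose l := (size (a i0)).-1.
  have lN : (l < N)%N.
    by apply: leq_trans (aN i0); rewrite /l prednK // size_poly_gt0.
  apply/eqP => /(congr1 (fun r : {poly E} => r`_l)); rewrite coef_poly lN coef0.
  move/(congr1 val) => /= /eqP/yt/(congr1 (fun p : {poly k} => p`_i0)).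
  rewrite coef_poly ltn_ord inord_val coef0 => /eqP.
  by rewrite -/(lead_coef _) lead_coef_eq0 (negPf ai0).
apply/eqP; rewrite -sum0 horner_map_poly_def.
transitivity (\sum_(l < N) \sum_(i < n.+1) kf_const L (a i)`_l * j y ^+ i * x ^+ l).
  apply: eq_bigr => l _ /=; rewrite -mulr_suml; congr (_ * _).
  rewrite horner_map_poly_def.
  have -> : \val (\sum_(i < n.+1) kf_const F (a (inord i))`_l * y ^+ i) =
     j (\sum_(i < n.+1) kf_const F (a (inord i))`_l * y ^+ i) by [].
  rewrite rmorph_sum; apply: eq_bigr => i _.
  by rewrite rmorphM rmorphXn inord_val.
rewrite exchange_big; apply: eq_bigr => i _.
rewrite (horner_coef_wide _ (n := N)) ?size_map_poly // mulr_suml.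
by apply: eq_bigr => l _; rewrite coef_map mulrAC.
Qed.

Lemma fixed_finite (x : L) n (b : 'I_n -> L) : transcendental y ->
  (forall z : L, exists2 c : 'I_n -> L, (forall i, c i \in sf_mem (kx x))
                         & z = \sum_(i < n) c i * b i) ->
  exists m (v : 'I_m -> F), forall f, exists c : 'I_m -> E,
    f = \sum_i e (c i) * v i.
Proof.
move=> yt spanL; have [m rP] := adjoin_span (fixed_algebraic yt spanL).
pose I : finType := ('I_n * 'I_m)%type.
pose w (t : I) := x ^+ t.2 * b t.1.
apply: (@subspace_span _ _ _ e j #|I|
  (fun t => w (enum_val t))) => z.
have [c ck ->] := spanL z.
have /choice[r rE] : forall i, exists r : {poly E}, (size r <= m)%N /\
    c i = (map_poly (j \o e) r).[x].
  move=> i; have /asboolP[p [q [q0 ->]]] := ck i.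
  have pE (s : {poly k}) : map_poly (kf_const L) s =
      map_poly (j \o e) (map_poly (kf_const E) s).
    by rewrite -map_poly_comp; apply: eq_map_poly => a.
  have [|r rm rE] := rP (map_poly (kf_const E) p) (map_poly (kf_const E) q).
    by rewrite -pE.
  by exists r; rewrite -rE -!pE.
pose c' (t : I) := (r t.1)`_(nat_of_ord t.2).
exists (fun t => c' (enum_val t)).
rewrite -(big_enum_val (A := I) (fun t : I => j (e (c' t)) * w t)) /=.
rewrite -(pair_bigA _ (fun (i : 'I_n) (l : 'I_m) => j (e (c' (i, l))) * w (i, l))) /=.
apply: eq_bigr => i _; have [rm ->] := rE i.
rewrite (horner_coef_wide _ (n := m)) ?size_map_poly // mulr_suml.
by apply: eq_bigr => l _; rewrite coef_map /w /= mulrA.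
Qed.
End FixedFunctionField.

Lemma fixed_function_field (k : closedFieldType) (L : kfield k)
    (H : finsubgroup (kaut L)) :
  function_field L -> function_field (fixed_kfield H).
Proof.
case=> x [xt [n [b spanL]]]; have [y yt] := fixed_transcendental H xt.
exists y; split=> //; have [m [v vE]] := fixed_finite yt spanL.
exists m, v => f; have [c ->] := vE f.
by exists (fun i => sf_val (c i)) => // i; apply: valP.
Qed.

Section Points.
Variables (k : fieldType) (C : curve k).

(* Valuation rings k <= O < K; these are automatically discrete, with residue *)
(* field k.                                                                   *)
Record cpoint := Point {
  pt_ring :> C -> Prop;
  pt_const : forall c, pt_ring (kf_const C c);
  pt_sub : forall f g, pt_ring f -> pt_ring g -> pt_ring (f - g);
  pt_mul : forall f g, pt_ring f -> pt_ring g -> pt_ring (f * g);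
  pt_val : forall f, pt_ring f \/ pt_ring f^-1;
  pt_proper : exists f, ~ pt_ring f }.

HB.instance Definition _ := gen_eqMixin cpoint.
HB.instance Definition _ := gen_choiceMixin cpoint.

Definition max_ideal (P : cpoint) : set C :=
  [set f | P f /\ forall g, P g -> f * g <> 1].

(* f is regular at P with f(P) = c.                                           *)
Definition has_value (P : cpoint) (f : C) (c : k) :=
  max_ideal P (f - kf_const C c).

Definition divisor := {freeg cpoint / int}.
Definition pt_div (P : cpoint) : divisor := << P >>.
End Points.

(* An automorphism s of the curve is identified with f |-> f o s^-1 on the    *)
(* function field. This makes Aut(C) -> Aut_k(k(C)) a group isomorphism.      *)
Notation aut C := (kaut (curve_ff C)).

Section Action.
Variables (k : fieldType) (C : curve k) (s : aut C) (P : cpoint C).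

(* f is regular at s(P) iff f o s is regular at P.                            *)
Let act_ring (f : C) : Prop := P (kaut_inv s f).

Fact act_const c : act_ring (kf_const C c).
Proof. by rewrite /act_ring /= kaut_inv_const; apply: pt_const. Qed.
Fact act_sub f g : act_ring f -> act_ring g -> act_ring (f - g).
Proof. by rewrite /act_ring /= rmorphB; apply: pt_sub. Qed.
Fact act_mul f g : act_ring f -> act_ring g -> act_ring (f * g).
Proof. by rewrite /act_ring /= rmorphM; apply: pt_mul. Qed.
Fact act_val f : act_ring f \/ act_ring f^-1.
Proof. by rewrite /act_ring /= fmorphV; apply: pt_val. Qed.
Fact act_proper : exists f, ~ act_ring f.
Proof. by have [f Pf] := pt_proper P; exists (s f); rewrite /act_ring /= kautK. Qed.

Definition act : cpoint C := Point act_const act_sub act_mul act_val act_proper.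
End Action.

Definition pt_orbit k (C : curve k) (G : finsubgroup (aut C)) (P : cpoint C) :
  set (cpoint C) := [set act s P | s in [set` fsg_set G]].

Definition curve_iso k (C D : curve k) :=
  exists phi : {rmorphism D -> C},
    bijective phi /\ forall c, phi (kf_const D c) = kf_const C c.

Definition ratfun_kfield (k : fieldType) : kfield k :=
  KField (@tofrac {poly k} \o polyC).

Lemma ratfun_horner (k : fieldType) (p : {poly k}) :
  (map_poly (kf_const (ratfun_kfield k)) p).[tofrac 'X] = tofrac p.
Proof.
rewrite map_poly_comp -[LHS]/((map_poly _ _).[_]) horner_map.
by congr (tofrac _); rewrite -[RHS]comp_polyXr.
Qed.

Lemma frac_numden (R : idomainType) (y : {fraction R}) :
  exists n d : R, d != 0 /\ y = tofrac n / tofrac d.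
Proof.
exists \n_(repr y), \d_(repr y); have dn0 := denom_ratioP (repr y); split=> //.
apply: (mulIf (x := tofrac \d_(repr y))); first by rewrite tofrac_eq0.
rewrite divfK ?tofrac_eq0 // -{1}[y]reprK; unfold GRing.mul; rewrite /= !piE.
apply/eqmodP; rewrite /= FracField.equivfE !numden_Ratio ?mulr1 ?oner_eq0 ?mulf_neq0 ?oner_neq0 //.
by rewrite mulrC.
Qed.

Lemma ratfun_function_field (k : fieldType) :
  function_field (ratfun_kfield k).
Proof.
exists (tofrac 'X); split.
  by move=> p /eqP; rewrite ratfun_horner => /eqP; rewrite tofrac_eq0 => /eqP.
exists 1%N, (fun=> 1) => y; exists (fun=> y); last by rewrite big_ord1 mulr1.
move=> _; have [p [q [q0 ->]]] := frac_numden y.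
by apply/asboolP; exists p, q; rewrite !ratfun_horner tofrac_eq0.
Qed.

Definition proj_line (k : fieldType) : curve k :=
  Curve (ratfun_function_field k).

Section Quotient.
Variables (k : closedFieldType) (C : curve k) (H : finsubgroup (aut C)).

Definition quotient_curve : curve k :=
  Curve (fixed_function_field H (curveP C)).

Section QuotientPoint.
Variable P : cpoint C.

Let quo_ring (f : quotient_curve) : Prop := P (val f).

Fact quo_const c : quo_ring (kf_const quotient_curve c).
Proof. exact: pt_const. Qed.
Fact quo_sub f g : quo_ring f -> quo_ring g -> quo_ring (f - g).
Proof. exact: pt_sub. Qed.
Fact quo_mul f g : quo_ring f -> quo_ring g -> quo_ring (f * g).
Proof. exact: pt_mul. Qed.
Fact quo_val f : quo_ring f \/ quo_ring f^-1.
Proof.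
rewrite /quo_ring (fmorphV (val : {rmorphism fixed_kfield H -> C}) f).
exact: pt_val.
Qed.
Fact quo_proper : exists f, ~ quo_ring f.
Proof.
have [x Px] := pt_proper P; apply: contrapT => nf; apply: Px.
have Pq (f : quotient_curve) : P (val f).
  by apply: contrapT => Pf; apply: nf; exists f.
have P0 : P 0 by have := pt_const P 0; rewrite rmorph0.
have P1 : P 1 by have := pt_const P 1; rewrite rmorph1.
have PD f g : P f -> P g -> P (f + g).
  by move=> Pf Pg; rewrite -[g]opprK; apply: pt_sub => //; rewrite -sub0r; apply: pt_sub.
have PX f m : P f -> P (f ^+ m).
  by move=> Pf; elim: m => [|m IH]; rewrite ?expr0 ?exprS //; apply: pt_mul.
have [//|Pxi] := pt_val P x.
have [->//|x0] := eqVneq x 0.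
have [q qmon qE] := orbit_poly_fixed H x.
have qx : root (map_poly val q) x by rewrite -qE orbit_poly_root.
have q0 : (0 < size q)%N by rewrite size_poly_gt0 monic_neq0.
have lq : val q`_(size q).-1 = 1 :> C by rewrite -/(lead_coef q) (monicP qmon).
have : \sum_(i < (size q).-1) val q`_i * x ^+ i + x ^+ (size q).-1 == 0.
  apply/eqP; rewrite -[RHS](rootP qx).
  rewrite (horner_coef_wide _ (n := (size q).-1.+1)); last first.
    by rewrite size_map_poly prednK.
  rewrite big_ord_recr; congr (_ + _).
    by apply: eq_bigr => i _; rewrite coef_map.
  by rewrite coef_map -[LHS]mul1r -lq.
case: (size q).-1 => [|m]; first by rewrite big_ord0 add0r expr0 oner_eq0.
rewrite addrC addr_eq0 => /eqP xm.
have -> : x = - \sum_(i < m.+1) val q`_i * x^-1 ^+ (m - i).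
  apply: (mulIf (x := x ^+ m)); first by rewrite expf_neq0.
  rewrite -exprS xm mulNr mulr_suml; congr (- _); apply: eq_bigr => i _.
  rewrite -mulrA; congr (_ * _).
  have im : (i <= m)%N by rewrite -ltnS.
  have <- : x ^+ (m - i) * x ^+ i = x ^+ m by rewrite -exprD subnK.
  by rewrite mulrA exprVn mulVf ?mul1r // expf_neq0.
rewrite -sub0r; apply: pt_sub => //; apply: (big_ind P) => // i _.
by apply: pt_mul; [apply: Pq|apply: PX].
Qed.

Definition quo_map : cpoint quotient_curve :=
  Point quo_const quo_sub quo_mul quo_val quo_proper.
End QuotientPoint.
End Quotient.

Section Plane.
Variable k : fieldType.

(* Points of P^2 are the lines of k^3.                                        *)
Record plane_point := PlanePoint {
  pp_line :> {vspace 'rV[k]_3};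
  pp_dim : \dim pp_line = 1%N }.

Definition hom_eval (L : kfield k) n (A : {mpoly k[n]}) (x : 'rV[L]_n) : L :=
  mmap (kf_const L) (x 0) A.

(* The subfield of all A(x) / B(x), with A, B forms of the same degree.       *)
Definition ratio_field (L : kfield k) n (x : 'rV[L]_n) : set L :=
  [set f | exists d (A B : {mpoly k[n]}),
    [/\ A \is d.-homog, B \is d.-homog, hom_eval B x != 0
      & f = hom_eval A x / hom_eval B x]].

Record plane_curve := PlaneCurve {
  pc_deg : nat;
  pc_eqn : {mpoly k[3]};
  pc_homog : pc_eqn \is pc_deg.-homog;
  pc_nonconst : (1 < msize pc_eqn)%N;
  pc_irred : forall A B : {mpoly k[3]},
    pc_eqn = A * B -> (msize A <= 1)%N \/ (msize B <= 1)%N }.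

Definition pc_points (X : plane_curve) : set plane_point :=
  [set p | forall v, v \in pp_line p -> (pc_eqn X).@[v 0] = 0].

Definition smooth_point (X : plane_curve) (p : plane_point) :=
  pc_points X p /\
  exists2 v, v \in pp_line p & exists i, ((pc_eqn X)^`M(i)).@[v 0] <> 0.

(* k(X), determined up to a unique isomorphism by homogeneous coordinates of  *)
(* a generic point of X.                                                      *)
Record pc_function_field (X : plane_curve) := PCFunctionField {
  pff :> kfield k;
  pff_coord : 'rV[pff]_3;
  pff_eqn : forall d (A : {mpoly k[3]}), A \is d.-homog ->
    hom_eval A pff_coord = 0 <-> exists B, A = B * pc_eqn X;
  pff_gen : ratio_field pff_coord = setT }.

(* v |-> v *m N is the linear projection P^2 --> P^1 with centre p; any two   *)
(* such N differ by an automorphism of P^1.                                   *)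
Definition projection_from (p : plane_point) (N : 'M[k]_(3, 2)) :=
  \rank N = 2%N /\ forall v, v \in pp_line p -> v *m N = 0.

(* pi_p^* k(P^1) inside k(X).                                                 *)
Definition proj_subfield X (M : pc_function_field X) (p : plane_point) : set M :=
  [set f | exists2 N, projection_from p N
                    & ratio_field (pff_coord M *m map_mx (kf_const M) N) f].

Arguments proj_subfield {X} M p _.

Definition coef_in (L : fieldType) (E : set L) (q : {poly L}) := forall i, E q`_i.

Definition minimal_poly (L : fieldType) (E : set L) (f : L) (q : {poly L}) :=
  [/\ q \is monic, coef_in E q, root q f
    & forall r, r != 0 -> coef_in E r -> root r f -> (size q <= size r)%N].

(* Algebraic, separable and normal: minimal polynomials over E exist, are     *)
(* separable, and split in L.                                                 *)
Definition galois_extension (L : fieldType) (E : set L) :=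
  forall f, exists q, [/\ minimal_poly E f q, coprimep q q^`()
    & exists s : seq L, q = \prod_(a <- s) ('X - a%:P)].

Definition galois_group (L : kfield k) (E : set L) : set (kaut L) :=
  [set s | forall f, E f -> s f = f].

Definition galois_point X (M : pc_function_field X) (p : plane_point) :=
  galois_extension (proj_subfield M p).

Definition inner_galois_point X (M : pc_function_field X) (p : plane_point) :=
  galois_point M p /\ smooth_point X p.

(* psi is the morphism (g_0 : g_1 : g_2), defined at each Q after rescaling   *)
(* by some h; the last condition says that psi^* is an isomorphism from the   *)
(* function field of the image onto that of D.                                *)
Definition birational_embedding (D : curve k) (psi : cpoint D -> plane_point) :=
  exists g : 'rV[D]_3,
    [/\ g != 0,
        forall Q, exists (h : D) (v : 'rV[k]_3),
          [/\ v != 0, v \in pp_line (psi Q)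
            & forall i, has_value Q (h * g 0 i) (v 0 i)]
      & ratio_field g = setT].
End Plane.
Arguments proj_subfield {k X} M p _.

Definition group_iso (gT rT : groupType) (A : set gT) (B : set rT) :=
  exists2 phi : gT -> rT, set_bij A B phi
    & forall x y, A x -> A y -> phi (x * y)%g = (phi x * phi y)%g.

Definition mulset (gT : groupType) (A B : {fset gT}) : {fset gT} :=
  [fset (x * y)%g | x in A, y in B]%fset.

(* h ^ x is the conjugate x^-1 h x.                                           *)
Definition semidirect (gT : groupType) (H G : finsubgroup gT) :=
  [/\ group_closed (mem (mulset H G)),
      forall h x, h \in fsg_set H -> x \in mulset H G -> (h ^ x)%g \in fsg_set H
    & (H `&` G)%fset = [fset 1%g]%fset].

(* Main.v *)
Require Import Defs.
From HB Require Import structures.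
From mathcomp Require Import all_boot all_order all_algebra.
From mathcomp Require Import finmap boolp classical_sets functions.
From mathcomp Require Import freeg mpoly.
From mathcomp Require Import ring zify.
From mathcomp Require Import separable.

Set Implicit Arguments.
Unset Strict Implicit.
Unset Printing Implicit Defensive.

Import Order.TTheory GRing.Theory Num.Theory.
Local Open Scope ring_scope.

(** Write [K] for the function field of [C] and [D] for the quotient [C/H], with
    function field [K^H].

    For a single curve [D] with groups [G1], [G2] and points [P1], [P2], let [f]
    generate the invariants of [G1], with its poles along the orbit of [P2], and
    [g] those of [G2], with its poles along the orbit of [P1]. A generator has
    at each point of that orbit a pole of order the size of the stabilizer
    ([generates_pole_divisor]), so the divisor of poles of [f] is the sum of the
    [s P2], that of [g] the sum of the [t P1], and the divisor condition compares
    them: both are dominated by [E = P1 + sum of the s P2 = P2 + sum of the t P1],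
    of degree [n + 1] with [n = #G1 = #G2]. Hence [(f : g : 1)] maps [D] to a
    curve of degree [n + 1], the points [P1] and [P2] go to [(0 : 1 : 0)] and
    [(1 : 0 : 0)], and projecting from these gives [f] and [g], that is, the
    Galois extensions with groups [G1] and [G2]. As the groups meet trivially,
    [g] has [n] conjugates over [k(f)], so [f] and [g] generate the function
    field; as the projections have degree [n], one less than the degree of the
    curve, the two points are smooth.

    The degree is obtained from the equation itself. After a change of
    coordinates that puts a pole of [f] at [P1], the characteristic polynomial of
    [g] over [k(f)] has polynomial coefficients and homogenizes to a form of
    degree [n + 1] whose top term in [X_1] is [X_1^n X_2] ([equation_exists]).
    Every form is congruent, modulo it, to one in which no monomial is divisible
    by [X_1^n X_2], and such a form vanishes at the generic point only if it is
    zero, by comparing poles at [P1] or by counting conjugates of [g]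
    ([reduced_zero]). So this form generates the ideal of the curve.

    The points of a curve being the valuation rings of its function field, the
    tools are built on these: Chevalley's theorem ([place_above]) for the
    existence of points, discreteness ([uniformizer_exists]), weak
    approximation, and the equality of ramification indices with orders of
    stabilizers. The last rests on [ramification_ge], an argument with Dedekind's
    independence of characters, and on norms of functions given by
    approximation.

    To apply this to [C/H], [G1] and [G2] are restricted to [K^H]; the restriction
    maps are injective, and the images meet trivially by the hypothesis on
    [H] and [G1 G2]. The divisor condition is pushed forward along the quotient
    map. What remains is that the invariants of [H G1] are again generated by one
    function: the norm over [H] of [f - c] has poles of the least order that
    ramification allows, along one orbit of [H G1], and a function with this
    property generates ([minimal_pole_generates], [product_group_generator]). *)

(** * Valuation rings of a function field *)

Section PlaceBasics.
Variables (k : closedFieldType) (C : curve k).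
Local Notation cst := (kf_const C).
Implicit Types (P Q : cpoint C) (f g x y z : C) (c : k).

Definition reg (P : cpoint C) : {pred C} := fun f => `[< P f >].

Definition mx (P : cpoint C) : {pred C} :=
  fun f => (f == 0) || (f^-1 \notin reg P).

Lemma in_mx P f : (f \in mx P) = (f == 0) || (f^-1 \notin reg P).
Proof. by []. Qed.

Lemma notin_mx P f : (f \notin mx P) = (f != 0) && (f^-1 \in reg P).
Proof. by rewrite in_mx negb_or negbK. Qed.

Lemma regP P f : reflect (P f) (f \in reg P).
Proof. exact: asboolP. Qed.

Lemma reg_cst P c : cst c \in reg P.
Proof. by apply/regP/pt_const. Qed.

Lemma reg_subring_closed P : subring_closed (reg P).
Proof.
split=> [|f g /regP Pf /regP Pg|f g /regP Pf /regP Pg]; apply/regP.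
- by have := pt_const P 1; rewrite rmorph1.
- exact: pt_sub.
- exact: pt_mul.
Qed.

HB.instance Definition _ P :=
  GRing.isSubringClosed.Build C (reg P) (reg_subring_closed P).

Lemma regM P f g : f \in reg P -> g \in reg P -> f * g \in reg P.
Proof. exact: rpredM. Qed.

Lemma regX P f n : f \in reg P -> f ^+ n \in reg P.
Proof. exact: rpredX. Qed.

Lemma regD P f g : f \in reg P -> g \in reg P -> f + g \in reg P.
Proof. exact: rpredD. Qed.

Lemma regB P f g : f \in reg P -> g \in reg P -> f - g \in reg P.
Proof. exact: rpredB. Qed.

Lemma reg_total P f : (f \in reg P) || (f^-1 \in reg P).
Proof. by case: (pt_val P f) => /regP -> //; rewrite orbT. Qed.

Lemma nreg_neq0 P f : f \notin reg P -> f != 0.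
Proof. by apply: contraNneq => ->; apply: rpred0. Qed.

Lemma nreg_invmx P f : f \notin reg P -> f^-1 \in mx P.
Proof. by move=> nf; rewrite in_mx invrK nf orbT. Qed.

Lemma mx_inv_nreg P f : f != 0 -> f \in mx P -> f^-1 \notin reg P.
Proof. by move=> f0; rewrite in_mx (negPf f0). Qed.

Lemma mx0 P : 0 \in mx P.
Proof. by rewrite in_mx eqxx. Qed.

Lemma mx_reg P f : f \in mx P -> f \in reg P.
Proof.
rewrite in_mx => /orP[/eqP->|nf]; first exact: rpred0.
by have := reg_total P f; rewrite (negPf nf) orbF.
Qed.

Lemma mx1 P : 1 \notin mx P.
Proof. by rewrite in_mx oner_eq0 invr1 rpred1. Qed.

Lemma mxMr P f g : f \in mx P -> g \in reg P -> f * g \in mx P.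
Proof.
move=> fm gr; rewrite in_mx.
have [//|/= fg0] := eqVneq (f * g) 0.
have f0 : f != 0 by apply: contraNneq fg0 => ->; rewrite mul0r.
have g0 : g != 0 by apply: contraNneq fg0 => ->; rewrite mulr0.
apply: contra (mx_inv_nreg f0 fm) => h.
have -> : f^-1 = (f * g)^-1 * g by rewrite invfM divfK.
exact: regM.
Qed.

Lemma mxMl P f g : f \in reg P -> g \in mx P -> f * g \in mx P.
Proof. by move=> fr gm; rewrite mulrC mxMr. Qed.

Lemma mxD P f g : f \in mx P -> g \in mx P -> f + g \in mx P.
Proof.
wlog fg : f g / f / g \in reg P => [W|] fm gm.
  have [/W->//|h] := boolP (f / g \in reg P).
  rewrite addrC W //; have := reg_total P (f / g).
  by rewrite (negPf h) invf_div.
have [->|g0] := eqVneq g 0; first by rewrite addr0.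
by rewrite -[f](divfK g0) -[X in _ + X]mul1r -mulrDl mxMl // regD ?rpred1.
Qed.

Lemma mxN P f : f \in mx P -> - f \in mx P.
Proof. by move=> fm; rewrite -mulN1r mxMl // rpredN rpred1. Qed.

Lemma mxB P f g : f \in mx P -> g \in mx P -> f - g \in mx P.
Proof. by move=> fm gm; rewrite mxD ?mxN. Qed.

Lemma mx_sum P (I : Type) (r : seq I) (p : pred I) (F : I -> C) :
  (forall i, p i -> F i \in mx P) -> \sum_(i <- r | p i) F i \in mx P.
Proof. by move=> h; apply: (big_ind (fun x => x \in mx P)) => //; [apply: mx0|apply: mxD]. Qed.

Lemma unit_regP P f : f \in reg P -> f \notin mx P -> f^-1 \in reg P.
Proof. by move=> _; rewrite notin_mx => /andP[]. Qed.

Lemma nmx_neq0 P f : f \notin mx P -> f != 0.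
Proof. by apply: contraNneq => ->; apply: mx0. Qed.

Lemma nmxM P f g : f \notin mx P -> g \notin mx P -> f * g \notin mx P.
Proof.
rewrite !notin_mx invfM.
by move=> /andP[f0 fr] /andP[g0 gr]; rewrite mulf_neq0 ?regM.
Qed.

Lemma nmx_prod P (I : Type) (r : seq I) (F : I -> C) :
  (forall i, F i \notin mx P) -> \prod_(i <- r) F i \notin mx P.
Proof. by move=> h; apply: (big_ind (fun x => x \notin mx P)) => //; [apply: mx1|apply: nmxM]. Qed.

Lemma mx_cst P c : (cst c \in mx P) = (c == 0).
Proof.
apply/idP/eqP => [cm|->]; last by rewrite rmorph0 mx0.
apply/eqP; apply: contraTT cm => c0.
by rewrite in_mx fmorph_eq0 (negPf c0) -fmorphV reg_cst.
Qed.

Lemma max_idealP P f : max_ideal P f <-> f \in mx P.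
Proof.
split=> [[Pf fg]|fm].
  rewrite in_mx; have [//|/= f0] := eqVneq f 0.
  by apply/negP => /regP/fg; rewrite divff.
split=> [|g /regP gr fg]; first by apply/regP/mx_reg.
by have := mxMr fm gr; rewrite fg (negPf (mx1 P)).
Qed.

Lemma value_uniq P f c d : f - cst c \in mx P -> f - cst d \in mx P -> c = d.
Proof.
move=> fc fd; apply/eqP; rewrite -subr_eq0 -(mx_cst P) rmorphB.
have -> : cst c - cst d = (f - cst d) - (f - cst c) by ring.
exact: mxB.
Qed.

Lemma cpoint_eq P Q : (forall f, (f \in reg P) = (f \in reg Q)) -> P = Q.
Proof.
move=> PQ; have {PQ} : pt_ring P = pt_ring Q.
  by apply: funext => f; apply: propext; split=> /regP;
    [rewrite PQ|rewrite -PQ] => /regP.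
case: P Q => [p a b c d e] [q a' b' c' d' e'] /= pq.
case: _ / pq in a' b' c' d' e' *.
by rewrite (Prop_irrelevance a a') (Prop_irrelevance b b') (Prop_irrelevance c c')
  (Prop_irrelevance d d') (Prop_irrelevance e e').
Qed.

(** ** Polynomials in one function *)

Definition ev (y : C) : {rmorphism {poly k} -> C} :=
  horner_morph (fun a => mulrC y (cst a)).

Arguments ev : simpl never.

Lemma evE y p : ev y p = (map_poly cst p).[y]. Proof. by []. Qed.
Lemma evX y : ev y 'X = y. Proof. exact: horner_morphX. Qed.
Lemma evC y c : ev y c%:P = cst c. Proof. exact: horner_morphC. Qed.
Lemma evXsubC y c : ev y ('X - c%:P) = y - cst c.
Proof. by rewrite rmorphB /= evX evC. Qed.
Lemma evZ y c p : ev y (c *: p) = cst c * ev y p.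
Proof. by rewrite -mul_polyC rmorphM /= evC. Qed.

Definition nonconst (y : C) := forall c, y <> cst c.

Lemma ev_eq0 y p : nonconst y -> (ev y p == 0) = (p == 0).
Proof.
move=> ny; apply/idP/eqP => [|->]; last by rewrite rmorph0.
exact: (nonconstant_transcendental ny).
Qed.

Lemma ev_reg P y p : y \in reg P -> ev y p \in reg P.
Proof.
move=> yr; rewrite evE horner_coef rpred_sum // => i _.
by rewrite coef_map regM ?regX ?reg_cst.
Qed.

Lemma ev_value P y c p : y - cst c \in mx P -> ev y p - cst p.[c] \in mx P.
Proof.
move=> yc; have yr : y \in reg P by rewrite -(subrK (cst c) y) regD ?reg_cst ?mx_reg.
have : root (p - p.[c]%:P) c by rewrite rootE hornerD hornerN hornerC subrr.
move/factor_theorem=> [q /(congr1 (ev y))].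
rewrite rmorphB rmorphM /= evC evXsubC => ->.
by rewrite mxMl ?ev_reg.
Qed.

Lemma mx_nonconst P y : y != 0 -> y \in mx P -> nonconst y.
Proof.
by move=> y0 ym c yc; move: ym y0; rewrite yc mx_cst fmorph_eq0 => ->.
Qed.

Lemma nreg_nonconst P y : y \notin reg P -> nonconst y.
Proof. by move=> yP c yc; rewrite yc reg_cst in yP. Qed.

Lemma integral_reg P z q :
  q \is monic -> (forall i, q`_i \in reg P) -> root q z -> z \in reg P.
Proof.
move=> qm qr qz; apply: contraT => nz.
have zr : z^-1 \in reg P by have := reg_total P z; rewrite (negPf nz).
have z0 := nreg_neq0 nz.
have sq : (0 < size q)%N by rewrite size_poly_gt0 monic_neq0.
move: qz; rewrite rootE horner_coef -(prednK sq) big_ord_recr /=.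
rewrite -/(lead_coef q) (monicP qm) mul1r.
case En : (size q).-1 => [|n].
  by rewrite big_ord0 add0r expr0 oner_eq0.
rewrite addrC addr_eq0 => /eqP zE.
have zn : z ^+ n != 0 by rewrite expf_neq0.
case/negP: nz; rewrite -(mulfK zn z) -exprS zE mulNr rpredN mulr_suml rpred_sum // => i _.
have -> : z ^+ n = z ^+ i * z ^+ (n - i) by rewrite -exprD subnKC // -ltnS.
rewrite invfM !mulrA mulfK ?expf_neq0 // -exprVn.
by rewrite regM ?regX.
Qed.

Lemma finite_over (y : C) : nonconst y ->
  exists n, forall z : 'I_n.+1 -> C, exists p : 'I_n.+1 -> {poly k},
    (exists i, p i != 0) /\ \sum_i ev y (p i) * z i = 0.
Proof.
(* The trivial group presents the whole field as a field of invariants. *)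
move=> ny; have gH : group_closed (mem [fset (1%g : aut C)]%fset).
  split=> [|s t /fset1P-> /fset1P->]; apply/fset1P => //.
  by rewrite mulgV.
pose H := FinSubgroup gH.
have inH (z : C) : z \in sf_mem (fixed H).
  by apply/fixedP => s /fset1P ->.
pose lft (z : C) : fixed_kfield H := SfElt (inH z).
have ty : transcendental (lft y).
  apply: nonconstant_transcendental => c /(congr1 val) /=; exact: ny.
have [x [_ [m [b bE]]]] := curveP C.
have [n [v vE]] := fixed_finite ty bE.
exists n => z.
have /choice[A AE] : forall i, exists u : 'I_n -> sub_kfield (kx_const (lft y)),
    lft (z i) = \sum_(j < n) val (u j) * v j.
  by move=> i; have [u ->] := vE (lft (z i)); exists u.
have [u [i0 ui0] u0] :=
  span_dependent (e := val : {rmorphism sub_kfield (kx_const (lft y)) -> fixed_kfield H})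
    (leqnn _) AE.
have [d [a [d0 aE]]] := kx_common_denominator (fun i => valP (u i)).
pose vl : {rmorphism fixed_kfield H -> C} := val.
have evl p : vl (map_poly (kf_const (fixed_kfield H)) p).[lft y] = ev y p.
  rewrite -horner_map evE; congr (_.[_]).
  by rewrite -[LHS](map_poly_comp vl (kf_const (fixed_kfield H))); apply: eq_map_poly.
exists a; split.
  exists i0; apply: contra_neq ui0 => ai0; apply/val_inj/(mulIf d0).
  by rewrite aE ai0 rmorph0 horner0 mul0r.
have := congr1 (fun w => vl (w * d)) u0; rewrite mul0r rmorph0 mulr_suml.
rewrite rmorph_sum => S0; rewrite -[RHS]S0; apply: eq_bigr => i _.
by rewrite mulrAC aE rmorphM evl.
Qed.

(** A pole of [x] at a place where [y] is regular can be cancelled by a single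
    polynomial in [y]: the leading coefficient of an algebraic equation of [x]
    over [k[y]]. *)
Lemma clear_denominator (x y : C) : nonconst y ->
  exists2 b, b != 0 & forall P, y \in reg P -> ev y b * x \in reg P.
Proof.
move=> ny; have [n /(_ (fun i => x ^+ i))[p [[i0 pi0] S0]]] := finite_over ny.
pose d := [arg max_(i > i0 | p i != 0%R) (i : nat)]%N.
have [pd dmax] : p d != 0 /\ forall i : 'I_n.+1, (d < i)%N -> p i = 0.
  rewrite /d; case: arg_maxnP => // j pj jmax; split=> // i ji.
  by apply/eqP; apply: contraLR ji => /jmax; rewrite -leqNgt.
exists (p d) => // P yr.
pose z := ev y (p d) * x.
have Pd0 : ev y (p d) != 0 by rewrite ev_eq0.
have S1 : \sum_(i < d) ev y (p (inord i)) * x ^+ i + ev y (p d) * x ^+ d = 0.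
  rewrite -[RHS]S0 (bigD1 d) //= addrC; congr (_ + _).
  rewrite (bigID (fun i : 'I_n.+1 => (i < d)%N)) /= [X in _ = _ + X]big1 ?addr0; last first.
    move=> i /andP[ind]; rewrite -leqNgt leq_eqVlt eq_sym => /orP[/eqP/val_inj e|/dmax->].
      by rewrite e eqxx in ind.
    by rewrite rmorph0 mul0r.
  rewrite (big_ord_widen n.+1 (fun i => ev y (p (inord i)) * x ^+ i)); last exact: ltnW.
  apply: eq_big => i; last by rewrite inord_val.
  by apply/idP/andP => [id|[]//]; split=> //; apply: contraTneq id => ->; rewrite ltnn.
have [d0|d0] := posnP d.
  by move/eqP: S1; rewrite d0 big_ord0 add0r expr0 mulr1 (negPf Pd0).
(* Multiplying the equation by [p_d(y)^(d-1)] makes it monic in [z]. *)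
pose q0 : {poly C} := \poly_(i < d) ev y (p (inord i) * p d ^+ (d.-1 - i)).
pose q := 'X^d + q0.
have sz : (size q0 < size ('X^d : {poly C}))%N.
  by rewrite size_polyXn ltnS size_poly.
apply: (integral_reg (q := q)).
- by rewrite monicE /q lead_coefDl // lead_coefXn.
- move=> i; rewrite coefD coefXn coef_poly regD ?rpred_nat //.
  by case: ifP => _; rewrite ?rpred0 ?ev_reg.
rewrite rootE hornerD hornerXn horner_poly.
apply/eqP; move/(congr1 (fun w => ev y (p d) ^+ d.-1 * w)): S1.
rewrite mulr0 mulrDr addrC [X in X + _]mulrA -exprSr prednK // -exprMn => S1.
rewrite -[RHS]S1 mulr_sumr; congr (_ + _); apply: eq_bigr => i _.
rewrite rmorphM rmorphXn /= exprMn.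
rewrite -[in RHS](@subnK i d.-1); last by rewrite -ltnS prednK.
by rewrite exprD; ring.
Qed.

(** The residue field is [k]: were [f - c] a unit for every constant [c], the
    ring would contain [k(f)], and being integrally closed it would be all of
    the function field. *)
Lemma value_ex P f : f \in reg P -> exists c, f - cst c \in mx P.
Proof.
move=> fr; apply: contrapT => nc.
have {}nc c : f - cst c \notin mx P by apply/negP => h; apply: nc; exists c.
have nf : nonconst f by move=> c fc; have := nc c; rewrite fc subrr mx0.
have unit_ev p : p != 0 -> ev f p \notin mx P.
  move=> p0; have [r pE] := closed_field_poly_normal p.
  rewrite pE evZ rmorph_prod nmxM ?mx_cst ?lead_coef_eq0 //.
  by apply: nmx_prod => a; rewrite evXsubC.
have [x /regP/negP[]] := pt_proper P.
have [b b0 /(_ P fr) bx] := clear_denominator x nf.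
have := unit_regP (ev_reg b fr) (unit_ev b b0).
by move/regM => /(_ _ bx); rewrite mulKf // (nmx_neq0 (unit_ev b b0)).
Qed.

Lemma archimedean P y x : y != 0 -> y \in mx P -> exists m, y ^+ m * x \in reg P.
Proof.
move=> y0 ym; have ny := mx_nonconst y0 ym.
have [b b0 /(_ P (mx_reg ym)) bx] := clear_denominator x ny.
(* Away from its power of [y], the denominator is a unit at [P]. *)
have [m [q qr bE]] := multiplicity_XsubC b 0; rewrite b0 /= in qr.
exists m.
have qn : ev y q \notin mx P.
  apply: contra qr => qm; have ym0 : y - cst 0 \in mx P by rewrite rmorph0 subr0.
  have h := mxB qm (ev_value q ym0).
  by rewrite rootE -(mx_cst P); move: h; rewrite opprB addrC subrK.
have q0 := nmx_neq0 qn.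
have qi : (ev y q)^-1 \in reg P by apply: unit_regP => //; apply/ev_reg/mx_reg.
rewrite -[X in X \in _](mulKf q0) regM // mulrA.
by move: bx; rewrite bE rmorphM rmorphXn /= evXsubC rmorph0 subr0.
Qed.

End PlaceBasics.

(** * Existence of places *)

Section PlaceExists.
Variables (k : closedFieldType) (C : curve k).
Local Notation cst := (kf_const C).

(** A subset of [bool * C] codes a subring together with an ideal of it, so that
    Zorn's lemma for sets applies to such pairs. *)
Definition ring_with_ideal (R I : C -> Prop) (S : set (bool * C)) :=
  let A x := S (true, x) in let J x := S (false, x) in
  [/\ forall x, R x -> A x, forall x, I x -> J x,
      (forall x y, A x -> A y -> A (x - y)) /\ (forall x y, A x -> A y -> A (x * y)),
      (forall x y, J x -> J y -> J (x - y)) /\ (forall x y, A x -> J y -> J (x * y))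
    & ~ J 1 /\ forall x, J x -> A x].

Definition coefs_in (S : C -> Prop) (p : {poly C}) := forall i, S p`_i.

Lemma sub_closed_sum (S : C -> Prop) : S 0 -> (forall x y, S x -> S y -> S (x - y)) ->
  forall (I : Type) (r : seq I) (p : pred I) F, (forall i, p i -> S (F i)) ->
    S (\sum_(i <- r | p i) F i).
Proof.
move=> S0 SB I r p F SF; apply: (big_ind S) => // x y Sx Sy.
by rewrite -[y]opprK; apply: (SB) => //; rewrite -sub0r; apply: SB.
Qed.

(** The relations say that 1 lies in the ideals generated by [J] in [A[x]] and in
    [A[1/x]]; at minimal degrees this is absurd. *)
Lemma ideal_relation_reduce (A J : C -> Prop) (x : C) (p q : {poly C}) :
    A 1 -> (forall u v, A u -> A v -> A (u - v)) -> (forall u, J u -> A u) ->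
    (forall u v, J u -> J v -> J (u - v)) -> (forall u v, A u -> J v -> J (u * v)) ->
    ~ J 1 -> x != 0 ->
    coefs_in J p -> coefs_in J q -> p.[x] = 1 -> q.[x^-1] = 1 ->
    (size q <= size p)%N ->
  exists p', [/\ coefs_in J p', p'.[x] = 1 & (size p' < size p)%N].
Proof.
move=> A1 AB JA JB AJ J1 x0 Jp Jq px qx sqp.
have J0 : J 0 by rewrite -(subrr p`_0); apply: JB.
have JD u v : J u -> J v -> J (u + v).
  by move=> Ju Jv; rewrite -[v]opprK; apply: (JB) => //; rewrite -sub0r; apply: JB.
case Ep : (size p) => [|n].
  by move/eqP: Ep px; rewrite size_poly_eq0 => /eqP->; rewrite horner0 => /esym/eqP; rewrite oner_eq0.
have px' : \sum_(i < n) p`_i * x ^+ i + p`_n * x ^+ n = 1.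
  by rewrite -px horner_coef Ep big_ord_recr.
have qx' : q`_0 + \sum_(i < n) q`_i.+1 * x^-1 ^+ i.+1 = 1.
  by rewrite -qx (horner_coef_wide _ (n := n.+1)) -?Ep // Ep big_ord_recl expr0 mulr1.
have [n0|n0] := posnP n.
  case: J1; move: px'; rewrite n0 big_ord0 add0r expr0 mulr1 => <-; exact: Jp.
(* In [(1 - q_0) p(x) = 1 - q_0] the top term of [p] is rewritten by
   [1 - q_0 = sum_(j > 0) q_j / x^j]. *)
pose r : {poly C} := (q`_0)%:P + (1 - q`_0) *: (\poly_(i < n) p`_i)
  + p`_n *: (\poly_(i < n) q`_(n - i)).
exists r; split.
- move=> i; rewrite /r !coefD coefC !coefZ !coef_poly.
  apply: (JD); first apply: (JD).
  + by case: ifP => _; [apply: Jq|].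
  + by case: ifP => _; (apply: (AJ); [apply: (AB) => //; apply/JA/Jq|]).
  + by case: ifP => _; apply: AJ => //; apply/JA/Jp.
- rewrite /r !hornerD hornerC !hornerZ !horner_poly.
  have -> : \sum_(i < n) q`_(n - i) * x ^+ i = x ^+ n * (1 - q`_0).
    rewrite -qx' [q`_0 + _]addrC addrK mulr_sumr (reindex_inj rev_ord_inj) /=.
    apply: eq_bigr => i _; rewrite subKn ?ltn_ord //.
    by rewrite -[in x ^+ n](subnK (ltn_ord i)) exprD exprVn mulrCA mulfK ?expf_neq0.
  have -> : \sum_(i < n) p`_i * x ^+ i = 1 - p`_n * x ^+ n by rewrite -px' addrK.
  ring.
- rewrite ltnS (leq_trans (size_polyD _ _)) // geq_max (leq_trans (size_polyD _ _)) ?geq_max /=.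
    by rewrite (leq_trans (size_scale_leq _ _)) ?size_poly.
  rewrite (leq_trans (size_polyC_leq1 _)) //.
  by rewrite (leq_trans (size_scale_leq _ _)) ?size_poly.
Qed.

(** Chevalley's extension theorem: a pair maximal for [ring_with_ideal] is a
    valuation ring with its maximal ideal, since a pair that cannot be enlarged
    by [x] nor by [1/x] would give two relations contradicting
    [ideal_relation_reduce] at minimal degree. *)
Lemma place_above (R I : C -> Prop) :
    (forall c, R (cst c)) -> (forall x y, R x -> R y -> R (x - y)) ->
    (forall x y, R x -> R y -> R (x * y)) ->
    (forall x y, I x -> I y -> I (x - y)) -> (forall x y, R x -> I y -> I (x * y)) ->
    (forall x, I x -> R x) -> ~ I 1 -> (exists2 x, x != 0 & I x) ->
  exists P : cpoint C, (forall x, R x -> x \in reg P) /\ forall x, I x -> x \in mx P.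
Proof.
move=> Rc RB RM IB RI IR I1 [x0 x0n Ix0].
pose base : set (bool * C) := fun bx => if bx.1 then R bx.2 else I bx.2.
have good0 : ring_with_ideal R I base by [].
pose Pr S := S = set0 \/ ring_with_ideal R I S.
(* The empty set is allowed in [Pr] as the union of the empty chain. *)
have [F FP tot|S [PS maxS]] := @Zorn_bigcup _ Pr.
  have [[S0 FS0 gS0]|nog] := pselect (exists2 S0, F S0 & ring_with_ideal R I S0); last first.
    left; apply/seteqP; split=> // z [S FS Sz]; case: (FP _ FS) => [SE|gS].
      by rewrite SE in Sz.
    by case: nog; exists S.
  have gF S z : F S -> S z -> ring_with_ideal R I S.
    by move=> FS Sz; case: (FP _ FS) => // SE; rewrite SE in Sz.
  right; case: (gS0) => RA IJ _ _ _; split.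
  - by move=> x Rx; exists S0 => //; apply: RA.
  - by move=> x Ix; exists S0 => //; apply: IJ.
  - split=> x y [S FS Sx] [T FT Ty]; have [ST|TS] := tot _ _ FS FT.
    + by exists T => //; case: (gF _ _ FT Ty) => _ _ [+ _ _ _]; apply => //; apply: ST.
    + by exists S => //; case: (gF _ _ FS Sx) => _ _ [+ _ _ _]; apply => //; apply: TS.
    + by exists T => //; case: (gF _ _ FT Ty) => _ _ [_ + _ _]; apply => //; apply: ST.
    + by exists S => //; case: (gF _ _ FS Sx) => _ _ [_ + _ _]; apply => //; apply: TS.
  - split=> x y [S FS Sx] [T FT Ty]; have [ST|TS] := tot _ _ FS FT.
    + by exists T => //; case: (gF _ _ FT Ty) => _ _ _ [+ _ _]; apply => //; apply: ST.
    + by exists S => //; case: (gF _ _ FS Sx) => _ _ _ [+ _ _]; apply => //; apply: TS.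
    + by exists T => //; case: (gF _ _ FT Ty) => _ _ _ [_ + _]; apply => //; apply: ST.
    + by exists S => //; case: (gF _ _ FS Sx) => _ _ _ [_ + _]; apply => //; apply: TS.
  - split=> [[S FS S1]|x [S FS Sx]].
      by case: (gF _ _ FS S1) => _ _ _ _ [].
    by exists S => //; case: (gF _ _ FS Sx) => _ _ _ _ [_]; apply.
case: PS => [SE|gS].
  have Ix0' : base (false, x0) by [].
  case: (maxS _ _ (or_intror good0)); rewrite SE; split=> // h; exact: (h _ Ix0').
case: (gS) => RA IJ [AB AM] [JB AJ] [J1 JA].
pose A x := S (true, x); pose J x := S (false, x).
have A0 : A 0 by rewrite -(rmorph0 cst); apply/RA/Rc.
have A1 : A 1 by rewrite -(rmorph1 cst); apply/RA/Rc.
have J0 : J 0 by rewrite -(subrr x0); apply: JB; apply: IJ.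
have AS := sub_closed_sum A0 AB.
have JS := sub_closed_sum J0 JB.
have adjoin x : ~ A x -> exists2 p, coefs_in J p & p.[x] = 1.
  move=> nAx; apply: contrapT => nop.
  pose T : set (bool * C) := fun bx =>
    exists2 p, coefs_in (if bx.1 then A else J) p & bx.2 = p.[x].
  have ST : (S `<=` T)%classic.
    move=> [b y] Sy; exists y%:P; last by rewrite hornerC.
        move=> i; rewrite coefC; case: b Sy => /= Sy; case: ifP => _; first exact: Sy.
        exact: A0.
      exact: Sy.
    exact: J0.
  have gT : ring_with_ideal R I T.
    split; [by move=> y /RA Ay; apply: ST|by move=> y /IJ Jy; apply: ST| | | split].
    + split=> _ _ [p /= Ap ->] [q /= Aq ->].
        exists (p - q); rewrite ?hornerD ?hornerN // => i; rewrite coefB; exact: (AB _ _ (Ap i) (Aq i)).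
      exists (p * q); rewrite ?hornerM // => i; rewrite coefM.
      by apply: AS => j _; exact: (AM _ _ (Ap j) (Aq _)).
    + split=> _ _ [p /= Ap ->] [q /= Aq ->].
        exists (p - q); rewrite ?hornerD ?hornerN // => i; rewrite coefB; exact: (JB _ _ (Ap i) (Aq i)).
      exists (p * q); rewrite ?hornerM // => i; rewrite coefM.
      by apply: JS => j _; exact: (AJ _ _ (Ap j) (Aq _)).
    + by case=> p Jp p1; apply: nop; exists p.
    + by move=> _ [p /= Jp ->]; exists p => // i; apply/JA/Jp.
  apply: (maxS T); last by right.
  split=> // TS; apply/nAx/TS; exists 'X; last by rewrite hornerX.
  by move=> i; rewrite coefX; case: eqP.
have val x : A x \/ A x^-1.
  have [->|xn0] := eqVneq x 0; first by left.
  apply: contrapT => /not_orP[/adjoin exp /adjoin exq].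
  have minrel (z : C) : (exists2 p, coefs_in J p & p.[z] = 1) -> exists p,
      [/\ coefs_in J p, p.[z] = 1 &
        forall q, coefs_in J q -> q.[z] = 1 -> (size p <= size q)%N].
    move=> [p Jp pz].
    pose B n := `[< exists p, [/\ coefs_in J p, p.[z] = 1 & size p = n] >].
    have exB : exists n, B n by exists (size p); apply/asboolP; exists p.
    have [n /asboolP[p' [Jp' pz' sp']] nmin] := ex_minnP exB.
    by exists p'; split=> // q Jq qz; rewrite sp'; apply: nmin; apply/asboolP; exists q.
  have [p [Jp px pmin]] := minrel _ exp; have [q [Jq qx qmin]] := minrel _ exq.
  have red := @ideal_relation_reduce A J.
  have [qp|/ltnW pq] := leqP (size q) (size p).
    have [r [Jr rx]] := red x p q A1 AB JA JB AJ J1 xn0 Jp Jq px qx qp.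
    by rewrite ltnNge pmin.
  have px' : p.[x^-1^-1] = 1 by rewrite invrK.
  have xin0 : x^-1 != 0 by rewrite invr_eq0.
  have [r [Jr rx]] := red x^-1 q p A1 AB JA JB AJ J1 xin0 Jq Jp qx px' pq.
  by rewrite ltnNge qmin.
have Jinv x : x != 0 -> J x -> ~ A x^-1.
  by move=> xn0 Jx Axi; apply: J1; rewrite -(mulVf xn0); apply: AJ.
have prop : exists x, ~ A x by exists x0^-1; apply: Jinv => //; apply: IJ.
pose P := @Point k C A (fun c => RA _ (Rc c)) AB AM val prop.
exists P; split=> x; first by move=> /RA Ax; apply/regP.
move=> /IJ Jx; rewrite in_mx; have [//|/= xn0] := eqVneq x 0.
by apply/negP => /regP; apply: Jinv.
Qed.

Lemma place_at_value (y : C) c : nonconst y -> exists P, y - cst c \in mx P.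
Proof.
move=> ny.
pose R x := exists p, x = ev y p; pose I x := exists p, x = ev y (p * ('X - c%:P)).
have [||||||||P [_ IP]] := @place_above R I; last first.
- by exists P; apply: IP; exists 1; rewrite mul1r evXsubC.
- exists (y - cst c); last by exists 1; rewrite mul1r evXsubC.
  by rewrite subr_eq0; apply/eqP/ny.
- case=> p /esym/eqP; rewrite -subr_eq0 -(rmorph1 (ev y)) -rmorphB ev_eq0 // => /eqP.
  move/(congr1 (horner^~ c)); rewrite hornerD hornerN !hornerE subrr mulr0 sub0r => /eqP.
  by rewrite oppr_eq0 oner_eq0.
- by move=> _ [p ->]; exists (p * ('X - c%:P)).
- by move=> _ _ [p ->] [q ->]; exists (p * q); rewrite -rmorphM mulrA.
- by move=> _ _ [p ->] [q ->]; exists (p - q); rewrite mulrBl rmorphB.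
- by move=> _ _ [p ->] [q ->]; exists (p * q); rewrite rmorphM.
- by move=> _ _ [p ->] [q ->]; exists (p - q); rewrite rmorphB.
- by move=> d; exists d%:P; rewrite evC.
Qed.

Lemma nonconst_inv (y : C) : nonconst y -> nonconst y^-1.
Proof. by move=> ny c yc; apply: (ny c^-1); rewrite fmorphV -yc invrK. Qed.

Lemma nonconst_neq0 (y : C) : nonconst y -> y != 0.
Proof. by move=> ny; apply/eqP => y0; apply: (ny 0); rewrite rmorph0. Qed.

Lemma pole_exists (y : C) : nonconst y -> exists P, y \notin reg P.
Proof.
move=> ny; have nyi := nonconst_inv ny; have [P] := place_at_value 0 nyi.
rewrite rmorph0 subr0 => /mx_inv_nreg; rewrite invrK => h.
by exists P; apply: h; apply: nonconst_neq0.
Qed.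

End PlaceExists.

(** * Orders at a place *)

Section Order.
Variables (k : closedFieldType) (C : curve k).
Local Notation cst := (kf_const C).
Implicit Types (P Q : cpoint C) (f g x y z : C).

Lemma nreg_exists P : exists x, x \notin reg P.
Proof. by have [x nx] := pt_proper P; exists x; apply/negP => /regP. Qed.

Lemma split_off_X n (p : 'I_n -> {poly k}) : (exists i, p i != 0) ->
  exists m (q : 'I_n -> {poly k}),
    (exists i, ~~ root (q i) 0) /\ forall i, p i = q i * 'X^m.
Proof.
case=> i0; have [s] := ubnP (size (p i0)); elim: s p => // s IHs p sp p0.
have [[i pi]|allr] := pselect (exists i, ~~ root (p i) 0).
  by exists 0%N, p; split=> [|j]; [exists i|rewrite expr0 mulr1].
have /choice[q qE] : forall i, exists q, p i = q * 'X.
  move=> i; have /factor_theorem[q] : root (p i) 0.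
    by apply/negPn/negP => h; apply: allr; exists i.
  by rewrite subr0 => ->; exists q.
have q0 : q i0 != 0 by apply: contraNneq p0 => q0; rewrite qE q0 mul0r.
have [|//|m [r [rr rE]]] := IHs q.
  by move: sp; rewrite qE size_mulX.
by exists m.+1, r; split=> // i; rewrite qE rE exprSr mulrA.
Qed.

(** Valuation rings over [k] are discrete: elements of strictly decreasing
    positive order, all below the order of [y], are independent over [k(y)],
    over which the function field is finite. *)
Lemma uniformizer_exists P : exists t : C,
  [/\ t != 0, t \in mx P & forall x, x \in mx P -> x / t \in reg P].
Proof.
have [x0 nx0] := nreg_exists P.
apply: contrapT => not_unif.
pose small (t : C) := t != 0 /\ t \in mx P.
have /choice[next nextP] : forall t, exists t', small t -> small t' /\ t / t' \in mx P.
  move=> t; have [[t0 tm]|] := pselect (small t); last by exists 0.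
  apply: contrapT => none; apply: not_unif; exists t; split=> // x xm.
  apply: contrapT => /negP nxt; apply: none; exists x => _; split; last first.
    by have := nreg_invmx nxt; rewrite invf_div.
  by split=> //; apply: contraNneq nxt => ->; rewrite mul0r rpred0.
pose t i := iter i next x0^-1.
have ts i : small (t i).
  elim: i => [|i IHi]; last by case: (nextP _ IHi).
  by split; [rewrite invr_eq0 (nreg_neq0 nx0)|apply: nreg_invmx].
have tlt i j : (i < j)%N -> t i / t j \in mx P.
  elim: j => // j IHj; have [_ tj] := nextP _ (ts j).
  rewrite ltnS leq_eqVlt => /orP[/eqP->|/IHj tij]; first exact: tj.
  have [tj0 _] := ts j.
  rewrite -(divfK tj0 (t i)) -[X in X \in _]mulrA.
  exact: (mxMr tij (mx_reg tj)).
clearbody t; have [y0 ym] := ts 0%N; have ny := mx_nonconst y0 ym.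
(* The terms [t 1, .., t (n+1)] all have order less than that of [y = t 0]. *)
have [n /(_ (fun i => t i.+1))[p [pn0 S0]]] := finite_over ny.
have [m [q [[i0 qi0] pE]]] := split_off_X pn0.
have {S0} S0 : \sum_i ev (t 0%N) (q i) * t i.+1 = 0.
  have ym0 : t 0%N ^+ m != 0 by rewrite expf_neq0.
  apply: (mulfI ym0); rewrite mulr0 -[RHS]S0 mulr_sumr; apply: eq_bigr => i _.
  by rewrite pE rmorphM rmorphXn /= evX; ring.
(* The last term whose coefficient is a unit has the smallest order. *)
pose d := [arg max_(i > i0 | ~~ root (q i) 0%R) (i : nat)]%N.
have [qd dmax] : ~~ root (q d) 0 /\ forall i : 'I_n.+1, (d < i)%N -> root (q i) 0.
  rewrite /d; case: arg_maxnP => // j pj jmax; split=> // i ji.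
  by apply: contraLR ji => /jmax; rewrite -leqNgt.
have ym0 : t 0%N - cst 0 \in mx P by rewrite rmorph0 subr0.
have [d0 dm] := ts d.+1.
have qdn : ev (t 0%N) (q d) \notin mx P.
  apply: contra qd => qm; have h := mxB qm (ev_value (q d) ym0).
  by rewrite rootE -(mx_cst P); move: h; rewrite opprB addrC subrK.
case/negP: qdn; rewrite -[X in X \in _](mulfK d0).
move/eqP: S0; rewrite (bigD1 d) //= addr_eq0 => /eqP ->.
rewrite mulNr mxN // mulr_suml mx_sum // => i id.
rewrite -mulrA; have [idl|dil|ide] := ltngtP i d.
- by rewrite mxMl ?tlt // ev_reg ?mx_reg.
- have /factor_theorem[r ->] := dmax _ dil.
  rewrite rmorphM /= evXsubC rmorph0 subr0.
  have -> : ev (t 0%N) r * t 0%N * (t i.+1 / t d.+1)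
     = (ev (t 0%N) r * t i.+1) * (t 0%N / t d.+1) by ring.
  rewrite mxMl ?tlt // regM ?ev_reg ?mx_reg //.
  by case: (ts i.+1).
- by case/eqP: id; apply/val_inj.
Qed.

Definition unif P : C := projT1 (cid (uniformizer_exists P)).

Lemma unifP P : [/\ unif P != 0, unif P \in mx P &
  forall x, x \in mx P -> x / unif P \in reg P].
Proof. exact: (projT2 (cid (uniformizer_exists P))). Qed.

Lemma unif_neq0 P : unif P != 0. Proof. by case: (unifP P). Qed.
Lemma unif_mx P : unif P \in mx P. Proof. by case: (unifP P). Qed.
Hint Resolve unif_neq0 unif_mx : core.

Lemma unit_factor P x : x != 0 -> exists m : int, x / unif P ^ m \in reg P /\
  x / unif P ^ m \notin mx P.
Proof.
have t0 := unif_neq0 P; have tm := unif_mx P; set t := unif P in t0 tm *.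
wlog xr : x / x \in reg P => [W|] x0.
  have [/W/(_ x0)//|nx] := boolP (x \in reg P).
  have [] := W x^-1; rewrite ?mx_reg ?nreg_invmx ?invr_eq0 // => m [mr mm].
  exists (- m); rewrite -invr_expz invrK -[x]invrK -[t ^ m]invrK -invfM.
  split; first exact: unit_regP.
  rewrite notin_mx invr_eq0 invrK mr andbT; exact: nmx_neq0 mm.
have [M xM] := archimedean x^-1 t0 tm.
pose B n := x / t ^+ n \in reg P.
have B0 : exists n, B n by exists 0%N; rewrite /B expr0 divr1.
have Bmax n : B n -> (n <= M)%N.
  move=> Bn; rewrite leqNgt; apply/negP => Mn.
  have := regM Bn xM; rewrite -/t.
  have -> : x / t ^+ n * (t ^+ M * x^-1) = (t ^+ (n - M))^-1.
    have {1}-> : n = ((n - M) + M)%N by rewrite subnK // ltnW.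
    by rewrite exprD; field; rewrite x0 !expf_neq0.
  apply/negP/mx_inv_nreg; rewrite ?expf_neq0 //.
  have : (0 < n - M)%N by rewrite subn_gt0.
  case: (n - M)%N => // r _; rewrite exprS mxMr //.
  by rewrite regX // mx_reg.
have [m Bm mmax] := ex_maxnP B0 Bmax.
exists m; split=> //; apply/negP => mm.
have : B m.+1.
  case: (unifP P) => _ _ /(_ _ mm); rewrite /B exprSr invfM mulrA; exact.
by move/mmax; rewrite ltnn.
Qed.

Definition ord P x : int := xget 0 (fun m : int =>
  x / unif P ^ m \in reg P /\ x / unif P ^ m \notin mx P).

(** The relation [m <= ord P x] for [x != 0], extended to hold at [x = 0], which
    makes it stable under sums; [ord P 0] has the junk value 0. *)
Definition vge P (m : int) x := x / unif P ^ m \in reg P.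

Lemma ord_unit P x : x != 0 -> x / unif P ^ ord P x \in reg P /\
  x / unif P ^ ord P x \notin mx P.
Proof. by move=> x0; rewrite /ord; case: xgetP (unit_factor P x0) => // h [m /h]. Qed.

Lemma unif_exp_reg P (m : int) : (unif P ^ m \in reg P) = (0 <= m).
Proof.
case: m => m; first by rewrite regX ?mx_reg.
apply/negbTE; rewrite NegzE /= -invr_expz; apply: mx_inv_nreg.
  by rewrite expfz_neq0.
by rewrite /= -exprnP exprS mxMr // regX // mx_reg.
Qed.

Lemma vge_ord P m x : x != 0 -> vge P m x = (m <= ord P x).
Proof.
move=> x0; have [ur um] := ord_unit P x0.
rewrite /vge -subr_ge0 -(unif_exp_reg P).
have t0 := unif_neq0 P; set u := x / _ in ur um.
have u0 := nmx_neq0 um.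
have -> : x / unif P ^ m = u * unif P ^ (ord P x - m).
  by rewrite expfzDr // mulrA /u divfK ?expfz_neq0 // invr_expz.
apply/idP/idP => h; last exact: regM.
by rewrite -[X in X \in _](mulKf u0) regM // unit_regP.
Qed.

Lemma vge0 P m : vge P m 0. Proof. by rewrite /vge mul0r rpred0. Qed.

Lemma reg_vge P x : (x \in reg P) = vge P 0 x.
Proof. by rewrite /vge expr0z divr1. Qed.

Lemma reg_ord P x : x != 0 -> (x \in reg P) = (0 <= ord P x).
Proof. by move=> x0; rewrite reg_vge vge_ord. Qed.

Lemma ord_zero P : ord P 0 = 0.
Proof. by rewrite /ord; case: xgetP => [m _ [_]|//]; rewrite mul0r mx0. Qed.

Lemma ordM P x y : x != 0 -> y != 0 -> ord P (x * y) = ord P x + ord P y.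
Proof.
move=> x0 y0; have [xr xm] := ord_unit P x0; have [yr ym] := ord_unit P y0.
have [zr zm] := ord_unit P (mulf_neq0 x0 y0); have t0 := unif_neq0 P.
have tz m : unif P ^ m != 0 by rewrite expfz_neq0.
have h : x * y / unif P ^ (ord P x + ord P y) = x / unif P ^ ord P x * (y / unif P ^ ord P y).
  by rewrite expfzDr // invfM mulrACA.
apply/eqP; rewrite eq_le -!vge_ord ?mulf_neq0 //; apply/andP; split; last first.
  by rewrite /vge h regM.
rewrite -subr_ge0 -(unif_exp_reg P).
have -> : unif P ^ (ord P x + ord P y - ord P (x * y)) =
   x * y / unif P ^ ord P (x * y) * (x / unif P ^ ord P x * (y / unif P ^ ord P y))^-1.
  rewrite -h expfzDr // -[unif P ^ (- _)]invr_expz invf_div.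
  by rewrite [RHS]mulrC mulrA divfK ?mulf_neq0.
by apply: regM => //; apply: unit_regP; [apply: regM|apply: nmxM].
Qed.

Lemma ord_one P : ord P 1 = 0.
Proof.
have := ordM P (oner_neq0 C) (oner_neq0 C); rewrite mulr1 => /esym/eqP.
by rewrite -subr_eq0 addrK => /eqP.
Qed.

Lemma ordV P x : ord P x^-1 = - ord P x.
Proof.
have [->|x0] := eqVneq x 0; last first.
  apply/eqP; rewrite -addr_eq0 -ordM ?invr_eq0 // mulVf //; exact/eqP/ord_one.
by rewrite invr0 ord_zero oppr0.
Qed.

Lemma ordX P x n : x != 0 -> ord P (x ^+ n) = ord P x *+ n.
Proof.
move=> x0; elim: n => [|n IHn]; first by rewrite expr0 ord_one.
by rewrite exprS ordM ?expf_neq0 // IHn mulrS.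
Qed.

Lemma ord_prod P (I : Type) (r : seq I) (F : I -> C) : (forall i, F i != 0) ->
  ord P (\prod_(i <- r) F i) = \sum_(i <- r) ord P (F i).
Proof.
move=> F0; elim: r => [|i r IHr]; first by rewrite !big_nil ord_one.
rewrite !big_cons ordM ?IHr //.
by elim/big_ind: _ => [|u v|//]; [apply: oner_neq0|apply: mulf_neq0].
Qed.

Lemma mx_ord P x : x != 0 -> (x \in mx P) = (0 < ord P x).
Proof.
move=> x0; rewrite in_mx (negPf x0) /= reg_ord ?invr_eq0 // ordV -ltNge.
by rewrite oppr_lt0.
Qed.

Lemma nreg_ord P x : x \notin reg P -> ord P x < 0.
Proof. by move=> nx; rewrite ltNge -reg_ord // (nreg_neq0 nx). Qed.

Lemma ord_unif P : ord P (unif P) = 1.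
Proof.
apply/eqP; rewrite eq_le; have t0 := unif_neq0 P.
rewrite -gtz0_ge1 -mx_ord // unif_mx andbT.
have [r0 _] := ord_unit P t0.
have : vge P (ord P (unif P)) (unif P) by rewrite vge_ord.
rewrite /vge -{1}[unif P]expr1z invr_expz -expfzDr // unif_exp_reg.
by rewrite subr_ge0.
Qed.

Lemma ord_gen P t : t != 0 -> t \in mx P ->
  (forall x, x \in mx P -> x / t \in reg P) -> ord P t = 1.
Proof.
move=> t0 tm tg; apply/eqP; rewrite eq_le -gtz0_ge1 -mx_ord // tm andbT.
have := tg _ (unif_mx P); rewrite reg_ord ?mulf_neq0 ?invr_eq0 //.
by rewrite ordM ?invr_eq0 // ordV ord_unif subr_ge0.
Qed.

Lemma ord_cst P c : c != 0 -> ord P (cst c) = 0.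
Proof.
move=> c0; have c0' : cst c != 0 by rewrite fmorph_eq0.
apply/eqP; rewrite eq_le -reg_ord // reg_cst andbT leNgt -mx_ord //.
by rewrite mx_cst (negPf c0).
Qed.

Lemma vgeD P m x y : vge P m x -> vge P m y -> vge P m (x + y).
Proof. by move=> xm ym; rewrite /vge mulrDl regD. Qed.

Lemma vgeN P m x : vge P m (- x) = vge P m x.
Proof. by rewrite /vge mulNr rpredN. Qed.

Lemma vge_sum P m (I : Type) (r : seq I) (p : pred I) (F : I -> C) :
  (forall i, p i -> vge P m (F i)) -> vge P m (\sum_(i <- r | p i) F i).
Proof. by move=> h; apply: (big_ind (vge P m)) => //; [apply: vge0|apply: vgeD]. Qed.

Lemma vgeM P m n x y : vge P m x -> vge P n y -> vge P (m + n) (x * y).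
Proof.
by move=> xm yn; rewrite /vge expfzDr ?unif_neq0 // invfM mulrACA regM.
Qed.

Lemma vge_le P m n x : m <= n -> vge P n x -> vge P m x.
Proof.
move=> mn; have [->|x0] := eqVneq x 0; first by rewrite !vge0.
by rewrite !vge_ord //; apply: le_trans.
Qed.

Lemma vge_cst P c : vge P 0 (cst c).
Proof. by rewrite -reg_vge reg_cst. Qed.

Lemma vgeX P m x n : vge P m x -> vge P (m *+ n) (x ^+ n).
Proof.
move=> xm; elim: n => [|n IHn]; first by rewrite expr0 mulr0n -(rmorph1 cst) vge_cst.
by rewrite exprS mulrS vgeM.
Qed.

Lemma mx_vge P x : (x \in mx P) = vge P 1 x.
Proof.
have [->|x0] := eqVneq x 0; first by rewrite mx0 vge0.
by rewrite mx_ord // vge_ord // gtz0_ge1.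
Qed.

Lemma dominant_term P (I : eqType) (r : seq I) (F : I -> C) i0 :
  uniq r -> i0 \in r -> F i0 != 0 ->
  (forall i, i \in r -> i != i0 -> vge P (ord P (F i0) + 1) (F i)) ->
  \sum_(i <- r) F i != 0.
Proof.
move=> ur i0r F0 Fi; apply/eqP => S0.
have : vge P (ord P (F i0) + 1) (F i0).
  move/eqP: S0; rewrite (bigD1_seq i0) //= addr_eq0 => /eqP F0E.
  rewrite [X in vge _ _ X]F0E vgeN big_seq_cond; apply: vge_sum => i /andP[].
  exact: Fi.
by rewrite vge_ord // gerDl.
Qed.

End Order.

(** * Automorphisms acting on places *)

Section ActionOnPlaces.
Variables (k : closedFieldType) (C : curve k).
Local Notation cst := (kf_const C).
Implicit Types (P Q : cpoint C) (f g x y z : C) (s t : aut C) (G : finsubgroup (aut C)).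

Lemma reg_act s P f : (f \in reg (act s P)) = (kaut_inv s f \in reg P).
Proof. by apply/regP/regP. Qed.

Lemma mx_act s P f : (f \in mx (act s P)) = (kaut_inv s f \in mx P).
Proof. by rewrite !in_mx reg_act fmorphV fmorph_eq0. Qed.

Lemma act_one P : act 1%g P = P.
Proof. by apply: cpoint_eq => f; rewrite reg_act. Qed.

Lemma act_mul s t P : act (s * t)%g P = act s (act t P).
Proof. by apply: cpoint_eq => f; rewrite !reg_act. Qed.

Lemma actK s P : act s^-1%g (act s P) = P.
Proof. by rewrite -act_mul mulVg act_one. Qed.

Lemma actKV s P : act s (act s^-1%g P) = P.
Proof. by rewrite -act_mul mulgV act_one. Qed.

Lemma act_inj s : injective (act s : cpoint C -> cpoint C).
Proof. exact: can_inj (actK s). Qed.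

Lemma ordXz P x (m : int) : x != 0 -> ord P (x ^ m) = m * ord P x.
Proof.
move=> x0; case: m => n; first by rewrite -exprnP ordX // -mulr_natl natz.
by rewrite NegzE -exprnN ordV ordX // -mulr_natl natz mulNr.
Qed.

Lemma ord_act s P f : f != 0 -> ord (act s P) f = ord P (kaut_inv s f).
Proof.
move=> f0; set t := unif P; have t0 : t != 0 := unif_neq0 P.
have st1 : ord (act s P) (s t) = 1.
  apply: ord_gen; rewrite ?fmorph_eq0 //.
    by rewrite mx_act kautK unif_mx.
  move=> x; rewrite mx_act reg_act => xm.
  by rewrite fmorph_div /= kautK; case: (unifP P) => _ _; apply.
have sf0 : kaut_inv s f != 0 by rewrite fmorph_eq0.
have [ur um] := ord_unit P sf0; set m := ord P (kaut_inv s f) in ur um *.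
have fE : f = s t ^ m * s (kaut_inv s f / t ^ m).
  by rewrite fmorph_div kautKV (fmorphXz (kaut_fun s)) mulrC divfK // expfz_neq0 // fmorph_eq0.
have u0 : kaut_inv s f / t ^ m != 0 by apply: nmx_neq0 um.
rewrite fE ordM ?expfz_neq0 ?fmorph_eq0 // ordXz ?fmorph_eq0 // st1 mulr1.
rewrite -[RHS]addr0; congr (_ + _); apply/eqP; rewrite eq_le.
have su0 : s (kaut_inv s f / t ^ m) != 0 by rewrite fmorph_eq0.
rewrite -reg_ord // reg_act kautK ur andbT leNgt -mx_ord //.
by rewrite mx_act kautK.
Qed.

Lemma ord_actV s P f : f != 0 -> ord P (s f) = ord (act s^-1%g P) f.
Proof. by move=> f0; rewrite ord_act. Qed.

Lemma vge_actV s P m f : vge P m (s f) = vge (act s^-1%g P) m f.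
Proof.
have [->|f0] := eqVneq f 0; first by rewrite rmorph0 !vge0.
by rewrite !vge_ord ?fmorph_eq0 // ord_actV.
Qed.

Lemma fsg1 G : 1%g \in fsg_set G. Proof. by case: (fsg_closed G). Qed.
Lemma fsgM G s t : s \in fsg_set G -> t \in fsg_set G -> (s * t)%g \in fsg_set G.
Proof. exact: (group_closedM (fsg_closed G)). Qed.
Lemma fsgV G s : s \in fsg_set G -> s^-1%g \in fsg_set G.
Proof. exact: (group_closedV (fsg_closed G)). Qed.

Lemma perm_fsg_mull G s : s \in fsg_set G ->
  perm_eq [seq (s * t)%g | t <- fsg_set G] (fsg_set G).
Proof.
move=> sG; apply: uniq_perm; rewrite ?fset_uniq //.
  by rewrite map_inj_uniq ?fset_uniq //; apply: mulgI.
move=> t; apply/mapP/idP => [[u uG ->]|tG]; first exact: fsgM.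
by exists (s^-1 * t)%g; [apply: fsgM => //; apply: fsgV|rewrite mulgA mulgV mul1g].
Qed.

Lemma perm_fsg_mulr G s : s \in fsg_set G ->
  perm_eq [seq (t * s)%g | t <- fsg_set G] (fsg_set G).
Proof.
move=> sG; apply: uniq_perm; rewrite ?fset_uniq //.
  by rewrite map_inj_uniq ?fset_uniq //; apply: mulIg.
move=> t; apply/mapP/idP => [[u uG ->]|tG]; first exact: fsgM.
by exists (t * s^-1)%g; [apply: fsgM => //; apply: fsgV|rewrite -mulgA mulVg mulg1].
Qed.

(** The multiplicity of [Q] in the divisor that sums the [s P]; for [Q] in the
    orbit of [P] it is the order of the stabilizer. *)
Definition hits G P Q : nat := count (fun s => act s P == Q) (fsg_set G).

Lemma hits_gt0P G P Q : reflect (exists2 s, s \in fsg_set G & act s P = Q)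
  (0 < hits G P Q)%N.
Proof.
rewrite -has_count; apply: (iffP hasP) => -[s sG /eqP sP]; by exists s.
Qed.

Lemma hits_self G P : (0 < hits G P P)%N.
Proof. by apply/hits_gt0P; exists 1%g; rewrite ?fsg1 ?act_one. Qed.

Lemma hits_actr G s P Q : s \in fsg_set G -> hits G P (act s Q) = hits G P Q.
Proof.
move=> sG; rewrite /hits -(permP (perm_fsg_mull sG)) count_map.
by apply: eq_count => t /=; rewrite act_mul (inj_eq (@act_inj s)).
Qed.

Lemma hits_actl G s P Q : s \in fsg_set G -> hits G (act s P) Q = hits G P Q.
Proof.
move=> sG; rewrite /hits -[RHS](permP (perm_fsg_mulr sG)) count_map.
by apply: eq_count => t /=; rewrite act_mul.
Qed.

Lemma hits_sum G P Q : hits G P Q = (\sum_(s <- fsg_set G) (act s^-1%g Q == P))%N.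
Proof.
rewrite /hits -sum1_count big_mkcond; apply: eq_bigr => s _.
have -> : (act s P == Q) = (act s^-1%g Q == P); last by case: eqP.
by apply/eqP/eqP => <-; rewrite ?actK ?actKV.
Qed.

Lemma fixed_ev G y p : y \in sf_mem (fixed G) -> ev y p \in sf_mem (fixed G).
Proof.
move=> yG; rewrite evE horner_coef rpred_sum // => i _.
by rewrite coef_map rpredM ?rpredX //; apply: const_fixed.
Qed.

Lemma fixed_inv G s f : f \in sf_mem (fixed G) -> s \in fsg_set G -> kaut_inv s f = f.
Proof. by move=> /fixedP fG sG; rewrite -{1}(fG s sG) kautK. Qed.

Lemma fixed_reg_act G s P f : f \in sf_mem (fixed G) -> s \in fsg_set G ->
  (f \in reg (act s P)) = (f \in reg P).
Proof. by move=> fG sG; rewrite reg_act (fixed_inv fG). Qed.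

Lemma fixed_ord_act G s P f : f \in sf_mem (fixed G) -> s \in fsg_set G ->
  ord (act s P) f = ord P f.
Proof.
have [->|f0] := eqVneq f 0; last by move=> fG sG; rewrite ord_act // (fixed_inv fG).
by rewrite !ord_zero.
Qed.

Lemma norm_fixed G x : \prod_(s <- fsg_set G) s x \in sf_mem (fixed G).
Proof.
apply/fixedP => t tG; rewrite rmorph_prod /= -[RHS](perm_big _ (perm_fsg_mull tG)) /=.
by rewrite big_map.
Qed.

Lemma ord_norm G x P : x != 0 ->
  ord P (\prod_(s <- fsg_set G) s x) = \sum_(s <- fsg_set G) ord (act s^-1%g P) x.
Proof.
move=> x0; rewrite ord_prod => [|s]; last by rewrite fmorph_eq0.
by apply: eq_bigr => s _; rewrite ord_actV.
Qed.

(** ** Weak approximation *)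

Lemma avoid_constants (l : seq k) : exists c, c \notin l.
Proof.
have /closed_nonrootP[c] : \prod_(a <- l) ('X - a%:P) != 0.
  exact/monic_neq0/monic_prod_XsubC.
by rewrite root_prod_XsubC; exists c.
Qed.

Lemma generic_shift y (L : seq (cpoint C)) (l : seq k) :
  exists2 c, c \notin l & forall R, R \in L -> y - cst c \notin mx R.
Proof.
have /choice[v vP] : forall R : cpoint C, exists c, y \in reg R -> y - cst c \in mx R.
  move=> R; have [/value_ex[c yc]|] := boolP (y \in reg R); first by exists c.
  by exists 0.
have [c] := avoid_constants (l ++ map v L).
rewrite mem_cat negb_or => /andP[cl cv]; exists c => // R RL; apply/negP => ycm.
have yr : y \in reg R by rewrite -(subrK (cst c) y) regD ?reg_cst ?mx_reg.
case/mapP: cv; exists R => //; exact: value_uniq ycm (vP R yr).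
Qed.

(** A discrete valuation ring is a maximal proper subring, so no place contains
    another. *)
Lemma separate_places P Q : P != Q -> exists2 y, y \in reg P & y \notin reg Q.
Proof.
move=> PQ; apply: contrapT => none.
have sub x : x \in reg P -> x \in reg Q.
  by move=> xP; apply/negPn/negP => xQ; apply: none; exists x.
case/eqP: PQ; apply: cpoint_eq => x; apply/idP/idP => [/sub//|xQ].
apply: contraT => nxP; have [z /negP[]] := nreg_exists Q.
have xi0 : x^-1 != 0 by rewrite invr_eq0 (nreg_neq0 nxP).
have [m zm] := archimedean z xi0 (nreg_invmx nxP).
have -> : z = x ^+ m * (x^-1 ^+ m * z).
  by rewrite mulrA -exprMn divff ?expr1n ?mul1r // -invr_eq0.
by rewrite regM ?regX // sub.
Qed.

Lemma approx_one P (L : seq (cpoint C)) : P \notin L ->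
  exists2 a, a - 1 \in mx P & forall Q, Q \in L -> a \in mx Q.
Proof.
move=> PL.
have one Q : Q \in L -> exists a, [/\ a - 1 \in mx P, a \in mx Q &
    forall R, R \in L -> a \in reg R].
  move=> QL; have PQ : P != Q by apply: contraNneq PL => ->.
  have [y yP yQ] := separate_places PQ.
  (* [1 / (y - c)] is regular on the whole list and vanishes at [Q] only
     because [y] has a pole there. *)
  have [c _ cL] := generic_shift y (P :: L) [::].
  have zr R : R \in P :: L -> (y - cst c)^-1 \in reg R.
    by move=> /cL; rewrite notin_mx => /andP[].
  have PPL : P \in P :: L by rewrite inE eqxx.
  have [d zd] := value_ex (zr P PPL).
  have d0 : d != 0.
    apply: contraTneq zd => ->; rewrite rmorph0 subr0 notin_mx invr_eq0 invrK.
    by rewrite (nmx_neq0 (cL _ PPL)) regB ?reg_cst.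
  have d0' : cst d != 0 by rewrite fmorph_eq0.
  have dr R : (cst d)^-1 \in reg R by rewrite -fmorphV reg_cst.
  exists ((y - cst c)^-1 / cst d); split.
  - have -> : (y - cst c)^-1 / cst d - 1 = ((y - cst c)^-1 - cst d) / cst d.
      by rewrite mulrBl divff.
    exact: mxMr.
  - apply: mxMr => //; apply: nreg_invmx; apply: contra yQ => yc.
    by rewrite -(subrK (cst c) y) regD ?reg_cst.
  - by move=> R RL; apply: regM => //; apply: zr; rewrite inE RL orbT.
suff /(_ L (fun _ => id))[a [aP aL _]] : forall L' : seq (cpoint C), {subset L' <= L} ->
    exists a, [/\ a - 1 \in mx P, forall Q, Q \in L' -> a \in mx Q &
      forall R, R \in L -> a \in reg R] by exists a.
elim=> [_|Q L' IH QL'].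
  by exists 1; split=> [|//|R _]; rewrite ?subrr ?mx0 ?rpred1.
have [|a [aP aL ar]] := IH; first by move=> R RL; apply: QL'; rewrite inE RL orbT.
have [|b [bP bQ br]] := one Q; first by apply: QL'; rewrite inE eqxx.
exists (a * b); split.
- have -> : a * b - 1 = (a - 1) * b + (b - 1) by ring.
  apply: mxD => //; apply: mxMr => //.
  by rewrite -(subrK 1 b) regD ?rpred1 ?mx_reg.
- move=> R; rewrite inE => /orP[/eqP->|RL'].
    by apply: mxMl => //; apply/ar/QL'; rewrite inE eqxx.
  by apply: mxMr; [apply: aL|apply/br/QL'; rewrite inE RL' orbT].
- by move=> R RL; rewrite regM ?ar ?br.
Qed.

Lemma ordD_lt P x y : x != 0 -> vge P (ord P x + 1) y ->
  x + y != 0 /\ ord P (x + y) = ord P x.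
Proof.
move=> x0 yx; have xy : x + y != 0.
  apply: contraTneq yx => /eqP; rewrite addrC addr_eq0 => /eqP->.
  by rewrite vgeN vge_ord // gerDl.
split=> //; apply/eqP; rewrite eq_le; apply/andP; split; last first.
  rewrite -vge_ord //; apply: vgeD; first by rewrite vge_ord.
  by apply: (vge_le _ yx); rewrite lerDl.
rewrite leNgt; apply/negP => lt1.
have : vge P (ord P x + 1) x.
  rewrite -[X in vge _ _ X](addrK y); apply: vgeD; last by rewrite vgeN.
  by rewrite vge_ord // lezD1.
by rewrite vge_ord // gerDl.
Qed.

Lemma approx_ord P (L : seq (cpoint C)) : P \notin L ->
  exists t : C, [/\ t != 0, ord P t = 1 & forall Q, Q \in L -> ord Q t = 0].
Proof.
move=> PL; have [a aP aL] := approx_one PL.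
set u := unif P; have u0 : u != 0 := unif_neq0 P.
have an : a \notin mx P.
  apply/negP => am; have := mxB am aP.
  by rewrite opprB addrC subrK (negPf (mx1 P)).
have a0 := nmx_neq0 an.
have ar : a \in reg P by rewrite -(subrK 1 a) regD ?rpred1 ?mx_reg.
have oa : ord P a = 0.
  by apply/eqP; rewrite eq_le -reg_ord // ar andbT leNgt -mx_ord.
have /choice[M MP] : forall Q, exists m, a \in mx Q -> a ^+ m * u \in reg Q.
  move=> Q; have [am|_] := boolP (a \in mx Q); last by exists 0%N.
  by have [m am'] := archimedean u a0 am; exists m.
pose N := (\sum_(Q <- L) M Q).+1.
have NL Q : Q \in L -> a ^+ N * u \in mx Q.
  move=> QL; have MN : (M Q <= \sum_(Q <- L) M Q)%N.
    by rewrite (big_rem Q) //= leq_addr.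
  rewrite /N -(subnK MN) -addSn exprD -mulrA mxMr ?MP ?aL //.
  by rewrite exprS mxMr ?aL // regX // mx_reg ?aL.
(* In [a^N u + (1 - a)^2] the first term decides at [P], the second at the
   points of the list. *)
have x0 : a ^+ N * u != 0 by rewrite mulf_neq0 ?expf_neq0.
have ox : ord P (a ^+ N * u) = 1.
  by rewrite ordM ?expf_neq0 // ordX // oa mul0rn add0r ord_unif.
have yP : vge P (ord P (a ^+ N * u) + 1) ((1 - a) ^+ 2).
  rewrite ox -[1 + 1]/(1 *+ 2 : int) vgeX // -mx_vge.
  by rewrite -opprB mxN.
have [t0 ot] := ordD_lt x0 yP.
exists (a ^+ N * u + (1 - a) ^+ 2); split=> //; first by rewrite ot.
move=> Q QL.
have n1 : 1 - a \notin mx Q.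
  apply/negP => h; have := mxD h (aL _ QL); rewrite subrK; exact/negP/mx1.
have b0 : (1 - a) ^+ 2 != 0 by rewrite expf_neq0 // (nmx_neq0 n1).
have ob : ord Q ((1 - a) ^+ 2) = 0.
  apply/eqP; rewrite eq_le -reg_ord // regX ?regB ?rpred1 ?mx_reg ?aL // andbT.
  by rewrite leNgt -mx_ord // expr2 nmxM.
rewrite addrC; have [||_ ->] := @ordD_lt Q ((1 - a) ^+ 2) (a ^+ N * u) => //.
by rewrite ob add0r -mx_vge NL.
Qed.

(** ** Linear independence *)

Lemma linear_dependence (F : fieldType) (I J : finType) (A : I -> J -> F) :
  (#|J| < #|I|)%N -> exists2 u : I -> F, (exists i, u i != 0) &
    forall j, \sum_i u i * A i j = 0.
Proof.
move=> JI; pose M := \matrix_(i < #|I|, j < #|J|) A (enum_val i) (enum_val j).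
have /rowV0Pn[u /sub_kermxP uM /rV0Pn[i ui]] : kermx M != 0.
  rewrite -mxrank_eq0 mxrank_ker subn_eq0 -ltnNge.
  exact: leq_ltn_trans (rank_leq_col M) JI.
exists (fun i => u 0 (enum_rank i)); first by exists (enum_val i); rewrite enum_valK.
move=> j; move/rowP/(_ (enum_rank j)): uM; rewrite !mxE => uMj; rewrite -[RHS]uMj.
rewrite (reindex_onto (enum_val : 'I_#|I| -> I) enum_rank); last first.
  by move=> *; rewrite enum_rankK.
apply: eq_big => [l|l _]; first by rewrite enum_valK eqxx.
by rewrite [M _ _]mxE enum_valK enum_rankK.
Qed.

(** Dedekind's independence of characters. *)
Lemma kaut_independent (l : seq (aut C)) (a : aut C -> C) : uniq l ->
  (forall x, \sum_(s <- l) a s * s x = 0) -> forall s, s \in l -> a s = 0.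
Proof.
elim: l a => // s0 l IH a /= /andP[s0l ul] rel.
have al s : s \in l -> a s = 0.
  move=> sl; have [y ysn] : exists y, s y != s0 y.
    apply: contrapT => none; case/negP: s0l; suff -> : s0 = s by [].
    apply: kaut_eq => y; apply/eqP; rewrite eq_sym; apply/negPn/negP => h.
    by apply: none; exists y.
  have rel' x : \sum_(t <- l) (a t * (t y - s0 y)) * t x = 0.
    have e1 : \sum_(t <- l) a t * t x = - (a s0 * s0 x).
      by apply/eqP; rewrite -addr_eq0 addrC; move: (rel x); rewrite big_cons => ->.
    have e2 : \sum_(t <- l) a t * t (x * y) = - (a s0 * s0 (x * y)).
      by apply/eqP; rewrite -addr_eq0 addrC; move: (rel (x * y)); rewrite big_cons => ->.
    transitivity (\sum_(t <- l) a t * t (x * y) - s0 y * \sum_(t <- l) a t * t x).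
      by rewrite mulr_sumr -sumrB; apply: eq_bigr => t _; rewrite rmorphM /=; ring.
    by rewrite e1 e2 rmorphM /=; ring.
  have /eqP := IH _ ul rel' s sl.
  by rewrite mulf_eq0 subr_eq0 (negPf ysn) orbF => /eqP.
move=> s; rewrite inE => /orP[/eqP->|/al//].
have := rel 1; rewrite big_cons rmorph1 mulr1 big_seq big1 ?addr0 // => t tl.
by rewrite al ?mul0r.
Qed.

End ActionOnPlaces.

(** * Ramification over the field of invariants *)

Section Ramification.
Variables (k : closedFieldType) (C : curve k).
Local Notation cst := (kf_const C).
Implicit Types (P Q : cpoint C) (f g x y z : C) (s t : aut C) (G : finsubgroup (aut C)).

Lemma value_expansion P x e : x \in reg P ->
  exists a : 'I_e -> k, vge P e%:Z (x - \sum_(i < e) cst (a i) * unif P ^+ i).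
Proof.
move=> xr; elim: e => [|e [a]].
  by exists (fun=> 0); rewrite big_ord0 subr0 -reg_vge.
set y := x - _ => ye.
have [c yc] := value_ex (ye : y / unif P ^ e%:Z \in reg P).
(* The new coefficient [c] has index [e], just outside the domain of [a]. *)
exists (fun i => oapp a c (insub (i : nat))).
rewrite big_ord_recr /= insubF ?ltnn //=.
have -> : \sum_(i < e) cst (oapp a c (insub (i : nat))) * unif P ^+ i =
          \sum_(i < e) cst (a i) * unif P ^+ i.
  by apply: eq_bigr => i _; rewrite valK.
rewrite opprD addrA -/y.
have -> : y - cst c * unif P ^+ e = (y / unif P ^ e%:Z - cst c) * unif P ^+ e.
  by rewrite mulrBl divfK // expf_neq0 // unif_neq0.
have -> : e.+1%:Z = 1 + e%:Z by rewrite -addn1 PoszD addrC.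
by rewrite vgeM // -?mx_vge // /vge -exprnP divff ?rpred1 // expf_neq0 // unif_neq0.
Qed.

Lemma sum_hits_orbit G P :
  (\sum_(Q <- undup [seq act s P | s <- fsg_set G]) hits G P Q = size (fsg_set G))%N.
Proof.
under eq_bigr => Q _ do rewrite /hits -sum1_count big_mkcond.
rewrite exchange_big -sum1_size /= big_seq [RHS]big_seq.
apply: eq_bigr => s sG; rewrite -big_mkcond sum1_count.
have := count_uniq_mem (act s P) (undup_uniq [seq act s P | s <- fsg_set G]).
rewrite mem_undup (map_f (fun s => act s P) sG) => h; rewrite -[RHS]h; apply: eq_count => Q /=; exact: eq_sym.
Qed.

(** The fundamental equality, in the form that a non-unit [u] of the invariant
    field vanishes at [P] at least [#Stab(P)] times. Let [B] be the semilocal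
    ring of the orbit of [P]. Expanding at the points of the orbit bounds the
    dimension of [B/uB] by [ord_P(u)] times the length of the orbit. If this is
    less than [#G], some combination [c] of the elements of [G] kills
    representatives [w] of [B/uB]; then it maps [B] into [u^N (c B)] for every
    [N], so it is zero, against the independence of characters. *)
Lemma ramification_ge G P u : u \in sf_mem (fixed G) -> u != 0 -> 0 < ord P u ->
  ((hits G P P)%:Z <= ord P u).
Proof.
move=> uG u0 upos; rewrite leNgt; apply/negP => small.
pose O := undup [seq act s P | s <- fsg_set G].
pose e := `|ord P u|%N.
have eE : e%:Z = ord P u by rewrite gtz0_abs.
have OP Q : Q \in O -> exists2 s, s \in fsg_set G & Q = act s P.
  by rewrite mem_undup => /mapP[s sG ->]; exists s.
have inO s : s \in fsg_set G -> act s P \in O.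
  by move=> sG; rewrite mem_undup (map_f (fun s => act s P) sG).
have uO Q : Q \in O -> ord Q u = e%:Z.
  by move=> /OP[s sG ->]; rewrite eE (fixed_ord_act _ uG).
pose n := size (fsg_set G).
have dim_lt : (size O * e < n)%N.
  rewrite /n -(sum_hits_orbit G P) big_seq.
  rewrite (eq_bigr (fun _ => hits G P P)) => [|Q /OP[s sG ->]]; last exact: hits_actr.
  rewrite -big_seq big_const_seq count_predT iter_addn_0 mulnC ltn_pmul2r.
    by rewrite -ltz_nat eE.
  by have := inO _ (fsg1 G); rewrite lt0n size_eq0; apply: contraTneq => ->.
pose B x := forall Q, Q \in O -> x \in reg Q.
have Bc c : B (cst c) by move=> Q _; apply: reg_cst.
have BM x y : B x -> B y -> B (x * y) by move=> bx by_ Q QO; rewrite regM ?bx ?by_.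
pose comb m (w : 'I_m -> C) (a : 'I_m -> k) := \sum_i cst (a i) * w i.
(* Divisibility by [u] is the vanishing of the first [e] coefficients of the
   expansions at the points of the orbit. *)
have dep m (w : 'I_m -> C) : (forall i, B (w i)) -> (size O * e < m)%N ->
    exists2 a : 'I_m -> k, (exists i, a i != 0) & B (comb m w a / u).
  move=> Bw lt_m.
  have /choice[E EP] : forall Qi : cpoint C * 'I_m, exists a : 'I_e -> k,
     Qi.1 \in O -> vge Qi.1 e%:Z (w Qi.2 - \sum_(j < e) cst (a j) * unif Qi.1 ^+ j).
    move=> [Q i] /=; have [QO|_] := boolP (Q \in O); last by exists (fun=> 0).
    by have [a aP] := value_expansion e (Bw i Q QO); exists a.
  pose A (i : 'I_m) (lj : 'I_(size O) * 'I_e) := E (nth P O lj.1, i) lj.2.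
  have [|a a0 aE] := @linear_dependence _ _ _ A; first by rewrite card_prod !card_ord.
  exists a => // Q QO; have Qu := uO Q QO.
  have c0 : vge Q e%:Z (comb m w a).
    have -> : comb m w a = \sum_i cst (a i) * (w i - \sum_(j < e) cst (E (Q, i) j) * unif Q ^+ j).
      have S0 : \sum_i cst (a i) * \sum_(j < e) cst (E (Q, i) j) * unif Q ^+ j = 0.
        under eq_bigr => i _ do rewrite mulr_sumr.
        rewrite exchange_big big1 //= => j _.
        have iQ : (index Q O < size O)%N by rewrite index_mem.
        have := aE (Ordinal iQ, j); rewrite /A /= nth_index // => /(congr1 cst).
        rewrite rmorph0 rmorph_sum /= => S0.
        transitivity ((\sum_i cst (a i * E (Q, i) j)) * unif Q ^+ j).
          by rewrite mulr_suml; apply: eq_bigr => i _; rewrite rmorphM /= mulrA.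
        by rewrite S0 mul0r.
      rewrite -[LHS]subr0 -[X in _ - X]S0 -sumrB.
      by apply: eq_bigr => i _; rewrite mulrBr.
    apply: vge_sum => i _; rewrite -[e%:Z]add0r; apply: vgeM; first exact: vge_cst.
    exact: (EP (Q, i)).
  have [->|cn0] := eqVneq (comb m w a) 0; first by rewrite mul0r rpred0.
  rewrite reg_ord ?mulf_neq0 ?invr_eq0 // ordM ?invr_eq0 // ordV Qu subr_ge0.
  by rewrite -vge_ord.
pose indep m := exists2 w : 'I_m -> C, forall i, B (w i) &
  forall a, B (comb m w a / u) -> forall i, a i = 0.
have ex_indep : exists m, `[< indep m >].
  by exists 0%N; apply/asboolP; exists (fun=> 0) => [[]|a _ []].
have le_indep m : `[< indep m >] -> (m <= size O * e)%N.
  move=> /asboolP[w Bw wi]; rewrite leqNgt; apply/negP => /(dep m w Bw)[a [i ai] /wi ai0].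
  by rewrite ai0 eqxx in ai.
(* A maximal family independent modulo [u B] spans [B] modulo [u B]. *)
have [m /asboolP[w Bw wi] m_max] := ex_maxnP ex_indep le_indep.
have m_lt : (m < n)%N by apply: leq_ltn_trans dim_lt; apply/le_indep/asboolP; exists w.
have span x : B x -> exists a, B ((x - comb m w a) / u).
  move=> Bx; apply: contrapT => nospan.
  suff /asboolP/m_max : indep m.+1 by rewrite ltnn.
  exists (fun i => if unlift ord0 i is Some j then w j else x).
    by move=> i; case: unliftP.
  move=> a; rewrite /comb big_ord_recl unlift_none /=.
  under eq_bigr => i _ do rewrite liftK.
  move=> Ba; have a0 : a ord0 = 0.
    apply/eqP/negPn/negP => an0; apply: nospan.
    exists (fun i => - (a (fintype.lift ord0 i) / a ord0)).
    have := BM _ _ (Bc (a ord0)^-1) Ba; congr (B _).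
    rewrite mulrA mulrDr mulrA -rmorphM mulVf // rmorph1 mul1r; congr ((_ + _) / _).
    rewrite /comb mulr_sumr -sumrN; apply: eq_bigr => i _.
    by rewrite mulrA -rmorphM rmorphN mulNr opprK mulrC [_ * _^-1]mulrC mulrC.
  move: Ba; rewrite a0 rmorph0 mul0r add0r => /wi ai i.
  by case: (unliftP ord0 i) => [j ->|->//]; apply: ai.
pose g (i : 'I_n) : aut C := nth 1%g (fsg_set G) i.
have gG i : g i \in fsg_set G by apply: mem_nth.
(* Fewer equations [sum_s c_s s(w_j) = 0] than unknowns [c_s]. *)
have [|c [i0 ci0] cw] := @linear_dependence C _ _ (fun (i : 'I_n) (j : 'I_m) => g i (w j)).
  by rewrite !card_ord.
pose T x := \sum_i c i * g i x.
have TM v x : v \in sf_mem (fixed G) -> T (v * x) = v * T x.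
  move=> vG; rewrite /T mulr_sumr; apply: eq_bigr => i _.
  by rewrite rmorphM /= (fixedP _ _ vG) //; ring.
have TD x y : T (x + y) = T x + T y.
  by rewrite /T -big_split; apply: eq_bigr => i _; rewrite rmorphD /= mulrDr.
have Tcomb a : T (comb m w a) = 0.
  rewrite /T /comb; under eq_bigr => i _ do rewrite rmorph_sum mulr_sumr.
  rewrite exchange_big big1 //= => j _.
  transitivity (cst (a j) * \sum_i c i * g i (w j)); last by rewrite cw mulr0.
  by rewrite mulr_sumr; apply: eq_bigr => i _; rewrite rmorphM /= kaut_const; ring.
have Tdiv N x : B x -> exists2 b, B b & T x = u ^+ N * T b.
  elim: N x => [|N IHN] x Bx; first by exists x; rewrite ?expr0 ?mul1r.
  have [a Ba] := span x Bx; have [b Bb bE] := IHN _ Ba.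
  exists b => //; have xE : x = u * ((x - comb m w a) / u) + comb m w a.
    by rewrite mulrC divfK // subrK.
  by rewrite {1}xE TD Tcomb addr0 TM // bE exprS mulrA.
have TB0 x : B x -> T x = 0.
  move=> Bx; apply/eqP/negPn/negP => Tx0.
  (* [D] bounds the poles at [P] of the coefficients [c], independently of [N]. *)
  pose D := (\sum_i `|ord P (c i)|)%N.
  have cD i : vge P (- D%:Z) (c i).
    have [->|ci] := eqVneq (c i) 0; first by rewrite vge0.
    rewrite vge_ord // /D (bigD1 i) //=; lia.
  have [b Bb bE] := Tdiv (`|ord P (T x)| + D).+1 x Bx.
  have TbD : vge P (- D%:Z) (T b).
    apply: vge_sum => i _; rewrite -[- _]addr0; apply: vgeM => //.
    by rewrite vge_actV -reg_vge Bb // inO // fsgV.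
  have := vgeM (vgeX (`|ord P (T x)| + D).+1 (_ : vge P (ord P u) u)) TbD.
  rewrite -bE !vge_ord // => /(_ (lexx _)).
  have : 1 <= ord P u by rewrite -gtz0_ge1.
  rewrite -mulr_natr; nia.
have T0 x : T x = 0.
  have uP Q : Q \in O -> u \in mx Q by move=> QO; rewrite mx_ord // uO // eE.
  have /choice[M MP] : forall Q, exists N, Q \in O -> u ^+ N * x \in reg Q.
    move=> Q; have [QO|_] := boolP (Q \in O); last by exists 0%N.
    by have [N] := archimedean x u0 (uP Q QO); exists N.
  pose N := (\sum_(Q <- O) M Q)%N.
  have /TB0 : B (u ^+ N * x).
    move=> Q QO; have MN : (M Q <= N)%N by rewrite /N (big_rem Q) //= leq_addr.
    by rewrite -(subnK MN) exprD -mulrA regM ?MP // regX // mx_reg ?uP.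
  rewrite TM; last exact: rpredX.
  by move/eqP; rewrite mulf_eq0 expf_eq0 (negPf u0) andbF => /eqP.
have gi : index (g i0) (fsg_set G) = i0 by rewrite index_uniq ?fset_uniq.
pose c' s := oapp c 0 (insub (index s (fsg_set G))).
have := @kaut_independent _ _ _ c' (fset_uniq (fsg_set G)) _ (g i0) (gG i0).
rewrite /c' gi valK /= => ci; case/eqP: ci0; apply: ci => x.
transitivity (T x) => //; rewrite (big_nth 1%g) big_mkord; apply: eq_bigr => i _.
by rewrite index_uniq ?fset_uniq // valK.
Qed.

End Ramification.

(** * Generators of the field of invariants *)

Section SimpleSubfield.
Variables (k : fieldType) (L : kfield k).
Local Notation cst := (kf_const L).

Lemma kx_sub (S : subfield L) (x : L) : (forall c, cst c \in sf_mem S) -> x \in sf_mem S ->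
  forall y, y \in sf_mem (kx x) -> y \in sf_mem S.
Proof.
move=> Sc Sx; have Sp p : (map_poly cst p).[x] \in sf_mem S.
  by rewrite horner_coef rpred_sum // => i _; rewrite coef_map rpredM ?rpredX ?Sc.
by move=> y /asboolP[p [q [_ ->]]]; rewrite rpred_div.
Qed.

Lemma kx_self (x : L) : x \in sf_mem (kx x).
Proof. by have := kx_eval x 'X; rewrite map_polyX hornerX. Qed.

End SimpleSubfield.

Section Generators.
Variables (k : closedFieldType) (C : curve k).
Local Notation cst := (kf_const C).
Implicit Types (P Q : cpoint C) (f g x y z : C) (s t : aut C) (G : finsubgroup (aut C)).

Definition generates G x := forall f, (f \in sf_mem (fixed G)) = (f \in sf_mem (kx x)).

Lemma generates_fixed G x : generates G x -> x \in sf_mem (fixed G).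
Proof. by move=> ->; apply: kx_self. Qed.

Lemma generates_shift_inv G x c : x - cst c != 0 -> generates G x ->
  generates G (x - cst c)^-1.
Proof.
move=> xc0 gx f; rewrite gx; apply/idP/idP; apply: kx_sub; try exact: kx_const.
  rewrite -[X in X \in _](subrK (cst c)) rpredD ?kx_const //.
  by rewrite -[X in X \in _]invrK rpredV kx_self.
by rewrite rpredV rpredB ?kx_const ?kx_self.
Qed.

(** Inverting at a value makes any given place a pole of the generator. *)
Lemma generates_pole G x P : nonconst x -> generates G x ->
  exists2 y, generates G y & y \notin reg P.
Proof.
move=> nx gx; have [/value_ex[c xc]|] := boolP (x \in reg P); last by exists x.
have xc0 : x - cst c != 0 by rewrite subr_eq0; apply/eqP/nx.
by exists (x - cst c)^-1; [apply: generates_shift_inv|apply: mx_inv_nreg].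
Qed.

Lemma ord_ev_pole P y p : y \notin reg P -> p != 0 ->
  ord P (ev y p) = (size p).-1%:Z * ord P y.
Proof.
move=> yP p0; have y0 := nreg_neq0 yP; have oy := nreg_ord yP.
have l0 : cst (lead_coef p) != 0 by rewrite fmorph_eq0 lead_coef_eq0.
have m0 : cst (lead_coef p) * y ^+ (size p).-1 != 0 by rewrite mulf_neq0 ?expf_neq0.
have om : ord P (cst (lead_coef p) * y ^+ (size p).-1) = (size p).-1%:Z * ord P y.
  by rewrite ordM ?expf_neq0 // ord_cst ?lead_coef_eq0 // add0r ordX // -mulr_natl natz.
have -> : ev y p = cst (lead_coef p) * y ^+ (size p).-1 +
    \sum_(i < (size p).-1) cst p`_i * y ^+ i.
  rewrite evE (horner_coef_wide _ (n := (size p).-1.+1)).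
    rewrite big_ord_recr /= addrC coef_map; congr (_ + _).
    by apply: eq_bigr => i _; rewrite coef_map.
  by rewrite size_map_poly prednK // size_poly_gt0.
have [|_ ->] := @ordD_lt _ _ P _ (\sum_(i < (size p).-1) cst p`_i * y ^+ i) m0; last exact: om.
rewrite om; apply: vge_sum => i _; rewrite -[X in vge P X _]add0r.
apply: vgeM; first exact: vge_cst.
rewrite vge_ord ?expf_neq0 // ordX // -mulr_natl natz.
have := ltn_ord i; nia.
Qed.

Lemma kx_ord y z : z \in sf_mem (kx y) -> z != 0 ->
  exists m : int, forall P, y \notin reg P -> ord P z = m * ord P y.
Proof.
move=> /asboolP[p [q [q0 zE]]] z0; rewrite -[_.[_]]/(ev y q) in q0 zE.
rewrite -[(map_poly _ p).[_]]/(ev y p) in zE.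
have p0 : p != 0 by apply: contraNneq z0 => p0; rewrite zE p0 rmorph0 mul0r.
have qn0 : q != 0 by apply: contraNneq q0 => ->; rewrite rmorph0.
exists ((size p).-1%:Z - (size q).-1%:Z) => P yP.
have pn : ev y p != 0 by apply: contraNneq z0 => e; rewrite zE e mul0r.
by rewrite zE ordM ?invr_eq0 // ordV !ord_ev_pole // mulrBl.
Qed.

(** One inequality is [ramification_ge]. For the other, the norm of a function of
    order 1 at [P] and 0 at the other points of the orbit has order [#Stab(P)] at
    [P], and the order of an invariant at [P] is a multiple of that of [y]. *)
Lemma generates_ord_pole G y P : generates G y -> y \notin reg P ->
  ord P y = - (hits G P P)%:Z.
Proof.
move=> gy yP; have y0 := nreg_neq0 yP; have oy := nreg_ord yP.
have ge : (hits G P P)%:Z <= - ord P y.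
  rewrite -ordV; apply: ramification_ge; rewrite ?invr_eq0 ?rpredV ?generates_fixed //.
  by rewrite ordV oppr_gt0.
pose L := [seq Q <- [seq act s P | s <- fsg_set G] | Q != P].
have PL : P \notin L by rewrite mem_filter eqxx.
have [t [t0 tP tL]] := approx_ord PL.
have N0 : \prod_(s <- fsg_set G) s t != 0.
  by rewrite prodf_seq_neq0; apply/allP => s _; rewrite fmorph_eq0.
have oN : ord P (\prod_(s <- fsg_set G) s t) = (hits G P P)%:Z.
  rewrite ord_norm // hits_sum -natz natr_sum.
  rewrite big_seq [RHS]big_seq; apply: eq_bigr => s sG.
  have [->|ne] := eqVneq; first by rewrite tP.
  rewrite tL // mem_filter ne.
  by apply/mapP; exists s^-1%g => //; apply: fsgV.
have [m mE] := kx_ord (etrans (esym (gy _)) (norm_fixed G t)) N0.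
have := mE P yP; rewrite oN; have : 0 < (hits G P P)%:Z by rewrite ltz_nat hits_self.
move: (hits G P P)%:Z (ord P y) ge oy => h o ge o0 h0 hE.
have m0 : m < 0 by rewrite ltNge; apply/negP => m0; nia.
nia.
Qed.

(** The norm of a function that vanishes at [Q] but takes the value 1 along the
    orbit of [P] and at the rest of the orbit of [Q]. *)
Lemma separating_norm G P Q : hits G P Q = 0%N ->
  exists u, [/\ u \in sf_mem (fixed G), u != 0, ord P u = 0 & 0 < ord Q u].
Proof.
move=> nPQ; have PnQ s : s \in fsg_set G -> act s P != Q.
  move=> sG; apply/eqP => sPQ; have: (0 < hits G P Q)%N by apply/hits_gt0P; exists s.
  by rewrite nPQ.
pose L := [seq act s P | s <- fsg_set G] ++
  [seq R <- [seq act s Q | s <- fsg_set G] | R != Q].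
have QL : Q \notin L.
  rewrite mem_cat mem_filter eqxx orbF; apply/mapP => -[s sG QE].
  by have := PnQ s sG; rewrite QE eqxx.
have [a aQ aL] := approx_one QL.
have xL R : R \in L -> 1 - a \notin mx R.
  move=> /aL am; apply/negP => h; have := mxD h am; rewrite subrK; exact/negP/mx1.
have xQ : 1 - a \in mx Q by rewrite -opprB mxN.
have PL : P \in L.
  by rewrite mem_cat; apply/orP; left; apply/mapP; exists 1%g; rewrite ?fsg1 ?act_one.
have x0 : 1 - a != 0 := nmx_neq0 (xL P PL).
have oL R : R \in L -> ord R (1 - a) = 0.
  move=> RL; apply/eqP; rewrite eq_le -reg_ord // leNgt -mx_ord // xL //=.
  by rewrite regB ?rpred1 // mx_reg ?aL.
exists (\prod_(s <- fsg_set G) s (1 - a)); split; first exact: norm_fixed.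
- by rewrite prodf_seq_neq0; apply/allP => s _; rewrite fmorph_eq0.
- rewrite ord_norm // big_seq big1 // => s sG; apply: oL.
  by rewrite mem_cat; apply/orP; left; apply/mapP; exists s^-1%g; rewrite ?fsgV.
rewrite ord_norm // (big_rem 1%g) ?fsg1 //= invg1 act_one ltr_wpDr //; last first.
  by rewrite -mx_ord.
rewrite big_seq sumr_ge0 // => s /mem_rem sG.
have [->|ne] := eqVneq (act s^-1%g Q) Q; first by rewrite -reg_ord ?mx_reg.
rewrite oL // mem_cat mem_filter ne; apply/orP; right.
by apply/mapP; exists s^-1%g; rewrite ?fsgV.
Qed.

(** Two poles of a generator [y] are conjugate, since the order of an invariant
    at a pole of [y] is determined, up to a positive factor, by its expression
    as a rational function of [y]. *)
Lemma generates_poles_conj G y P Q : generates G y -> y \notin reg P ->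
  y \notin reg Q -> (0 < hits G P Q)%N.
Proof.
move=> gy yP yQ; rewrite lt0n; apply/negP => /eqP /separating_norm[u [uG u0 oP oQ]].
have [m mE] := kx_ord (etrans (esym (gy _)) uG) u0.
have := mE P yP; have := mE Q yQ; rewrite oP => oQm /esym/eqP.
rewrite mulf_eq0 => /orP[/eqP m0|/eqP oy0].
  by rewrite oQm m0 mul0r ltxx in oQ.
by have := nreg_ord yP; rewrite oy0 ltxx.
Qed.

Definition pole_divisor G P y := forall Q,
  if y \in reg Q then hits G P Q = 0%N else ord Q y = - (hits G P Q)%:Z.

Lemma generates_pole_divisor G y P : generates G y -> y \notin reg P ->
  pole_divisor G P y.
Proof.
move=> gy yP Q; have yG := generates_fixed gy.
have [yQ|yQ] := boolP (y \in reg Q).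
  apply/eqP; rewrite -leqn0 leqNgt; apply/hits_gt0P => -[s sG sP].
  by rewrite -sP (fixed_reg_act _ yG) // (negPf yP) in yQ.
have /hits_gt0P[s sG <-] := generates_poles_conj gy yP yQ.
by rewrite (fixed_ord_act _ yG) // (generates_ord_pole gy) // hits_actr.
Qed.

Lemma pole_divisor_vge G P y Q : pole_divisor G P y -> vge Q (- (hits G P Q)%:Z) y.
Proof.
move=> /(_ Q); have [yQ ->|yQ oy] := boolP (y \in reg Q).
  by rewrite oppr0 -reg_vge.
by rewrite vge_ord ?oy // (nreg_neq0 yQ).
Qed.

(** In lowest terms [u = p(y) / q(y)], a root [r] of [q] would give a pole of [u]
    at a place where [y = r]; the degree of [p] is read off the pole at [P]. *)
Lemma pole_divisor_poly G P y u (m : nat) : generates G y -> y \notin reg P ->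
    u \in sf_mem (fixed G) -> (forall Q, vge Q (- (m%:Z * (hits G P Q)%:Z)) u) ->
  exists2 p : {poly k}, (size p <= m.+1)%N & u = ev y p.
Proof.
move=> gy yP uG um; have py := generates_pole_divisor gy yP.
have ny := nreg_nonconst yP.
have [->|u0] := eqVneq u 0; first by exists 0; rewrite ?size_poly0 ?rmorph0.
have [p [q [cpq q0 uE]]] : exists p q : {poly k}, [/\ coprimep p q, q != 0 & u * ev y q = ev y p].
  have := uG; rewrite gy => /asboolP[p [q [qy uE]]].
  rewrite -[_.[_]]/(ev y q) in qy uE; rewrite -[(map_poly _ p).[_]]/(ev y p) in uE.
  have q0 : q != 0 by apply: contraNneq qy => ->; rewrite rmorph0.
  have g0 : gcdp p q != 0 by rewrite gcdp_eq0 negb_and q0 orbT.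
  have eg0 : ev y (gcdp p q) != 0 by rewrite ev_eq0.
  exists (p %/ gcdp p q), (q %/ gcdp p q); split.
  - by rewrite coprimep_div_gcd // q0 orbT.
  - by rewrite dvdp_div_eq0 ?dvdp_gcdr.
  apply: (mulIf eg0); rewrite -mulrA -!rmorphM !divpK ?dvdp_gcdl ?dvdp_gcdr //=.
  by rewrite uE divfK.
have sq : size q = 1%N.
  apply/eqP; apply: contraT => /closed_rootP[r qr].
  have [Q yr] := place_at_value r ny.
  have yQ : y \in reg Q by rewrite -(subrK (cst r) y) regD ?reg_cst ?mx_reg.
  have uQ : u \in reg Q.
    by have := um Q; have := py Q; rewrite yQ => ->; rewrite mulr0 oppr0 -reg_vge.
  have qm : ev y q \in mx Q by have := ev_value q yr; rewrite (rootP qr) rmorph0 subr0.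
  have pm : ev y p \in mx Q by rewrite -uE mxMl.
  have := mxB pm (ev_value p yr); rewrite opprB addrC subrK mx_cst => pr.
  by have := coprimep_root cpq pr; rewrite (rootP qr) eqxx.
have [c c0 qc] : exists2 c, c != 0 & q = c%:P.
  by have /size_poly1P := introT eqP sq.
have {}uE : u = ev y (c^-1 *: p).
  by rewrite evZ -uE qc evC mulrCA fmorphV mulVf ?mulr1 // fmorph_eq0.
exists (c^-1 *: p) => //.
have p0 : c^-1 *: p != 0 by apply: contraNneq u0 => e; rewrite uE e rmorph0.
have := um P; rewrite vge_ord // uE ord_ev_pole // (generates_ord_pole gy) //.
have := hits_self G P; move: (hits G P P) => h h0.
case: (size _) => // n; rewrite /= mulrN lerN2 -!PoszM lez_nat leq_pmul2r //.
Qed.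

(** By [ramification_ge] the order of [w] at [P] is exactly minus the least
    positive order of an invariant there. Hence an invariant function with poles
    only along the orbit of [P] is a polynomial in [w], by cancelling leading
    terms at [P], and every invariant is a quotient of two such functions. *)
Lemma minimal_pole_generates G P w : nonconst w -> w \in sf_mem (fixed G) ->
  (forall Q, vge Q (- (hits G P Q)%:Z) w) -> generates G w /\ w \notin reg P.
Proof.
move=> nw wG wv; have w0 := nonconst_neq0 nw.
have inv_reg u Q : u \in sf_mem (fixed G) -> (0 < hits G P Q)%N ->
   (u \in reg Q) = (u \in reg P).
  by move=> uG /hits_gt0P[s sG <-]; rewrite (fixed_reg_act _ uG).
have wP : w \notin reg P.
  have [Q wQ] := pole_exists nw; have := wv Q.
  have [h0|h0] := posnP (hits G P Q); first by rewrite h0 oppr0 -reg_vge (negPf wQ).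
  by rewrite -(inv_reg w Q).
split=> //; have := wv P; rewrite vge_ord // => ow_ge.
set h := (hits G P P)%:Z in ow_ge.
have h0 : 0 < h by rewrite ltz_nat hits_self.
have ow : ord P w = - h.
  apply/eqP; rewrite eq_le ow_ge andbT lerNr -ordV; apply: ramification_ge.
  - by rewrite rpredV.
  - by rewrite invr_eq0.
  - by rewrite ordV oppr_gt0 nreg_ord.
have polyw (m : nat) u : u \in sf_mem (fixed G) ->
    (forall Q, hits G P Q = 0%N -> u \in reg Q) -> vge P (- m%:Z) u ->
    exists p, u = ev w p.
  elim: m u => [|m IHm] u uG uQ um.
    have [[c ->]|nu] := pselect (exists c, u = cst c); first by exists c%:P; rewrite evC.
    have [|Q /negP[]] := @pole_exists _ _ u; first by move=> c uc; apply: nu; exists c.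
    have [|hQ] := posnP (hits G P Q); first exact: uQ.
    by rewrite inv_reg // reg_vge.
  have [|um'] := boolP (vge P (- m%:Z) u); first exact: IHm.
  have u0 : u != 0 by apply: contraNneq um' => ->; rewrite vge0.
  have ou : ord P u = - m.+1%:Z.
    by move: um um'; rewrite !vge_ord //; lia.
  (* [w^q / u] has order the remainder of [m + 1] by [#Stab(P)], too small to be
     positive. *)
  pose q := (m.+1 %/ hits G P P)%N.
  have wq0 : w ^+ q != 0 by rewrite expf_neq0.
  have owu : ord P (w ^+ q / u) = (m.+1 %% hits G P P)%:Z.
    rewrite ordM ?invr_eq0 // ordV ordX // ow ou opprK.
    have := divn_eq m.+1 (hits G P P); rewrite -/q /h -mulr_natl natz.
    nia.
  have r0 : (m.+1 %% hits G P P)%N = 0%N.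
    apply/eqP; rewrite -leqn0 leqNgt; apply/negP => r0.
    have := @ramification_ge _ _ G P (w ^+ q / u); rewrite owu => /(_ _ _ _).
    rewrite rpred_div ?rpredX // mulf_neq0 ?invr_eq0 // ltz_nat => /(_ isT isT r0).
    by rewrite lez_nat leqNgt ltn_pmod // hits_self.
  rewrite r0 in owu; have z0 : u / w ^+ q != 0 by rewrite mulf_neq0 ?invr_eq0.
  have oz : ord P (u / w ^+ q) = 0 by rewrite -invf_div ordV owu oppr0.
  have [c uc] : exists c, u / w ^+ q - cst c \in mx P.
    by apply: value_ex; rewrite reg_ord ?oz.
  have [|Q hQ||p pE] := IHm (u - cst c * w ^+ q).
  - by rewrite rpredB // rpredM ?rpredX // const_fixed.
  - by rewrite regB ?uQ // regM ?reg_cst // regX // reg_vge; have := wv Q; rewrite hQ oppr0.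
  - have -> : u - cst c * w ^+ q = (u / w ^+ q - cst c) * w ^+ q by rewrite mulrBl divfK.
    have -> : - m%:Z = 1 + - m.+1%:Z by clear; lia.
    apply: vgeM; first by rewrite -mx_vge.
    have -> : - m.+1%:Z = ord P (w ^+ q) by rewrite -ou -[u](divfK wq0) ordM // oz add0r.
    by rewrite vge_ord.
  - by exists (p + c *: 'X^q); rewrite rmorphD evZ rmorphXn /= evX -pE subrK.
move=> y; apply/idP/idP => [yG|]; last by apply: kx_sub => // c; apply: const_fixed.
have [b b0 by_] := clear_denominator y nw.
have eb0 : ev w b != 0 by rewrite ev_eq0.
have [|Q hQ||p pE] := polyw `|ord P (ev w b * y)|%N (ev w b * y).
- by rewrite rpredM // fixed_ev.
- by apply: by_; rewrite reg_vge; have := wv Q; rewrite hQ oppr0.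
- have [->|z0] := eqVneq (ev w b * y) 0; first by rewrite vge0.
  by rewrite vge_ord //; clear; lia.
by apply/asboolP; exists p, b; split=> //; rewrite -[_.[w]]/(ev w p) -pE mulrC mulKf.
Qed.

(** Among the [x + c y], with [x] separating [t] from the tail of the list and [y]
    from its head, each automorphism of the list excludes at most one constant
    [c], and [k] is infinite. *)
Lemma separating_element (l : seq (aut C)) t : t \notin l ->
  exists x, forall s, s \in l -> t x != s x.
Proof.
elim: l => [_|s0 l IH]; first by exists 0.
rewrite inE negb_or => /andP[ts0 /IH[x xl]].
have [y ysn] : exists y, t y != s0 y.
  apply: contrapT => none; case/eqP: ts0; apply: kaut_eq => y; apply/eqP.
  by apply/negPn/negP => h; apply: none; exists y.
have /choice[bad badP] : forall s, exists b, forall c, c != b ->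
    (s \in s0 :: l) -> t (x + cst c * y) != s (x + cst c * y).
  move=> s; apply: contrapT => nob.
  have {}nob b : exists2 c, c != b & (s \in s0 :: l) /\ t (x + cst c * y) = s (x + cst c * y).
    apply: contrapT => nc; apply: nob; exists b => c cb sl; apply/eqP => e.
    by apply: nc; exists c.
  have [c _ [sl ec]] := nob 0; have [d dc [_ ed]] := nob c.
  have dcn : cst d - cst c != 0 by rewrite -rmorphB fmorph_eq0 subr_eq0.
  have ey : t y = s y.
    apply: (mulfI dcn); have : t (x + cst d * y) - t (x + cst c * y) =
      s (x + cst d * y) - s (x + cst c * y) by rewrite ec ed.
    rewrite !rmorphD !rmorphM /= !kaut_const => e.
    transitivity (t x + cst d * t y - (t x + cst c * t y)); first by ring.
    by rewrite e; ring.
  have ex : t x = s x.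
    by move: ec; rewrite !rmorphD !rmorphM /= !kaut_const ey => /addIr.
  move: sl; rewrite inE => /orP[/eqP se|/xl]; last by rewrite ex eqxx.
  by rewrite -se ey eqxx in ysn.
have [c cl] := avoid_constants [seq bad s | s <- s0 :: l].
exists (x + cst c * y) => s sl; apply: badP => //.
by apply: contraNneq cl => ->; apply: map_f.
Qed.

(** Such a [t] permutes the conjugates of each [x], so it agrees at [x] with some
    element of [G]; [separating_element] makes one of them agree everywhere. *)
Lemma fixing_fixed G t : (forall f, f \in sf_mem (fixed G) -> t f = f) ->
  t \in fsg_set G.
Proof.
move=> tG; apply/negPn/negP => /separating_element[x xG].
have [q _ qE] := orbit_poly_fixed G x.
have : root (orbit_poly G x) (t x).
  have -> : orbit_poly G x = map_poly t (orbit_poly G x).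
    rewrite qE -map_poly_comp; apply: eq_map_poly => -[f fG] /=; exact/esym/tG.
  by rewrite rootE horner_map fmorph_eq0 -rootE orbit_poly_root.
rewrite /orbit_poly -(big_map (fun s : aut C => s x) xpredT (fun y => 'X - y%:P)).
by rewrite root_prod_XsubC => /mapP[s sG /eqP]; rewrite (negPf (xG s sG)).
Qed.

End Generators.

(** * Forms and homogeneous coordinates *)

Section Forms.
Variables (k : closedFieldType) (n : nat).
Implicit Types (A B : {mpoly k[n]}) (m : 'X_{1..n}).

Lemma homog_coef0 d A m : A \is d.-homog -> A@_m != 0 -> mdeg m = d.
Proof. by move=> Ad; rewrite -mcoeff_msupp; apply: (dhomogP _ _ _ Ad). Qed.

Lemma mmap_scale (S : comNzRingType) (f : {rmorphism k -> S}) (u v : 'I_n -> S) (h : S) d A :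
  (forall i, v i = h * u i) -> A \is d.-homog -> mmap f v A = h ^+ d * mmap f u A.
Proof.
move=> vE Ad; rewrite /mmap mulr_sumr big_seq [RHS]big_seq; apply: eq_bigr => m mA.
rewrite mulrCA; congr (_ * _); rewrite /mmap1.
under eq_bigr => i _ do rewrite vE exprMn.
by rewrite big_split /= prodrXr -mdegE (dhomogP _ _ _ Ad _ mA).
Qed.

Lemma meval_scale (v : 'I_n -> k) c d A : A \is d.-homog ->
  A.@[fun i => c * v i] = c ^+ d * A.@[v].
Proof. by move=> Ad; apply: (mmap_scale idfun). Qed.

Lemma meval_vertex j d A : A \is d.-homog -> A.@[fun i => (i == j)%:R] = A@_(U_(j) *+ d).
Proof.
move=> Ad; rewrite mevalE.
have term m : m \in msupp A -> \prod_i (i == j)%:R ^+ m i = (m == (U_(j) *+ d)%MM)%:R :> k.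
  move=> mA; have md : mdeg m = d := dhomogP _ _ _ Ad _ mA.
  have [->|ne] := eqVneq.
    rewrite big1 // => i _; rewrite mulmnE mnm1E eq_sym.
    by case: eqP => _; rewrite ?expr1n ?mul0n ?expr0.
  have [i ij mi] : exists2 i, i != j & m i != 0%N.
    apply: contrapT => none; case/eqP: ne; apply/mnmP => i.
    have m0 l : l != j -> m l = 0%N.
      by move=> lj; apply/eqP/negPn/negP => ml; apply: none; exists l.
    rewrite mulmnE mnm1E; have [<-|/= ji] := eqVneq j i; last by rewrite mul0n m0 // eq_sym.
    by rewrite mul1n -md mdegE (bigD1 j) //= big1 ?addn0 // => l /m0.
  by rewrite (bigD1 i) //= (negPf ij) expr0n (negPf mi) mul0r.
rewrite big_seq; under eq_bigr => m mA do rewrite term //.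
rewrite -big_seq; have [js|js] := boolP ((U_(j) *+ d)%MM \in msupp A).
  rewrite (bigD1_seq (U_(j) *+ d)%MM) ?msupp_uniq //= eqxx mulr1 big1 ?addr0 //.
  by move=> m /negPf->; rewrite mulr0.
rewrite (eqP (_ : A@_(U_(j) *+ d) == 0)) ?mcoeff_eq0 // big_seq big1 // => m mA.
by case: eqP mA => [->|_ _]; rewrite ?(negPf js) ?mulr0.
Qed.

Lemma mderiv_homog d A i : A \is d.+1.-homog -> A^`M(i) \is d.-homog.
Proof.
move=> Ad; apply/dhomogP => m; rewrite mcoeff_msupp mcoeff_mderiv => h.
have : A@_(m + U_(i)) != 0 by apply: contraNneq h => ->; rewrite mul0rn.
by move/(homog_coef0 Ad); rewrite mdegD mdeg1 addn1 => -[].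
Qed.

Lemma mcoeff_neq0_exists A : A != 0 -> exists m, A@_m != 0.
Proof.
move=> A0; apply: contrapT => none; case/eqP: A0; apply/mpolyP => m.
by rewrite mcoeff0; apply/eqP/negPn/negP => h; apply: none; exists m.
Qed.

Section Eval.
Variables (L : kfield k) (x : 'rV[L]_n).
Local Notation cst := (kf_const L).

Lemma hom_evalE A : hom_eval A x = \sum_(m <- msupp A) cst A@_m * \prod_i x 0 i ^+ m i.
Proof. by []. Qed.
Lemma hom_evalM A B : hom_eval (A * B) x = hom_eval A x * hom_eval B x.
Proof. exact: rmorphM. Qed.
Lemma hom_evalB A B : hom_eval (A - B) x = hom_eval A x - hom_eval B x.
Proof. exact: rmorphB. Qed.
Lemma hom_evalD A B : hom_eval (A + B) x = hom_eval A x + hom_eval B x.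
Proof. exact: rmorphD. Qed.
Lemma hom_eval1 : hom_eval 1 x = 1. Proof. exact: rmorph1. Qed.
Lemma hom_eval0 : hom_eval 0 x = 0. Proof. exact: rmorph0. Qed.
Lemma hom_evalC c : hom_eval c%:MP x = cst c. Proof. exact: mmapC. Qed.
Lemma hom_evalX i : hom_eval 'X_i x = x 0 i.
Proof. by rewrite /hom_eval mmapX mmap1U. Qed.
Lemma hom_evalXm m : hom_eval 'X_[m] x = \prod_i x 0 i ^+ m i.
Proof. by rewrite /hom_eval mmapX. Qed.
Lemma hom_evalXn A d : hom_eval (A ^+ d) x = hom_eval A x ^+ d.
Proof. exact: rmorphXn. Qed.
Lemma hom_evalZ c A : hom_eval (c *: A) x = cst c * hom_eval A x.
Proof. exact: mmapZ. Qed.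
Lemma hom_eval_sum (I : Type) (r : seq I) (F : I -> {mpoly k[n]}) :
  hom_eval (\sum_(i <- r) F i) x = \sum_(i <- r) hom_eval (F i) x.
Proof. exact: rmorph_sum. Qed.

Lemma homogX i d : ('X_i : {mpoly k[n]}) ^+ d \is d.-homog.
Proof. by rewrite mpolyXn dhomogX /= mdegMn mdeg1 mul1n. Qed.

Lemma homog1X i : ('X_i : {mpoly k[n]}) \is 1.-homog.
Proof. by rewrite dhomogX /= mdeg1. Qed.

Lemma homogC c : (c%:MP : {mpoly k[n]}) \is 0.-homog.
Proof. by rewrite -[c%:MP]mulr1 mul_mpolyC dhomogZ // dhomog1. Qed.

Definition ratio_mem : {pred L} := fun f => `[< ratio_field x f >].

Lemma ratio_closed : divring_closed ratio_mem.
Proof.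
split=> [|_ _ /asboolP[d [A [B [Ad Bd B0 ->]]]] /asboolP[e [A' [B' [Ae Be B0' ->]]]]
         |_ _ /asboolP[d [A [B [Ad Bd B0 ->]]]] /asboolP[e [A' [B' [Ae Be B0' ->]]]]];
  apply/asboolP.
- by exists 0%N, 1, 1; rewrite hom_eval1 oner_eq0 divr1 dhomog1.
- exists (d + e)%N, (A * B' - A' * B), (B * B'); rewrite hom_evalB !hom_evalM.
  split; [|exact: dhomogM|exact: mulf_neq0|by field; rewrite B0 B0'].
  by apply: rpredB; [exact: dhomogM|rewrite addnC; exact: dhomogM].
- have [A0|A0] := eqVneq (hom_eval A' x) 0.
    exists 0%N, 0, 1; rewrite hom_eval1 hom_eval0 oner_eq0 dhomog1 A0 mul0r invr0 mulr0 mul0r.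
    by rewrite rpred0.
  exists (d + e)%N, (A * B'), (B * A'); rewrite !hom_evalM.
  by split; [exact: dhomogM|exact: dhomogM|exact: mulf_neq0|rewrite invf_div mulf_div].
Qed.

Definition ratio_subfield : subfield L := Subfield ratio_closed.

Lemma ratioP f : f \in sf_mem ratio_subfield <-> ratio_field x f.
Proof. by split=> /asboolP. Qed.

Lemma ratio_const c : cst c \in sf_mem ratio_subfield.
Proof.
apply/ratioP; exists 0%N, c%:MP, 1.
by rewrite hom_eval1 oner_eq0 divr1 dhomog1 hom_evalC homogC.
Qed.

Lemma ratio_coord i j : x 0 j != 0 -> x 0 i / x 0 j \in sf_mem ratio_subfield.
Proof. by move=> xj; apply/ratioP; exists 1%N, 'X_i, 'X_j; rewrite !homog1X !hom_evalX. Qed.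

Lemma ratio_sub (S : subfield L) h : (forall c, cst c \in sf_mem S) -> h != 0 ->
  (forall i, x 0 i / h \in sf_mem S) ->
  forall f, ratio_field x f -> f \in sf_mem S.
Proof.
move=> Sc h0 Sx _ [d [A [B [Ad Bd B0 ->]]]].
have ES (E : {mpoly k[n]}) : mmap cst (fun i => x 0 i / h) E \in sf_mem S.
  rewrite rpred_sum // => m _; rewrite rpredM ?Sc //.
  by rewrite rpred_prod // => i _; rewrite rpredX.
have xE i : x 0 i = h * (x 0 i / h) by rewrite mulrC divfK.
rewrite /hom_eval (mmap_scale cst xE Ad) (mmap_scale cst xE Bd).
by rewrite -mulf_div divff ?mul1r ?rpred_div // expf_neq0.
Qed.

(** Substituting [t x] for [x] turns a factorization [F = A B] into
    [A(t x) B(t x) = 0] in [L[t]]. So all the homogeneous parts of one factor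
    vanish at [x], that factor is a multiple of [F], and the other is constant. *)
Lemma vanishing_form_irreducible F d : F \is d.-homog -> F != 0 ->
  (forall e A, A \is e.-homog -> hom_eval A x = 0 <-> exists B, A = B * F) ->
  forall A B, F = A * B -> (msize A <= 1)%N \/ (msize B <= 1)%N.
Proof.
move=> Fd F0 Fdiv.
pose rho A : {poly L} := mmap (polyC \o cst) (fun i => (x 0 i)%:P * 'X) A.
have rhoE e A : A \is e.-homog -> rho A = (hom_eval A x)%:P * 'X^e.
  move=> Ae; rewrite /rho (@mmap_scale _ _ (fun i => (x 0 i)%:P) _ 'X e) //; last first.
    by move=> i; rewrite mulrC.
  rewrite mulrC; congr (_ * _); rewrite hom_evalE rmorph_sum; apply: eq_bigr => m _.
  rewrite rmorphM rmorph_prod; congr (_ * _); apply: eq_bigr => i _.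
  by rewrite rmorphXn.
have div A : rho A = 0 -> exists B, A = B * F.
  move=> A0; have AE := pihomog_partitionE (mf := mdeg) (leqnn (msize A)).
  have part (e : 'I_(msize A)) : exists B, pihomog mdeg e A = B * F.
    apply/(Fdiv e); first exact: pihomogP.
    have := congr1 (fun p : {poly L} => p`_e) A0; rewrite coef0 {1}AE /rho rmorph_sum /= => <-.
    rewrite coef_sum (bigD1 e) //= big1 => [|l le].
      rewrite -[mmap _ _ _]/(rho _) (rhoE e) ?pihomogP // coefCM coefXn eqxx mulr1 addr0 //.
    rewrite -[mmap _ _ _]/(rho _) (rhoE l) ?pihomogP // coefCM coefXn.
    by rewrite (inj_eq val_inj) eq_sym (negPf le) mulr0.
  have /choice[Q QE] := part; exists (\sum_e Q e).
  by rewrite [LHS]AE mulr_suml; apply: eq_bigr => e _.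
have small A B : F = A * B -> rho A = 0 -> (msize B <= 1)%N.
  move=> FE /div[A' AE]; have BA : B * A' = 1.
    by apply: (mulIf F0); rewrite mul1r -mulrA -AE mulrC.
  have B0 : B != 0 by apply: contra_eq_neq BA => ->; rewrite mul0r eq_sym oner_eq0.
  have A0 : A' != 0 by apply: contra_eq_neq BA => ->; rewrite mulr0 eq_sym oner_eq0.
  have := congr1 (fun p => msize p) BA; rewrite /= msizeM // msize1.
  have : (0 < msize A')%N by rewrite lt0n msize_poly_eq0.
  have : (0 < msize B)%N by rewrite lt0n msize_poly_eq0.
  move: (msize B) (msize A') => b a; lia.
move=> A B FE; have /eqP : rho A * rho B = 0.
  have -> : rho A * rho B = rho (A * B) by rewrite /rho rmorphM.
  rewrite -FE (rhoE d) // (iffRL (Fdiv d F Fd)) ?mul0r //.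
  by exists 1; rewrite mul1r.
rewrite mulf_eq0 => /orP[]/eqP h; [right|left]; apply: small h => //.
by rewrite mulrC.
Qed.

End Eval.
End Forms.

(** * The equation of the plane model *)

Section ThreeIndices.
Variables (a b j : 'I_3).
Hypotheses (ab : a != b) (aj : a != j) (bj : b != j).

Lemma ord3_cover i : [|| i == a, i == b | i == j].
Proof.
move: ab aj bj; rewrite -!val_eqE /=.
have := ltn_ord i; have := ltn_ord a; have := ltn_ord b; have := ltn_ord j; lia.
Qed.

Lemma big_ord3 (R : Type) (idx : R) (op : Monoid.com_law idx) (F : 'I_3 -> R) :
  \big[op/idx]_i F i = op (F a) (op (F b) (F j)).
Proof.
rewrite (bigD1 a) // (bigD1 b) 1?eq_sym //= (bigD1 j) /=; last first.
  by rewrite ![j == _]eq_sym aj bj.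
rewrite big_pred0 ?Monoid.mulm1 // => i.
by case/or3P: (ord3_cover i) => /eqP->; rewrite eqxx ?andbF.
Qed.

Lemma mdeg3 (m : 'X_{1..3}) : mdeg m = (m a + (m b + m j))%N.
Proof. by rewrite mdegE big_ord3. Qed.

Lemma mnm3_eq (m m' : 'X_{1..3}) : mdeg m = mdeg m' -> m b = m' b -> m j = m' j -> m = m'.
Proof.
rewrite !mdeg3 => md mb mj; have ma : m a = m' a by lia.
by apply/mnmP => i; case/or3P: (ord3_cover i) => /eqP->.
Qed.
End ThreeIndices.

Section PlaneEquation.
Variables (k : closedFieldType) (C : curve k).
Local Notation cst := (kf_const C).
Implicit Types (P Q : cpoint C) (s t : aut C) (G : finsubgroup (aut C)).

Lemma uniq_conjugates G (y : C) : (forall s, s \in fsg_set G -> s y = y -> s = 1%g) ->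
  uniq [seq s y | s : aut C <- fsg_set G].
Proof.
move=> st; rewrite map_inj_in_uniq ?fset_uniq // => s t sG tG /= e.
have : (t^-1 * s)%g = 1%g.
  apply: st; first by rewrite fsgM ?fsgV.
  by rewrite -[LHS]/(kaut_inv t (s y)) e kautK.
by move/(congr1 (fun u => (t * u)%g)); rewrite mulgA mulgV mul1g mulg1.
Qed.

Lemma invariant_poly_roots G (y : C) (R : {poly C}) :
  (forall s, s \in fsg_set G -> s y = y -> s = 1%g) ->
  (forall i, R`_i \in sf_mem (fixed G)) -> root R y ->
  (size R <= size (fsg_set G))%N -> R = 0.
Proof.
move=> st RG Ry sR; apply/eqP; apply: contraLR sR => R0; rewrite -ltnNge.
rewrite -(size_map (fun s : aut C => s y)); apply: max_poly_roots => //.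
  apply/allP => _ /mapP[s sG ->].
  have -> : R = map_poly s R.
    by apply/polyP => i; rewrite coef_map /= (fixedP _ _ (RG i)).
  by rewrite rootE horner_map (rootP Ry) rmorph0.
exact: uniq_conjugates.
Qed.

(** Divided by [x_a^d], the form is a polynomial of degree less than [#G] in
    [x_j / x_a] with invariant coefficients, so it vanishes at the [#G] conjugates
    of [x_j / x_a]. Its coefficients are then zero, and they are polynomials in
    [x_b / x_a], which is transcendental. *)
Lemma low_degree_zero G (x : 'rV[C]_3) (a b j : 'I_3) d (A : {mpoly k[3]}) :
    a != b -> a != j -> b != j -> x 0 a != 0 ->
    x 0 b / x 0 a \in sf_mem (fixed G) -> nonconst (x 0 b / x 0 a) ->
    (forall s, s \in fsg_set G -> s (x 0 j / x 0 a) = x 0 j / x 0 a -> s = 1%g) ->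
    A \is d.-homog -> (forall m, A@_m != 0 -> (m j < size (fsg_set G))%N) ->
  hom_eval A x = 0 -> A = 0.
Proof.
move=> ab aj bj xa0 bG bn jst Ad Aj Ax.
set y := x 0 b / x 0 a in bG bn; set z := x 0 j / x 0 a in jst.
pose R : {poly C} := \sum_(m <- msupp A) (cst A@_m * y ^+ m b) *: 'X^(m j).
have Rc i : R`_i = ev y (\sum_(m <- msupp A) (A@_m * (i == m j)%:R) *: 'X^(m b)).
  rewrite coef_sum rmorph_sum; apply: eq_bigr => m _.
  rewrite coefZ coefXn evZ rmorphXn /= evX rmorphM rmorph_nat; ring.
have R0 : R = 0.
  apply: (invariant_poly_roots jst).
  - by move=> i; rewrite Rc fixed_ev.
  - apply/eqP; rewrite horner_sum; apply: (mulfI (expf_neq0 d xa0)).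
    rewrite mulr0 -[RHS]Ax hom_evalE mulr_sumr big_seq [RHS]big_seq.
    apply: eq_bigr => m mA; rewrite hornerZ hornerXn (big_ord3 ab aj bj).
    have <- : mdeg m = d := dhomogP _ _ _ Ad _ mA.
    rewrite (mdeg3 ab aj bj m) !exprD /y /z !expr_div_n /=.
    have e1 : x 0 a ^+ m b != 0 by rewrite expf_neq0.
    have e2 : x 0 a ^+ m j != 0 by rewrite expf_neq0.
    move: (x 0 a ^+ m b) (x 0 a ^+ m j) e1 e2 => u v u0 v0; field.
    by rewrite u0 v0.
  - apply/leq_sizeP => i ni; rewrite Rc big_seq big1 ?rmorph0 // => m.
    rewrite mcoeff_msupp => /Aj mj.
    by have -> : (i == m j) = false; [apply/eqP; lia|rewrite mulr0 scale0r].
apply/mpolyP => m; rewrite mcoeff0; apply/eqP; apply/negPn/negP => Am.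
have := congr1 (fun p : {poly C} => p`_(m j)) R0; rewrite coef0 Rc.
move/eqP; rewrite ev_eq0 // => /eqP/(congr1 (fun p : {poly k} => p`_(m b))).
rewrite coef0 coef_sum (bigD1_seq m) ?mcoeff_msupp ?msupp_uniq //= eqxx.
rewrite coefZ coefXn eqxx !mulr1 big_seq_cond big1 ?addr0 => [/eqP|m' /andP[mA' ne]].
  exact/negP.
rewrite coefZ coefXn; have [mj|] := eqVneq (m j) (m' j); last by rewrite mulr0 mul0r.
have [mb|] := eqVneq (m b) (m' b); last by rewrite mulr0.
case/eqP: ne; apply: (mnm3_eq ab aj bj) => //.
by rewrite (homog_coef0 Ad Am) (homog_coef0 Ad) // -mcoeff_msupp.
Qed.

(** The coefficient of [T^j] is a sum of products of [size l - j] distinct roots,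
    each using up its own correction [b] to the common bound [N]. *)
Lemma prod_coef_vge Q (l : seq (aut C)) (F : aut C -> C) (b : aut C -> int) (N : int) :
  (forall s, 0 <= b s) -> 0 <= N -> (forall s, vge Q (- (b s + N)) (F s)) ->
  forall j, vge Q (- (\sum_(s <- l) b s + ((size l)%:Z - j%:Z) * N))
    (\prod_(s <- l) ('X - (F s)%:P))`_j.
Proof.
move=> b0 N0 bF; elim: l => [|s l IH] j.
  rewrite !big_nil coef1; case: j => [|j]; last by rewrite vge0.
  by rewrite subrr mul0r addr0 oppr0 -(rmorph1 cst) vge_cst.
have [jl|lj] := ltnP (size l).+1 j.
  by rewrite nth_default ?vge0 // size_prod_XsubC.
rewrite !big_cons [('X - _) * _]mulrBl mul_polyC coefB coefXM coefZ.
apply: vgeD; last rewrite vgeN.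
  case: j lj => [|j] lj /=; first by rewrite vge0.
  apply: vge_le (IH j); rewrite /=; have := b0 s; lia.
have := vgeM (bF s) (IH j); apply: vge_le => /=; lia.
Qed.

(** The conjugate [s y] has an excess pole at [Q] only if [Q = s P]; over [G] the
    excesses add up to [hits G P Q], the pole allowed for one more root. *)
Lemma poly_coef_vge Q G P (y : C) :
  (forall Q, vge Q (- ((hits G P Q)%:Z + (Q == P)%:Z)) y) ->
  forall j, vge Q (- (((size (fsg_set G)).+1%:Z - j%:Z) * (hits G P Q)%:Z))
    (\prod_(s <- fsg_set G) ('X - (s y)%:P))`_j.
Proof.
move=> yv j.
pose b s : int := (s \in fsg_set G) && (act s^-1%g Q == P).
pose F s : C := if s \in fsg_set G then s y else 0.
have bF s : vge Q (- (b s + (hits G P Q)%:Z)) (F s).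
  rewrite /b /F; case: ifP => sG /=; last by rewrite vge0.
  rewrite vge_actV; have := yv (act s^-1%g Q).
  by rewrite hits_actr ?fsgV // addrC.
have := @prod_coef_vge Q (fsg_set G) F b (hits G P Q)%:Z _ _ bF j.
have -> : \prod_(s <- fsg_set G) ('X - (F s)%:P) = \prod_(s <- fsg_set G) ('X - (s y)%:P).
  by rewrite big_seq [RHS]big_seq; apply: eq_bigr => s sG; rewrite /F sG.
move=> h; have := h (fun _ => isT) isT; congr (is_true (vge _ (- _) _)).
rewrite -addn1 PoszD.
have -> : \sum_(s <- fsg_set G) b s = (hits G P Q)%:Z.
  rewrite hits_sum -[RHS]natz natr_sum big_seq [RHS]big_seq; apply: eq_bigr => s sG.
  by rewrite /b sG natz.
ring.
Qed.

Definition coord0 : 'I_3 := @Ordinal 3 0 isT.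
Definition coord1 : 'I_3 := @Ordinal 3 1 isT.
Definition coord2 : 'I_3 := @Ordinal 3 2 isT.

Lemma coord01 : coord0 != coord1. Proof. by []. Qed.
Lemma coord21 : coord2 != coord1. Proof. by []. Qed.
Lemma coord20 : coord2 != coord0. Proof. by []. Qed.

Definition mon (i j l : nat) : 'X_{1..3} :=
  (U_(coord0) *+ i + U_(coord1) *+ j + U_(coord2) *+ l)%MM.

Lemma mon0 i j l : mon i j l coord0 = i.
Proof. by rewrite !mnmDE !mulmnE !mnm1E /= mul1n !mul0n !addn0. Qed.
Lemma mon1 i j l : mon i j l coord1 = j.
Proof. by rewrite !mnmDE !mulmnE !mnm1E /= !mul0n mul1n add0n addn0. Qed.
Lemma mon2 i j l : mon i j l coord2 = l.
Proof. by rewrite !mnmDE !mulmnE !mnm1E /= !mul0n mul1n. Qed.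
Lemma mdeg_mon i j l : mdeg (mon i j l) = (i + j + l)%N.
Proof. by rewrite !mdegD !mdegMn !mdeg1 !mul1n. Qed.

Section Model.
Variables (G : finsubgroup (aut C)) (P : cpoint C) (f g : C).
Let n := size (fsg_set G).
Hypotheses (gen_f : generates G f) (pole_f : f \notin reg P).
Hypothesis g_vge : forall Q, vge Q (- ((hits G P Q)%:Z + (Q == P)%:Z)) g.

Definition model_point : 'rV[C]_3 :=
  \row_i if i == coord0 then f else if i == coord1 then g else 1.
Local Notation x := model_point.

Lemma model0 : x 0 coord0 = f. Proof. by rewrite mxE. Qed.
Lemma model1 : x 0 coord1 = g. Proof. by rewrite mxE. Qed.
Lemma model2 : x 0 coord2 = 1. Proof. by rewrite mxE. Qed.

Lemma model_nonconst : nonconst f. Proof. exact: nreg_nonconst pole_f. Qed.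

Lemma model_eval_mon m : hom_eval 'X_[m] x = f ^+ m coord0 * g ^+ m coord1.
Proof.
rewrite hom_evalXm (big_ord3 coord20 coord21 coord01) /= model0 model1 model2.
by rewrite expr1n mul1r.
Qed.

(** The characteristic polynomial of [g] over [k(f)] has polynomial
    coefficients, by the bound on the poles of [g], and homogenizes to a form of
    degree [#G + 1] with the single top term [X_1^#G X_2]. *)
Lemma equation_exists : exists F' : {mpoly k[3]},
  [/\ F' \is n.+1.-homog, forall m, F'@_m != 0 -> (m coord1 < n)%N
    & hom_eval ('X_[mon 0 n 1] + F') x = 0].
Proof.
pose Phi : {poly C} := \prod_(s <- fsg_set G) ('X - (s g)%:P).
have PhiE : Phi = orbit_poly G g by [].
have PhiG j : Phi`_j \in sf_mem (fixed G).
  have [q _ qE] := orbit_poly_fixed G g.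
  by rewrite PhiE qE coef_map; case: q`_j.
have /choice[A AP] : forall j : 'I_n, exists A : {poly k},
    (size A <= n.+2 - j)%N /\ Phi`_j = ev f A.
  move=> j; have jn := ltn_ord j.
  have [|A sA AE] := @pole_divisor_poly _ _ G P f Phi`_j (n.+1 - j) gen_f pole_f (PhiG j).
    move=> Q; have := poly_coef_vge Q g_vge j.
    by rewrite -/n -/Phi subzn // ltnW // ltnW.
  by exists A; split=> //; apply: leq_trans sA _; lia.
(* The coefficient of [T^j] has degree at most [n + 1 - j] in [f]. *)
exists (\sum_(j < n) \sum_(i < n.+2 - j) (A j)`_i *: 'X_[mon i j (n.+1 - j - i)]).
have Fcoef m : (\sum_(j < n) \sum_(i < n.+2 - j) (A j)`_i *: 'X_[mon i j (n.+1 - j - i)])@_m != 0 ->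
    exists (j : 'I_n) (i : 'I_(n.+2 - j)), m = mon i j (n.+1 - j - i).
  move=> h; apply: contrapT => none; case/eqP: h.
  rewrite raddf_sum /= big1 // => j _; rewrite raddf_sum /= big1 // => i _.
  rewrite mcoeffZ mcoeffX; case: eqP => [e|]; last by rewrite mulr0.
  by case: none; exists j, i.
split.
- apply/dhomogP => m; rewrite mcoeff_msupp => /Fcoef[j [i ->]].
  rewrite /= mdeg_mon; have := ltn_ord i; have := ltn_ord j; lia.
- by move=> m /Fcoef[j [i ->]]; rewrite mon1.
have Phig : Phi.[g] = 0 by apply/rootP; rewrite PhiE orbit_poly_root.
rewrite -[RHS]Phig hom_evalD model_eval_mon mon0 mon1 expr0 mul1r.
have sPhi : size Phi = n.+1 by rewrite /Phi size_prod_XsubC.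
have lPhi : Phi`_n = 1.
  by have /monicP := orbit_poly_monic G g; rewrite -PhiE /lead_coef sPhi.
rewrite horner_coef sPhi big_ord_recr /= lPhi mul1r addrC; congr (_ + _).
rewrite hom_eval_sum; apply: eq_bigr => j _; have [sA ->] := AP j.
rewrite evE (horner_coef_wide _ (n := n.+2 - j)) ?size_map_poly //.
rewrite mulr_suml hom_eval_sum; apply: eq_bigr => i _.
by rewrite hom_evalZ model_eval_mon mon0 mon1 coef_map mulrA.
Qed.

Hypothesis g_ord : ord P g = - ((hits G P P)%:Z + 1).
Hypothesis g_conj : forall s, s \in fsg_set G -> s g = g -> s = 1%g.

Definition reduced (A : {mpoly k[3]}) := forall m : 'X_{1..3},
  (n <= m coord1)%N -> (0 < m coord2)%N -> A@_m = 0.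

(** If the degree in [X_1] is at least [#G], the top term in [X_1] is free of
    [X_2] and alone has the largest pole at [P], where [g] has one pole more than
    [f]. Otherwise that degree is below the number of conjugates of [g]. *)
Lemma reduced_zero d (A : {mpoly k[3]}) : A \is d.-homog -> reduced A ->
  hom_eval A x = 0 -> A = 0.
Proof.
move=> Ad Ared Ax; have [low|/existsNP[m0 /not_implyP[Am0 m0n]]] :=
  pselect (forall m : 'X_{1..3}, A@_m != 0 -> (m coord1 < n)%N).
  apply: (low_degree_zero (G := G) coord20 coord21 coord01 _ _ _ _ Ad low Ax);
    rewrite ?model0 ?model1 ?model2 ?oner_eq0 ?divr1 //.
  - exact: generates_fixed.
  - exact: model_nonconst.
exfalso; have [m Am mmax] : exists2 m, A@_m != 0 &
    forall m', A@_m' != 0 -> (m' coord1 <= m coord1)%N.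
  pose B i := `[< exists2 m : 'X_{1..3}, A@_m != 0 & m coord1 = i >].
  have exB : exists i, B i by exists (m0 coord1); apply/asboolP; exists m0.
  have Bd i : B i -> (i <= d)%N.
    move=> /asboolP[m Am <-]; rewrite -(homog_coef0 Ad Am).
    rewrite (mdeg3 coord20 coord21 coord01); lia.
  have [i /asboolP[m Am mi] imax] := ex_maxnP exB Bd.
  by exists m => // m' Am'; rewrite mi; apply: imax; apply/asboolP; exists m'.
have mn : (n <= m coord1)%N.
  by apply: leq_trans (mmax _ Am0); rewrite leqNgt; apply/negP.
have m2 : m coord2 = 0%N.
  by apply/eqP; rewrite -leqn0 leqNgt; apply: contra Am => m2; apply/eqP/Ared.
have f0 := nreg_neq0 pole_f.
have g0 : g != 0.
  by apply/eqP => g0; have := g_ord; rewrite g0 ord_zero; lia.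
have oT m' : A@_m' != 0 -> ord P (cst A@_m' * (f ^+ m' coord0 * g ^+ m' coord1)) =
    - ((m' coord0)%:Z * (hits G P P)%:Z + (m' coord1)%:Z * ((hits G P P)%:Z + 1)).
  move=> A0; rewrite !ordM ?mulf_neq0 ?expf_neq0 ?fmorph_eq0 // ord_cst // add0r.
  rewrite !ordX // g_ord (generates_ord_pole gen_f pole_f).
  by rewrite -[X in X + _]mulr_natl -[X in _ + X]mulr_natl !natz; ring.
have T0 m' : A@_m' != 0 -> cst A@_m' * (f ^+ m' coord0 * g ^+ m' coord1) != 0.
  by move=> A0; rewrite !mulf_neq0 ?expf_neq0 ?fmorph_eq0.
have := @dominant_term _ _ P _ (msupp A)
  (fun m' => cst A@_m' * (f ^+ m' coord0 * g ^+ m' coord1)) m (msupp_uniq A).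
rewrite mcoeff_msupp => /(_ Am (T0 _ Am)) dom.
have : hom_eval A x != 0; last by rewrite Ax eqxx.
rewrite hom_evalE.
under eq_bigr => m' _ do rewrite -hom_evalXm model_eval_mon.
apply: dom => m'; rewrite mcoeff_msupp => Am' ne.
rewrite vge_ord ?T0 // !oT //.
have := homog_coef0 Ad Am; have := homog_coef0 Ad Am'.
rewrite !(mdeg3 coord20 coord21 coord01) m2 => d' dm.
have := mmax _ Am'; rewrite leq_eqVlt => /orP[/eqP m1|m1]; last by have := hits_self G P; nia.
have m2' : m' coord2 = 0%N.
  apply/eqP; rewrite -leqn0 leqNgt; apply: contra Am' => m2'.
  by apply/eqP/Ared => //; rewrite m1.
case/eqP: ne; apply: (mnm3_eq coord20 coord21 coord01) => //.
  by rewrite !(mdeg3 coord20 coord21 coord01) d' m2 dm.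
by lia.
Qed.

End Model.
End PlaneEquation.

Section ModelIdeal.
Variables (k : closedFieldType) (C : curve k).
Local Notation cst := (kf_const C).
Variables (G : finsubgroup (aut C)) (P : cpoint C) (f g : C).
Let n := size (fsg_set G).
Hypotheses (gen_f : generates G f) (pole_f : f \notin reg P).
Hypothesis g_vge : forall Q, vge Q (- ((hits G P Q)%:Z + (Q == P)%:Z)) g.
Hypothesis g_ord : ord P g = - ((hits G P P)%:Z + 1).
Hypothesis g_conj : forall s, s \in fsg_set G -> s g = g -> s = 1%g.
Local Notation x := (model_point f g).

Definition reducible_mod (F : {mpoly k[3]}) d (A : {mpoly k[3]}) :=
  exists B, A - B * F \is d.-homog /\ reduced G (A - B * F).

Lemma reducible_mod_sum F d (I : eqType) (r : seq I) (c : I -> k) (A : I -> {mpoly k[3]}) :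
  (forall i, i \in r -> reducible_mod F d (A i)) ->
  reducible_mod F d (\sum_(i <- r) c i *: A i).
Proof.
move=> Ar; have /choice[B BP] : forall i, exists B, i \in r ->
    A i - B * F \is d.-homog /\ reduced G (A i - B * F).
  move=> i; have [/Ar[B Bi]|_] := boolP (i \in r); first by exists B.
  by exists 0.
exists (\sum_(i <- r) c i *: B i).
have -> : \sum_(i <- r) c i *: A i - (\sum_(i <- r) c i *: B i) * F =
    \sum_(i <- r) c i *: (A i - B i * F).
  by rewrite mulr_suml -sumrB; apply: eq_bigr => i _; rewrite scalerBr scalerAl.
split; first by rewrite big_seq rpred_sum // => i /BP[h _]; apply: dhomogZ.
move=> m m1 m2; rewrite raddf_sum /= big_seq big1 // => i /BP[_ h].
by rewrite mcoeffZ h ?mulr0.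
Qed.

(** Replacing [X_1^n X_2] by [- F'] lowers the degree in [X_1]. *)
Lemma reducible_monomial F' d m :
  F' \is n.+1.-homog -> (forall m, F'@_m != 0 -> (m coord1 < n)%N) ->
  mdeg m = d -> reducible_mod ('X_[mon 0 n 1] + F') d 'X_[m].
Proof.
move=> Fd F1; have [N] := ubnP (m coord1); elim: N m => // N IH m; rewrite ltnS => mN md.
have [/andP[m1 m2]|small] := boolP ((n <= m coord1)%N && (0 < m coord2)%N); last first.
  exists 0; rewrite mul0r subr0 dhomogX /= md eqxx; split=> // m' m1 m2.
  rewrite mcoeffX; case: eqP => // e; by rewrite e m1 m2 in small.
have mle : (mon 0 n 1 <= m)%MM.
  apply/mnm_lepP => i; case/or3P: (ord3_cover coord20 coord21 coord01 i) => /eqP->.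
  - by rewrite mon2.
  - by rewrite mon0.
  - by rewrite mon1.
set m' := (m - mon 0 n 1)%MM; have mE : m = (m' + mon 0 n 1)%MM by rewrite submK.
have [B [Bd Br]] : reducible_mod ('X_[mon 0 n 1] + F') d
    (\sum_(q <- msupp F') (- F'@_q) *: 'X_[m' + q]).
  apply: reducible_mod_sum => q qF; have qn := F1 q; rewrite -mcoeff_msupp in qn.
  have md' : mdeg m = (mdeg m' + n.+1)%N by rewrite {1}mE mdegD mdeg_mon; lia.
  have q1 := qn qF; have qd : mdeg q = n.+1 := dhomogP _ _ _ Fd _ qF.
  apply: IH; last by rewrite mdegD qd -md'.
  have : m coord1 = (m' coord1 + n)%N by rewrite {1}mE mnmDE mon1.
  by rewrite mnmDE; lia.
exists (B + 'X_[m']).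
suff -> : 'X_[m] - (B + 'X_[m']) * ('X_[mon 0 n 1] + F') =
  \sum_(q <- msupp F') (- F'@_q) *: 'X_[m' + q] - B * ('X_[mon 0 n 1] + F') by [].
have -> : \sum_(q <- msupp F') (- F'@_q) *: 'X_[m' + q] = - ('X_[m'] * F').
  rewrite [X in - (_ * X)](mpolyE F') mulr_sumr -sumrN; apply: eq_bigr => q _.
  by rewrite mpolyXD scaleNr scalerAr.
by rewrite {1}mE mpolyXD; ring.
Qed.

(** Modulo the equation every form is reduced, so the forms vanishing at the
    generic point are its multiples. *)
Lemma equation_divides : exists F : {mpoly k[3]},
  [/\ F \is n.+1.-homog, F != 0 & forall d A, A \is d.-homog ->
    hom_eval A x = 0 <-> exists B, A = B * F].
Proof.
have [F' [Fd F1 Fx]] := equation_exists gen_f pole_f g_vge.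
exists ('X_[mon 0 n 1] + F'); split.
- apply: rpredD => //; rewrite dhomogX /= mdeg_mon; apply/eqP; lia.
- apply/eqP => /(congr1 (fun A => A@_(mon 0 n 1))).
  rewrite mcoeff0 mcoeffD mcoeffX eqxx.
  have -> : F'@_(mon 0 n 1) = 0.
    by apply/eqP/negPn/negP => /F1; rewrite mon1 ltnn.
  by rewrite addr0; apply/eqP/oner_neq0.
move=> d A Ad; split=> [Ax|[B ->]]; last by rewrite hom_evalM Fx mulr0.
have [B [Bd Br]] : reducible_mod ('X_[mon 0 n 1] + F') d A.
  rewrite (mpolyE A); apply: reducible_mod_sum => m mA.
  by apply: reducible_monomial => //; exact: (dhomogP _ _ _ Ad _ mA).
exists B; apply/eqP; rewrite -subr_eq0; apply/eqP.
apply: (reduced_zero gen_f pole_f g_ord g_conj Bd Br).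
by rewrite hom_evalB hom_evalM Fx mulr0 subr0.
Qed.

End ModelIdeal.

Section Interpolation.
Variables (k : closedFieldType) (C : curve k).
Implicit Types (s t : aut C) (G : finsubgroup (aut C)).

(** Lagrange interpolation at the conjugates of [g]. *)
Lemma conjugates_generate G (S : subfield C) (g : C) :
  (forall f, f \in sf_mem (fixed G) -> f \in sf_mem S) -> g \in sf_mem S ->
  (forall s, s \in fsg_set G -> s g = g -> s = 1%g) ->
  forall y, y \in sf_mem S.
Proof.
move=> GS gS st y.
have ne s t : s \in fsg_set G -> t \in fsg_set G -> s != t -> s g - t g != 0.
  move=> sG tG; apply: contraNneq => /eqP; rewrite subr_eq0 => /eqP e.
  have : (t^-1 * s)%g = 1%g.
    apply: st; first by rewrite fsgM ?fsgV.
    by rewrite -[LHS]/(kaut_inv t (s g)) e kautK.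
  by move/(congr1 (fun u => (t * u)%g)); rewrite mulgA mulgV mul1g mulg1 => ->.
pose L s : {poly C} := \prod_(t <- fsg_set G | t != s) ('X - (t g)%:P).
pose R : {poly C} := \sum_(s <- fsg_set G) (s y / (L s).[s g]) *: L s.
have mapL u s : u \in fsg_set G -> map_poly u (L s) = L (u * s)%g.
  move=> uG; rewrite /L rmorph_prod /= -[RHS](perm_big _ (perm_fsg_mull uG)) /=.
  rewrite big_map; apply: eq_big => [t|t _]; first by rewrite (inj_eq (mulgI u)).
  by rewrite rmorphB /= map_polyX map_polyC.
have RE u : u \in fsg_set G -> map_poly u R = R.
  move=> uG; rewrite /R rmorph_sum /= -[RHS](perm_big _ (perm_fsg_mull uG)) /=.
  rewrite big_map; apply: eq_bigr => s _.
  rewrite map_polyZ /= mapL // fmorph_div -horner_map /= mapL //.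
have RG i : R`_i \in sf_mem (fixed G).
  by apply/fixedP => u uG; rewrite -coef_map RE.
have <- : R.[g] = y.
  rewrite /R horner_sum (big_rem 1%g) ?fsg1 //= big_seq big1 ?addr0 => [|s].
    rewrite hornerZ divfK // horner_prod prodf_seq_neq0; apply/allP => t tG.
    apply/implyP => t1; rewrite hornerXsubC; apply: (ne 1%g t) => //; first exact: fsg1.
    by rewrite eq_sym.
  rewrite mem_rem_uniq ?fset_uniq // => /andP[/= s1 sG].
  rewrite hornerZ; suff -> : (L s).[g] = 0 by rewrite mulr0.
  rewrite /L horner_prod (big_rem 1%g) ?fsg1 //= eq_sym s1 hornerXsubC.
  have -> : g - (1%g : aut C) g = 0 by exact: subrr.
  exact: mul0r.
rewrite horner_coef rpred_sum // => i _; rewrite rpredM ?rpredX //.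
exact: GS.
Qed.

(** ** Galois extensions of fields of invariants *)

(** The minimal polynomial of [f] has the distinct conjugates of [f] as roots. *)
Lemma fixed_galois G : galois_extension (fun f : C => f \in sf_mem (fixed G)).
Proof.
move=> f; pose l := undup [seq s f | s : aut C <- fsg_set G].
have fl : f \in l.
  by rewrite mem_undup; apply/mapP; exists 1%g; rewrite ?fsg1.
have permG u : u \in fsg_set G -> perm_eq [seq u y | y <- l] l.
  move=> uG; apply: uniq_perm; rewrite ?undup_uniq //.
    by rewrite map_inj_uniq ?undup_uniq //; apply: fmorph_inj.
  move=> y; rewrite !mem_undup; apply/mapP/mapP => -[z].
    rewrite mem_undup => /mapP[s sG ->] ->; exists (u * s)%g => //.
    exact: fsgM.
  move=> zG ->; exists ((u^-1 * z)%g f).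
    by rewrite mem_undup; apply/mapP; exists (u^-1 * z)%g; rewrite ?fsgM ?fsgV.
  by rewrite -[RHS]/(u (kaut_inv u (z f))) kautKV.
pose q := \prod_(a <- l) ('X - a%:P).
exists q; split.
- split.
  + exact: monic_prod_XsubC.
  + move=> i; apply/fixedP => u uG; rewrite -coef_map.
    suff -> : map_poly u q = q by [].
    rewrite /q rmorph_prod /= -[RHS](perm_big _ (permG u uG)) big_map.
    by apply: eq_bigr => y _; rewrite rmorphB /= map_polyX map_polyC.
  + by rewrite root_prod_XsubC.
  + move=> r r0 rG rf; rewrite size_prod_XsubC.
    apply: max_poly_roots; rewrite ?undup_uniq //.
    apply/allP => y; rewrite mem_undup => /mapP[s sG ->].
    have -> : r = map_poly s r.
      by apply/polyP => i; rewrite coef_map /= (fixedP _ _ (rG i)).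
    by rewrite rootE horner_map (rootP rf) rmorph0.
- by have := separable_prod_XsubC l; rewrite undup_uniq unlock.
- by exists l.
Qed.

Lemma fixed_galois_group G :
  galois_group (fun f : C => f \in sf_mem (fixed G)) = [set` fsg_set G]%classic.
Proof.
apply/seteqP; split=> s /=; first exact: fixing_fixed.
by move=> sG f /fixedP; apply.
Qed.
End Interpolation.

(** * The morphism to the plane *)

Section Centers.
Variables (k : closedFieldType) (C : curve k) (x : 'rV[C]_3) (F : {mpoly k[3]}) (n : nat).
Local Notation cst := (kf_const C).
Hypothesis F_homog : F \is n.-homog.
Hypothesis F_div : forall d A, A \is d.-homog -> hom_eval A x = 0 <-> exists B, A = B * F.
Hypothesis x_full : ratio_field x = setT.

(** [v] is the image of [Q] under the morphism with coordinates [x]. *)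
Definition center Q (v : 'rV[k]_3) :=
  v != 0 /\ exists h, forall i, h * x 0 i - cst (v 0 i) \in mx Q.

Lemma rV_neq0P (K : fieldType) (v : 'rV[K]_3) : reflect (exists i, v 0 i != 0) (v != 0).
Proof.
apply: (iffP idP) => [v0|[i vi]]; last by apply: contraNneq vi => ->; rewrite mxE.
apply: contrapT => none; case/eqP: v0; apply/rowP => i; rewrite mxE.
by apply/eqP/negPn/negP => h; apply: none; exists i.
Qed.

Lemma nonconst_exists : exists y : C, nonconst y.
Proof.
have [y [yt _]] := curveP C; exists y => c yc.
have /yt/eqP : root (map_poly cst ('X - c%:P)) y.
  by rewrite rmorphB /= map_polyX map_polyC root_XsubC yc.
by rewrite polyXsubC_eq0.
Qed.

Lemma nonconst_ratio h : h != 0 -> exists j, nonconst (x 0 j / h).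
Proof.
move=> h0; apply: contrapT => none; have [y ny] := nonconst_exists.
have Sx j : x 0 j / h \in sf_mem (kx (1 : C)).
  have [[c ->]|nc] := pselect (exists c, x 0 j / h = cst c); first exact: kx_const.
  by case: none; exists j => c e; apply: nc; exists c.
have /asboolP[p [q [_ yE]]] : y \in sf_mem (kx (1 : C)).
  by apply: (ratio_sub (kx_const 1) h0 Sx); rewrite x_full.
apply: (ny (p.[1] / q.[1])); rewrite yE fmorph_div -!horner_map /= rmorph1 //.
Qed.

Lemma coordinates_neq0 : x != 0.
Proof.
have [j nj] := nonconst_ratio (oner_neq0 C); apply/rV_neq0P; exists j.
by apply/eqP => xj; apply: (nj 0); rewrite xj mul0r rmorph0.
Qed.

Lemma center_exists Q : exists v, center Q v.
Proof.
have /rV_neq0P[i0 xi0] := coordinates_neq0.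
(* Divide by the coordinate of least order. *)
have [i xi imin] : exists2 i, x 0 i != 0 & forall j, x 0 j / x 0 i \in reg Q.
  case: (@Order.TotalTheory.arg_minP _ _ _ i0 (fun i => x 0 i != 0) (fun i => ord Q (x 0 i)) xi0).
  move=> i xi imin; exists i => // j; have [->|xj] := eqVneq (x 0 j) 0.
    by rewrite mul0r rpred0.
  by rewrite reg_ord ?mulf_neq0 ?invr_eq0 // ordM ?invr_eq0 // ordV subr_ge0 imin.
have /choice[w wP] : forall j, exists c, x 0 j / x 0 i - cst c \in mx Q.
  by move=> j; apply: value_ex.
exists (\row_j w j); split; last first.
  by exists (x 0 i)^-1 => j; rewrite mxE mulrC.
apply/rV_neq0P; exists i; rewrite mxE; apply: contraTneq (wP i) => ->.
by rewrite rmorph0 subr0 divff // mx1.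
Qed.

(** Two normalizations of [x] at [Q] differ by a factor that is a unit at [Q]. *)
Lemma center_uniq Q v w : center Q v -> center Q w -> exists c, w = c *: v.
Proof.
move=> [v0 [h hv]] [w0 [h' hw]]; have /rV_neq0P[i vi] := v0.
have r1 j : h * x 0 j \in reg Q by rewrite -(subrK (cst (v 0 j)) (h * _)) regD ?reg_cst ?mx_reg.
have u1 : h * x 0 i \notin mx Q.
  apply: contra vi => m1; rewrite -(mx_cst Q).
  by have := mxB m1 (hv i); rewrite opprB addrC subrK.
have hx0 := nmx_neq0 u1; have xi0 : x 0 i != 0.
  by apply: contraNneq hx0 => ->; rewrite mulr0.
have h0 : h != 0 by apply: contraNneq hx0 => ->; rewrite mul0r.
exists (w 0 i / v 0 i); apply/rowP => j; rewrite mxE.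
pose u := h' / h; have uE l : u * (h * x 0 l) = h' * x 0 l by rewrite mulrA divfK.
have ur : u \in reg Q.
  rewrite -[u](mulfK hx0) uE regM ?unit_regP //.
  by rewrite -(subrK (cst (w 0 i)) (h' * _)) regD ?reg_cst ?mx_reg.
have key l c : h * x 0 l - cst c \in mx Q -> u * (h * x 0 l) - u * cst c \in mx Q.
  by move=> m1; rewrite -mulrBr mxMl.
have [c uc] := value_ex ur.
have val l : w 0 l = c * v 0 l.
  apply: (@value_uniq _ _ Q (h' * x 0 l)) => //.
  rewrite rmorphM -uE.
  have -> : u * (h * x 0 l) - cst c * cst (v 0 l) =
     (u * (h * x 0 l) - u * cst (v 0 l)) + (u - cst c) * cst (v 0 l) by ring.
  by apply: mxD; [apply: key|apply: mxMr => //; apply: reg_cst].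
by rewrite !val mulfK.
Qed.

Lemma value_mmap Q (u : 'I_3 -> C) (v : 'I_3 -> k) (A : {mpoly k[3]}) :
  (forall i, u i - cst (v i) \in mx Q) -> mmap cst u A - cst A.@[v] \in mx Q.
Proof.
move=> uv; have ur i : u i \in reg Q by rewrite -(subrK (cst (v i)) (u i)) regD ?reg_cst ?mx_reg.
have valM a b c d : a \in reg Q -> a - cst c \in mx Q -> b - cst d \in mx Q ->
    a * b - cst (c * d) \in mx Q.
  move=> ar ac bd; rewrite rmorphM.
  have -> : a * b - cst c * cst d = a * (b - cst d) + (a - cst c) * cst d by ring.
  by apply: mxD; [apply: mxMl|apply: mxMr => //; apply: reg_cst].
have valX a c e : a \in reg Q -> a - cst c \in mx Q -> a ^+ e - cst (c ^+ e) \in mx Q.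
  move=> ar ac; elim: e => [|e IH]; first by rewrite !expr0 rmorph1 subrr mx0.
  by rewrite !exprS; apply: (valM).
rewrite mevalE /mmap rmorph_sum -sumrB; apply: mx_sum => m _.
apply: (valM); rewrite ?reg_cst ?subrr ?mx0 //.
suff [] : mmap1 u m \in reg Q /\ mmap1 u m - cst (\prod_i v i ^+ m i) \in mx Q by [].
apply: (big_ind2 (fun a c => a \in reg Q /\ a - cst c \in mx Q)).
- by rewrite rpred1 rmorph1 subrr mx0.
- by move=> a c b d [ar ac] [br bd]; split; [apply: regM|apply: (valM)].
- by move=> i _; split; [apply: regX|apply: valX].
Qed.

Lemma center_on_curve Q v : center Q v -> F.@[v 0] = 0.
Proof.
move=> [_ [h hv]]; have := value_mmap F hv.
have Fx : hom_eval F x = 0 by apply/(F_div F_homog); exists 1; rewrite mul1r.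
rewrite (@mmap_scale _ _ _ cst (x 0) (fun i => h * x 0 i) h n F) //.
rewrite -[mmap _ _ _]/(hom_eval F x) Fx mulr0 sub0r => /mxN.
by rewrite opprK mx_cst => /eqP.
Qed.

(** Surjectivity: the forms vanishing at a point [v] of the curve give a proper
    ideal in the ring of functions regular at [v], and a place above it has
    center [v]. *)
Lemma center_surj (v : 'rV[k]_3) : v != 0 -> F.@[v 0] = 0 -> exists Q, center Q v.
Proof.
move=> v0 Fv; have /rV_neq0P[i vi] := v0.
have van d (A : {mpoly k[3]}) : A \is d.-homog -> hom_eval A x = 0 -> A.@[v 0] = 0.
  by move=> Ad /(F_div Ad)[B ->]; rewrite mevalM Fv mulr0.
have xi : x 0 i != 0.
  apply: contraNneq vi => xi; apply/eqP; rewrite -(mevalXU (v 0)).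
  by apply: (van 1%N); rewrite ?homog1X ?hom_evalX.
pose R u := exists d A, A \is d.-homog /\ u = hom_eval A x / x 0 i ^+ d.
pose I u := exists d A, [/\ A \is d.-homog, A.@[v 0] = 0 & u = hom_eval A x / x 0 i ^+ d].
have subE d A e B : hom_eval A x / x 0 i ^+ d - hom_eval B x / x 0 i ^+ e =
    hom_eval (A * 'X_i ^+ e - B * 'X_i ^+ d) x / x 0 i ^+ (d + e).
  rewrite hom_evalB !hom_evalM !hom_evalXn !hom_evalX exprD.
  have := expf_neq0 d xi; have := expf_neq0 e xi.
  by move: (x 0 i ^+ d) (x 0 i ^+ e) => a b b0 a0; field; rewrite a0 b0.
have mulE d A e B : hom_eval A x / x 0 i ^+ d * (hom_eval B x / x 0 i ^+ e) =
    hom_eval (A * B) x / x 0 i ^+ (d + e).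
  by rewrite hom_evalM exprD mulf_div.
have homB d (A : {mpoly k[3]}) e (B : {mpoly k[3]}) : A \is d.-homog -> B \is e.-homog ->
    A * 'X_i ^+ e - B * 'X_i ^+ d \is (d + e)%N.-homog.
  move=> Ad Be; apply: rpredB; first by apply: dhomogM => //; apply: homogX.
  by rewrite addnC; apply: dhomogM => //; apply: homogX.
have minor j : I (x 0 j / x 0 i - cst (v 0 j / v 0 i)).
  exists 1%N, ('X_j - (v 0 j / v 0 i) *: 'X_i); split.
  - by apply: rpredB; [|apply: dhomogZ]; apply: homog1X.
  - by rewrite mevalB mevalZ !mevalXU divfK // subrr.
  - by rewrite hom_evalB hom_evalZ !hom_evalX expr1 mulrBl mulfK.
have [||||||||Q [_ QI]] := @place_above _ C R I.
- by move=> c; exists 0%N, c%:MP; rewrite homogC hom_evalC expr0 divr1.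
- move=> _ _ [d [A [Ad ->]]] [e [B [Be ->]]].
  by exists (d + e)%N, (A * 'X_i ^+ e - B * 'X_i ^+ d); rewrite subE homB.
- move=> _ _ [d [A [Ad ->]]] [e [B [Be ->]]].
  by exists (d + e)%N, (A * B); rewrite mulE dhomogM.
- move=> _ _ [d [A [Ad Av ->]]] [e [B [Be Bv ->]]].
  exists (d + e)%N, (A * 'X_i ^+ e - B * 'X_i ^+ d); rewrite subE homB //.
  by rewrite mevalB !mevalM Av Bv !mul0r subrr.
- move=> _ _ [d [A [Ad ->]]] [e [B [Be Bv ->]]].
  by exists (d + e)%N, (A * B); rewrite mulE dhomogM // mevalM Bv mulr0.
- by move=> _ [d [A [Ad _ ->]]]; exists d, A.
- case=> d [A [Ad Av /esym e1]]; have xd := expf_neq0 d xi.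
  have := van d (A - 'X_i ^+ d); rewrite rpredB ?homogX //.
  rewrite hom_evalB hom_evalXn hom_evalX -[hom_eval A x](divfK xd) e1 mul1r subrr.
  move=> /(_ isT erefl); rewrite mevalB Av sub0r => /eqP; rewrite oppr_eq0.
  by rewrite rmorphXn /= mevalXU expf_eq0 (negPf vi) andbF.
- apply: contrapT => allc.
  have xc j : x 0 j / x 0 i = cst (v 0 j / v 0 i).
    apply/eqP; rewrite -subr_eq0; apply/negPn/negP => ne; apply: allc.
    by exists (x 0 j / x 0 i - cst (v 0 j / v 0 i)).
  by have [j] := nonconst_ratio xi; apply; rewrite xc.
exists Q; split=> //; exists (cst (v 0 i) / x 0 i) => j.
have -> : cst (v 0 i) / x 0 i * x 0 j - cst (v 0 j) =
    cst (v 0 i) * (x 0 j / x 0 i - cst (v 0 j / v 0 i)).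
  by rewrite mulrBr -rmorphM [in cst (_ * _)]mulrC divfK // mulrAC mulrA.
by apply: mxMl; [apply: reg_cst|apply: QI].
Qed.
End Centers.

Section PlanePoints.
Variable k : closedFieldType.

Lemma vline_dim (v : 'rV[k]_3) : v != 0 -> \dim <[v]> = 1%N.
Proof. by move=> v0; rewrite dim_vline v0. Qed.

Definition span_point (v : 'rV[k]_3) (v0 : v != 0) : plane_point k :=
  PlanePoint (vline_dim v0).

Lemma plane_point_eq (p q : plane_point k) : pp_line p = pp_line q -> p = q.
Proof.
case: p q => [p dp] [q dq] /= pq; case: _ / pq in dq *.
by rewrite (Prop_irrelevance dp dq).
Qed.

Lemma vline_scale (v : 'rV[k]_3) c : c != 0 -> <[c *: v]>%VS = <[v]>%VS.
Proof.
move=> c0; apply/eqP; rewrite eqEsubv -!memvE rpredZ ?memv_line //=.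
by rewrite -[X in X \in _](scalerK c0) rpredZ ?memv_line.
Qed.

Lemma plane_point_spanned (p : plane_point k) :
  exists2 v : 'rV[k]_3, v != 0 & pp_line p = <[v]>%VS.
Proof.
have pn : pp_line p != 0%VS by rewrite -dimv_eq0 pp_dim.
exists (vpick (pp_line p)); first by rewrite vpick0.
apply/eqP; rewrite eq_sym eqEdim -memvE memv_pick pp_dim.
by rewrite dim_vline vpick0 pn.
Qed.

Lemma delta_neq0 (j : 'I_3) : delta_mx 0 j != 0 :> 'rV[k]_3.
Proof.
apply/eqP => /rowP/(_ j)/eqP; rewrite !mxE !eqxx /=; exact/negP/oner_neq0.
Qed.

Definition vertex (j : 'I_3) : plane_point k := span_point (delta_neq0 j).

Lemma vertex_inj : injective vertex.
Proof.
move=> i j /(congr1 (@pp_line k)) /= ij.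
have : (delta_mx 0 i : 'rV[k]_3) \in <[delta_mx 0%R j : 'rV[k]_3]>%VS by rewrite -ij memv_line.
case/vlineP => c /rowP/(_ i); rewrite !mxE !eqxx /=.
by case: eqP => //= _ /eqP; rewrite mulr0 oner_eq0.
Qed.

(** A linear projection from a vertex is given by two independent forms in the
    other two coordinates, and its field does not depend on them. *)
Lemma projection_vertex_field (L : kfield k) (x : 'rV[L]_3) (a b j : 'I_3) (f : L) :
  a != b -> a != j -> b != j -> x 0 a != 0 ->
  (exists2 N, projection_from (vertex j) N &
     ratio_field (x *m map_mx (kf_const L) N) f) <-> f \in sf_mem (kx (x 0 b / x 0 a)).
Proof.
move=> ab aj bj xa; split=> [[N [_ jN] fN]|].
  apply: (ratio_sub _ xa _ fN); first exact: kx_const.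
  move=> i; have N0 : N j i = 0.
    have /rowP/(_ i) := jN (delta_mx 0 j) (memv_line _).
    by rewrite -rowE !mxE.
  rewrite mxE (big_ord3 ab aj bj) /= !mxE N0 rmorph0 mulr0 addr0.
  rewrite mulrDl mulrAC divff // mul1r mulrAC.
  rewrite -[_ \in _]/(_ \in sf_mem (kx (x 0 b / x 0 a))).
  by rewrite rpredD ?kx_const // rpredM ?kx_const //; apply: kx_self.
move=> f_kx; pose N : 'M[k]_(3, 2) := \matrix_(i, l)
  ((i == a) && (l == 0) || (i == b) && (l == 1))%:R.
have NN : N^T *m N = 1%:M.
  apply/matrixP => i l; rewrite !mxE (big_ord3 ab aj bj) /= !mxE !eqxx.
  rewrite [j == a]eq_sym [j == b]eq_sym [b == a]eq_sym (negPf ab) (negPf aj) (negPf bj) /=.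
  case: i l => [[|[|//]] ?] [[|[|//]] ?];
    by rewrite -!val_eqE /= ?mulr0 ?mul0r ?mulr1 ?addr0 ?add0r.
exists N.
  split.
    apply/eqP; rewrite eqn_leq rank_leq_col /=.
    by have := mxrankM_maxr N^T N; rewrite NN mxrank1.
  move=> v /vlineP[c ->]; rewrite -scalemxAl -rowE; apply/rowP => l; rewrite !mxE.
  by rewrite [j == a]eq_sym [j == b]eq_sym (negPf aj) (negPf bj) mulr0.
set y := x *m _; apply/ratioP.
have ya : y 0 0 = x 0 a.
  rewrite mxE (big_ord3 ab aj bj) /= !mxE !eqxx [j == a]eq_sym [j == b]eq_sym.
  rewrite [b == a]eq_sym (negPf ab) (negPf aj) (negPf bj) /=.
  by rewrite rmorph1 rmorph0 !mulr0 mulr1 !addr0.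
have yb : y 0 1 = x 0 b.
  rewrite mxE (big_ord3 ab aj bj) /= !mxE !eqxx [j == a]eq_sym [j == b]eq_sym.
  rewrite [b == a]eq_sym (negPf ab) (negPf aj) (negPf bj) /=.
  by rewrite rmorph1 rmorph0 !mulr0 mulr1 addr0 add0r.
move: f_kx; apply: kx_sub; first exact: ratio_const.
by rewrite -ya -yb; apply: ratio_coord; rewrite ya.
Qed.

End PlanePoints.

Section PlaneMap.
Variables (k : closedFieldType) (C : curve k) (x : 'rV[C]_3) (X : plane_curve k).
Local Notation cst := (kf_const C).
Hypothesis X_div : forall d A, A \is d.-homog ->
  hom_eval A x = 0 <-> exists B, A = B * pc_eqn X.
Hypothesis x_full : ratio_field x = setT.

Definition plane_map (Q : cpoint C) : plane_point k :=
  span_point (proj1 (projT2 (cid (center_exists x_full Q)))).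

Definition plane_field : pc_function_field X := PCFunctionField X_div x_full.

Lemma plane_map_center Q : exists2 v, center x Q v & pp_line (plane_map Q) = <[v]>%VS.
Proof.
exists (projT1 (cid (center_exists x_full Q))) => //.
exact: (projT2 (cid (center_exists x_full Q))).
Qed.

Lemma plane_mapE Q v : center x Q v -> pp_line (plane_map Q) = <[v]>%VS.
Proof.
move=> vQ; have [w wQ ->] := plane_map_center Q.
have [c wE] := center_uniq vQ wQ; rewrite wE vline_scale //.
by apply: contraTneq (proj1 wQ) => c0; rewrite wE c0 scale0r eqxx.
Qed.

Lemma plane_map_vertex Q j h : (forall i, i != j -> h * x 0 i \in mx Q) ->
  h * x 0 j - 1 \in mx Q -> plane_map Q = vertex k j.
Proof.
move=> hi hj; apply: plane_point_eq; apply: plane_mapE; split; first exact: delta_neq0.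
exists h => i; rewrite mxE eqxx /=; have [->|ij] := eqVneq i j; first by rewrite rmorph1.
by rewrite rmorph0 subr0 hi.
Qed.

Lemma plane_map_birational : birational_embedding plane_map.
Proof.
exists x; split=> //; first exact: coordinates_neq0.
move=> Q; have [v [v0 [h hv]] ->] := plane_map_center Q.
exists h, v; split=> //; first exact: memv_line.
by move=> i; apply/max_idealP.
Qed.

Lemma plane_map_range : range plane_map = pc_points X.
Proof.
apply/seteqP; split=> [_ [Q _ <-] w|p pX].
  have [v vQ ->] := plane_map_center Q => /vlineP[c ->].
  have -> : (pc_eqn X).@[(c *: v) 0] = (pc_eqn X).@[fun i => c * v 0 i].
    by apply: meval_eq => i; rewrite mxE.
  by rewrite (meval_scale _ _ (pc_homog X)) (center_on_curve (pc_homog X) X_div vQ) mulr0.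
have [v v0 pE] := plane_point_spanned p.
have [|Q Qv] := center_surj X_div x_full v0.
  by apply: pX; rewrite pE memv_line.
exists Q => //; apply: plane_point_eq; rewrite pE; exact: plane_mapE.
Qed.

Lemma proj_vertex_fixed (G : finsubgroup (aut C)) (a b j : 'I_3) :
  a != b -> a != j -> b != j -> x 0 a != 0 -> generates G (x 0 b / x 0 a) ->
  proj_subfield plane_field (vertex k j) = (fun f => f \in sf_mem (fixed G)).
Proof.
move=> ab aj bj xa gen; apply: funext => f; apply: propext; rewrite gen.
exact: projection_vertex_field.
Qed.

(** Were all the partial derivatives zero at the vertex, the equation would have
    degree less than [#G] in the corresponding coordinate, against
    [low_degree_zero]. *)
Lemma vertex_smooth (G : finsubgroup (aut C)) (a b j : 'I_3) :
  a != b -> a != j -> b != j -> x 0 a != 0 ->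
  x 0 b / x 0 a \in sf_mem (fixed G) -> nonconst (x 0 b / x 0 a) ->
  (forall s, s \in fsg_set G -> s (x 0 j / x 0 a) = x 0 j / x 0 a -> s = 1%g) ->
  pc_deg X = (size (fsg_set G)).+1 -> pc_points X (vertex k j) ->
  smooth_point X (vertex k j).
Proof.
move=> ab aj bj xa bG bn jst degX jX; split=> //.
have Fd := pc_homog X; rewrite degX in Fd; set n := size (fsg_set G) in Fd.
have ej (A : {mpoly k[3]}) e : A \is e.-homog ->
    A.@[(delta_mx 0 j : 'rV[k]_3) 0] = A@_(U_(j) *+ e).
  move=> Ae; rewrite -(meval_vertex j Ae); apply: meval_eq => i.
  by rewrite mxE eqxx.
exists (delta_mx 0 j); first exact: memv_line.
apply: contrapT => sing.
have {}sing i : (pc_eqn X)@_(U_(j) *+ n + U_(i)) = 0.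
  have [->|ij] := eqVneq i j.
    by rewrite -mulmSr -(ej _ _ Fd); apply: jX; apply: memv_line.
  have /eqP : ((pc_eqn X)^`M(i)).@[(delta_mx 0 j : 'rV[k]_3) 0] == 0.
    by apply/negPn/negP => h; apply: sing; exists i; apply/eqP.
  rewrite (ej _ _ (mderiv_homog i Fd)) mcoeff_mderiv mulmnE mnm1E eq_sym (negPf ij).
  by rewrite mul0n.
have F0 : pc_eqn X = 0.
  apply: (low_degree_zero ab aj bj xa bG bn jst Fd) => [m Fm|].
    rewrite ltnNge; apply/negP => mj; case/eqP: (Fm).
    have md := homog_coef0 Fd Fm.
    have [i mE] : exists i, m = (U_(j) *+ n + U_(i))%MM.
      have nm : (U_(j) *+ n <= m)%MM.
        apply/mnm_lepP => i; rewrite mulmnE mnm1E.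
        by case: eqP => [<-|_]; rewrite ?mul1n ?mul0n.
      have : mdeg (m - U_(j) *+ n) == 1%N.
        have := submK nm => /(congr1 (fun q => mdeg q)); rewrite /= mdegD mdegMn mdeg1 md; lia.
      by move=> /mdeg1P[i /eqP iE]; exists i; rewrite -iE addmC submK.
    by rewrite mE sing.
  by apply/(X_div Fd); exists 1; rewrite mul1r.
by have := pc_nonconst X; rewrite F0 msize0.
Qed.

End PlaneMap.

(** * The plane model attached to two groups *)

Section PlaneModel.
Variables (k : closedFieldType) (C : curve k).
Local Notation cst := (kf_const C).
Implicit Types (P Q : cpoint C) (s t : aut C) (G : finsubgroup (aut C)).

Lemma generates_stab G (y : C) s : generates G y -> s y = y -> s \in fsg_set G.
Proof.
move=> gy sy; apply: fixing_fixed => f; rewrite gy => /asboolP[p [q [_ ->]]].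
have sp (r : {poly k}) : s (map_poly cst r).[y] = (map_poly cst r).[y].
  rewrite -horner_map /= sy -map_poly_comp; congr (_.[_]); apply: eq_map_poly => c /=.
  exact: kaut_const.
by rewrite fmorph_div /= !sp.
Qed.

(** The plane curve is given with coordinates in [C] itself, so that the Galois
    groups of the projections are sets of automorphisms of [C]. *)
Definition galois_plane_model G1 G2 P1 P2 := exists (x : 'rV[C]_3) (X : plane_curve k)
  (X_div : forall d A, A \is d.-homog -> hom_eval A x = 0 <-> exists B, A = B * pc_eqn X)
  (x_full : ratio_field x = setT),
  let M := plane_field X_div x_full in let psi := plane_map x_full in
  [/\ pc_deg X = (size (fsg_set G1)).+1, psi P1 <> psi P2,
      inner_galois_point M (psi P1), inner_galois_point M (psi P2) &
      galois_group (proj_subfield M (psi P1)) = [set` fsg_set G1]%classic /\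
      galois_group (proj_subfield M (psi P2)) = [set` fsg_set G2]%classic].

(** The case where the equation can be written down: [f] has its poles along the
    orbit of [P1], where [g] has the excess pole. The images of [P1] and [P2] are
    then the vertices [coord1] and [j]. *)
Lemma galois_plane_model_vertices G1 G2 P1 P2 (f g : C) (a b j : 'I_3) (h : C) :
  let x := model_point f g in
  generates G1 f -> f \notin reg P1 ->
  (forall Q, vge Q (- ((hits G1 P1 Q)%:Z + (Q == P1)%:Z)) g) ->
  ord P1 g = - ((hits G1 P1 P1)%:Z + 1) ->
  (forall s, s \in fsg_set G1 -> s g = g -> s = 1%g) ->
  a != b -> a != j -> b != j -> j != coord1 -> x 0 a != 0 ->
  generates G2 (x 0 b / x 0 a) -> nonconst (x 0 b / x 0 a) ->
  (forall s, s \in fsg_set G2 -> s (x 0 j / x 0 a) = x 0 j / x 0 a -> s = 1%g) ->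
  (forall i, i != j -> h * x 0 i \in mx P2) -> h * x 0 j - 1 \in mx P2 ->
  size (fsg_set G1) = size (fsg_set G2) ->
  galois_plane_model G1 G2 P1 P2.
Proof.
move=> x gf fP gv go gc ab aj bj j1 xa gen2 n2 c2 hP hj sG.
have [F [Fd F0 Fdiv]] := equation_divides gf fP gv go gc.
have F1 : (1 < msize F)%N.
  have [m Fm] := mcoeff_neq0_exists F0.
  have := msize_mdeg_lt (etrans (mcoeff_msupp _ _) Fm).
  by rewrite (homog_coef0 Fd Fm); apply: leq_trans.
have x_full : ratio_field x = setT.
  apply/seteqP; split=> // y _; apply/ratioP.
  have x2 : x 0 coord2 != 0 by rewrite model2 oner_eq0.
  have fS : f \in sf_mem (ratio_subfield x).
    by have := ratio_coord coord0 x2; rewrite model0 model2 divr1.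
  apply: (conjugates_generate (G := G1) (g := g) _ _ gc) => [u|].
    by rewrite gf; apply: kx_sub => // c; apply: ratio_const.
  by have := ratio_coord coord1 x2; rewrite model1 model2 divr1.
pose X := PlaneCurve Fd F1 (vanishing_form_irreducible Fd F0 Fdiv).
have X_div d A : A \is d.-homog ->
    hom_eval A x = 0 <-> exists B, A = B * pc_eqn X by apply: Fdiv.
exists x, X, X_div, x_full => M psi.
have g0 : g != 0 by apply/eqP => g0; have := go; rewrite g0 ord_zero; clear; lia.
have f0 := nreg_neq0 fP.
have psi1 : psi P1 = vertex k coord1.
  apply: (plane_map_vertex x_full (h := g^-1)) => [i|].
    case/or3P: (ord3_cover coord20 coord21 coord01 i) => /eqP-> // _.
      by rewrite model2 mulr1 mx_ord ?invr_eq0 // ordV go; clear; lia.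
    rewrite model0 mx_ord ?mulf_neq0 ?invr_eq0 // ordM ?invr_eq0 // ordV go.
    by rewrite (generates_ord_pole gf fP); clear; lia.
  by rewrite model1 mulVf // subrr mx0.
have psi2 : psi P2 = vertex k j by apply: (plane_map_vertex x_full hP hj).
have on_curve Q : pc_points X (psi Q).
  by rewrite -(plane_map_range X_div x_full); exists Q.
have x2 : x 0 coord2 != 0 by rewrite model2 oner_eq0.
have gen1 : generates G1 (x 0 coord0 / x 0 coord2) by rewrite model0 model2 divr1.
have proj1 := proj_vertex_fixed X_div x_full coord20 coord21 coord01 x2 gen1.
have proj2 := proj_vertex_fixed X_div x_full ab aj bj xa gen2.
split.
- by [].
- by rewrite psi1 psi2 => /vertex_inj e; rewrite e eqxx in j1.
- split; first by rewrite /galois_point psi1 proj1; apply: fixed_galois.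
  have := on_curve P1; rewrite psi1; apply: (vertex_smooth X_div coord20 coord21 coord01 x2) => //.
  + exact: generates_fixed gen1.
  + by rewrite model0 model2 divr1; apply: nreg_nonconst fP.
  + by rewrite model1 model2 divr1; apply: gc.
- split; first by rewrite /galois_point psi2 proj2; apply: fixed_galois.
  have := on_curve P2; rewrite psi2; apply: (vertex_smooth X_div ab aj bj xa _ n2 c2) => //.
  + exact: generates_fixed gen2.
  + by rewrite /= sG.
- by rewrite psi1 psi2 proj1 proj2; split; apply: fixed_galois_group.
Qed.

(** Coordinates: let [f] and [g] generate the invariants of [G1] and [G2], with
    poles along the orbits of [P2] and [P1]. By the divisor condition [g] has
    no more poles than [f], except one more at [P1]. If [P1] is a pole of [f],
    the map [(f : g : 1)] satisfies the conditions for a model; otherwise the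
    pole of [f] is moved to [P1] by taking [1 / (f - f(P1))] and, projectively
    the same map, [(1 : g : f - f(P1))]. *)
Lemma galois_plane_model_exists G1 G2 P1 P2 (f g : C) :
  P1 != P2 -> generates G1 f -> f \notin reg P2 -> generates G2 g -> g \notin reg P1 ->
  (forall s, s \in fsg_set G1 -> s \in fsg_set G2 -> s = 1%g) ->
  perm_eq (P1 :: [seq act s P2 | s <- fsg_set G1]) (P2 :: [seq act t P1 | t <- fsg_set G2]) ->
  galois_plane_model G1 G2 P1 P2.
Proof.
move=> P12 gf fP2 gg gP1 triv div.
have sG : size (fsg_set G1) = size (fsg_set G2).
  by have := perm_size div; rewrite /= !size_map => -[].
have hitsE Q : ((Q == P1) + hits G1 P2 Q = (Q == P2) + hits G2 P1 Q)%N.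
  have := permP div (pred1 Q); rewrite /= !count_map.
  by rewrite eq_sym [P2 == Q]eq_sym.
have h1 : hits G2 P1 P1 = (hits G1 P2 P1).+1.
  by have := hitsE P1; rewrite eqxx (negPf P12) add0n add1n.
have h2 : hits G1 P2 P2 = (hits G2 P1 P2).+1.
  by have := hitsE P2; rewrite eqxx eq_sym (negPf P12) add0n add1n.
have f0 := nreg_neq0 fP2; have g0 := nreg_neq0 gP1.
have gpd := generates_pole_divisor gg gP1.
have fpd := generates_pole_divisor gf fP2.
have gv Q : vge Q (- (hits G2 P1 Q)%:Z) g by apply: pole_divisor_vge.
have gP2v : vge P2 (1 - (hits G1 P2 P2)%:Z) g.
  by rewrite h2; apply: vge_le (gv P2); clear; lia.
have oP1 : ord P1 g = - (hits G1 P2 P1)%:Z - 1.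
  by rewrite (generates_ord_pole gg gP1) h1; clear; lia.
have oP2 := generates_ord_pole gf fP2.
have stab_g s : s \in fsg_set G1 -> s g = g -> s = 1%g.
  by move=> sG1 /(generates_stab gg); apply: triv.
have stab_f s : s \in fsg_set G2 -> s f = f -> s = 1%g.
  by move=> sG2 /(generates_stab gf) sG1; apply: triv.
have ng := nreg_nonconst gP1.
have [fP1|fP1] := boolP (f \in reg P1); last first.
  have hh Q : hits G1 P2 Q = hits G1 P1 Q.
    have /hits_gt0P[s sG1 <-] := generates_poles_conj gf fP2 fP1.
    by rewrite hits_actl.
  apply: (galois_plane_model_vertices (f := f) (g := g) (a := coord2) (b := coord1)
    (j := coord0) (h := f^-1)) => //; rewrite ?model0 ?model1 ?model2 ?divr1 ?oner_eq0 //.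
  - move=> Q; apply: vge_le (gv Q); have := hitsE Q; rewrite hh.
    by case: (Q == P1); case: (Q == P2); clear; lia.
  - by rewrite oP1 hh; clear; lia.
  - move=> i; case/or3P: (ord3_cover coord20 coord21 coord01 i) => /eqP-> // _.
      by rewrite model2 mulr1 nreg_invmx.
    rewrite model1 mx_vge.
    have -> : 1 = (hits G1 P2 P2)%:Z + (1 - (hits G1 P2 P2)%:Z) by clear; lia.
    apply: vgeM gP2v; rewrite vge_ord ?invr_eq0 // ordV oP2; clear; lia.
  - by rewrite mulVf // subrr mx0.
have h0 : hits G1 P2 P1 = 0%N by have := fpd P1; rewrite fP1.
have [c fc] := value_ex fP1; have nf := nreg_nonconst fP2.
have fc0 : f - cst c != 0 by rewrite subr_eq0; apply/eqP/nf.
pose f1 := (f - cst c)^-1.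
have f10 : f1 != 0 by rewrite invr_eq0.
have gf1 : generates G1 f1 by apply: generates_shift_inv.
have f1P1 : f1 \notin reg P1 by apply: mx_inv_nreg.
have f1pd := generates_pole_divisor gf1 f1P1.
have fcr Q : (f - cst c \in reg Q) = (f \in reg Q).
  apply/idP/idP => h; last by rewrite regB ?reg_cst.
  by rewrite -(subrK (cst c) f) regD ?reg_cst.
have of1 Q : vge Q ((hits G1 P2 Q)%:Z - (hits G1 P1 Q)%:Z) f1.
  have [fQ|fQ] := boolP (f \in reg Q).
    by have := fpd Q; rewrite fQ => ->; rewrite sub0r; apply: pole_divisor_vge.
  have f1Q : f1 \in mx Q by apply: nreg_invmx; rewrite fcr.
  have := f1pd Q; rewrite (mx_reg f1Q) => ->; rewrite subr0.
  rewrite vge_ord // ordV.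
  have ofQ : ord Q f = - (hits G1 P2 Q)%:Z by have := fpd Q; rewrite (negPf fQ).
  have [|_ ->] := @ordD_lt _ _ Q f (- cst c) (nreg_neq0 fQ); last by rewrite ofQ opprK.
  rewrite vgeN; apply: vge_le (vge_cst Q c); have := nreg_ord fQ; clear; lia.
have of1P1 := generates_ord_pole gf1 f1P1.
apply: (galois_plane_model_vertices (f := f1) (g := g * f1) (a := coord0) (b := coord1)
  (j := coord2) (h := 1)) => //; rewrite ?model0 ?model1 ?model2 ?mulfK ?mul1r //.
- move=> Q; apply: vge_le (vgeM (gv Q) (of1 Q)); have := hitsE Q.
  by case: (Q == P1); case: (Q == P2); clear; lia.
- by rewrite ordM // oP1 of1P1 h0; clear; lia.
- move=> s sG1 sgf; apply: (stab_g s sG1); apply: (mulIf f10).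
  by rewrite -[RHS]sgf rmorphM /= (fixedP _ _ (generates_fixed gf1)).
- move=> s sG2; rewrite /f1 invrK => e; apply: (stab_f s sG2).
  by move: e; rewrite rmorphB /= kaut_const => /addIr.
- move=> i; case/or3P: (ord3_cover coord20 coord21 coord01 i) => /eqP-> // _; rewrite mul1r.
    by rewrite model0 nreg_invmx ?fcr.
  rewrite model1 mx_vge.
  have -> : 1 = (1 - (hits G1 P2 P2)%:Z) + (hits G1 P2 P2)%:Z by clear; lia.
  apply: vgeM gP2v _; have := of1 P2.
  have f1P2 : f1 \in mx P2 by apply: nreg_invmx; rewrite fcr.
  by have := f1pd P2; rewrite (mx_reg f1P2) => ->; rewrite subr0.
- by rewrite subrr mx0.
Qed.

End PlaneModel.

(** * Descent to the quotient by a normalized group *)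

Section Norm.
Variables (k : closedFieldType) (C : curve k).
Local Notation cst := (kf_const C).
Implicit Types (P Q : cpoint C) (s t : aut C) (G H : finsubgroup (aut C)).

Lemma semidirect_conj H G h s : semidirect H G -> h \in fsg_set H -> s \in fsg_set G ->
  (h ^ s)%g \in fsg_set H.
Proof.
move=> [_ norm _] hH sG; apply: norm => //; apply/imfset2P.
by exists 1%g; [exact: fsg1|exists s; rewrite ?mul1g].
Qed.

Lemma semidirect_cap H G s : semidirect H G -> s \in fsg_set H -> s \in fsg_set G -> s = 1%g.
Proof.
move=> [_ _ cap] sH sG; apply/fset1P; rewrite -cap.
by rewrite in_fsetI; apply/andP.
Qed.

Definition product_group H G (HG : semidirect H G) : finsubgroup (aut C) :=
  FinSubgroup (let: And3 c _ _ := HG in c).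

Lemma product_groupP H G (HG : semidirect H G) s :
  reflect (exists2 h, h \in fsg_set H & exists2 t, t \in fsg_set G & s = (h * t)%g)
    (s \in fsg_set (product_group HG)).
Proof. exact: imfset2P. Qed.

Lemma product_group_perm H G (HG : semidirect H G) :
  perm_eq (fsg_set (product_group HG)) [seq (h * t)%g | h <- fsg_set H, t <- fsg_set G].
Proof.
apply: uniq_perm; first exact: fset_uniq.
  apply: allpairs_uniq; rewrite ?fset_uniq //.
  move=> [h t] [h' t'] /allpairsP[[x y] /= [xH yG [-> ->]]] /allpairsP[[x' y'] /= [xH' yG' [-> ->]]].
  move=> /= e; have e' : (x'^-1 * x = y' * y^-1)%g.
    by apply: (mulIg y); rewrite -!mulgA mulVg mulg1 e mulgA mulVg mul1g.
  have e1 : (x'^-1 * x = 1)%g.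
    by apply: (semidirect_cap HG); [|rewrite e']; rewrite fsgM ?fsgV.
  have ex : x = x' by rewrite -[RHS]mulg1 -e1 mulgA mulgV mul1g.
  by congr (_, _) => //; apply: (mulgI x); rewrite e -ex.
move=> s; apply/product_groupP/allpairsP => [[h hH [t tG ->]]|[[h t] /= [hH tG ->]]].
  by exists (h, t).
by exists h => //; exists t.
Qed.

Lemma hits_product H G (HG : semidirect H G) P Q :
  hits (product_group HG) P Q = (\sum_(h <- fsg_set H) hits G P (act h^-1%g Q))%N.
Proof.
rewrite /hits (permP (product_group_perm HG)) -sum1_count big_mkcond.
rewrite big_allpairs_dep /=; apply: eq_bigr => h _.
rewrite -sum1_count [RHS]big_mkcond; apply: eq_bigr => t _.
rewrite act_mul; congr (if _ then _ else _).
by apply/eqP/eqP => [<-|->]; rewrite ?actK ?actKV.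
Qed.

Lemma vge_prod Q (I : Type) (r : seq I) (m : I -> int) (F : I -> C) :
  (forall i, vge Q (m i) (F i)) -> vge Q (\sum_(i <- r) m i) (\prod_(i <- r) F i).
Proof.
move=> h; elim: r => [|i r IH]; first by rewrite !big_nil -(rmorph1 cst) vge_cst.
by rewrite !big_cons vgeM.
Qed.

(** Rationality descends from [C/G] to [C/HG]: if [f] generates the invariants
    of [G] and has its poles along [G P], the norm over [H] of [f - c] has the
    least possible poles, along [HG P], and is not constant because for general
    [c] it has a zero. *)
Lemma product_group_generator H G (HG : semidirect H G) f P :
  generates G f -> f \notin reg P ->
  exists2 w, generates (product_group HG) w & w \notin reg P.
Proof.
move=> gf fP; have nf := nreg_nonconst fP.
have [c _ cL] := generic_shift f [seq act s P | s <- fsg_set (product_group HG)] [::].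
pose w := \prod_(h <- fsg_set H) h (f - cst c).
have fc0 : f - cst c != 0 by rewrite subr_eq0; apply/eqP/nf.
have w0 : w != 0.
  by rewrite prodf_seq_neq0; apply/allP => h _; rewrite fmorph_eq0.
have fcG : f - cst c \in sf_mem (fixed G).
  by rewrite rpredB ?const_fixed ?generates_fixed.
have wG : w \in sf_mem (fixed (product_group HG)).
  apply/fixedP => _ /product_groupP[h hH [t tG ->]].
  rewrite -[LHS]/(h (t w)).
  suff -> : t w = w by apply: (fixedP _ _ (norm_fixed H (f - cst c))).
  have tV := fsgV tG.
  have permJ : perm_eq [seq (u ^ t^-1)%g | u <- fsg_set H] (fsg_set H).
    apply: uniq_perm; rewrite ?fset_uniq //.
      rewrite map_inj_uniq ?fset_uniq //; exact: can_inj (conjgK _).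
    move=> u; apply/mapP/idP => [[v vH ->]|uH]; first exact: (semidirect_conj HG).
    exists (u ^ t)%g; first exact: (semidirect_conj HG).
    by rewrite conjgK.
  rewrite /w rmorph_prod /= -[RHS](perm_big _ permJ) /= big_map.
  apply: eq_bigr => u _.
  have -> : (u ^ t^-1)%g (f - cst c) = (t * u)%g ((t^-1)%g (f - cst c)).
    by rewrite conjgE invgK -[RHS]/(((t * u) * t^-1)%g _) mulgA.
  by rewrite -[RHS]/(t (u ((t^-1)%g _))) (fixedP _ _ fcG _ tV).
have wv Q : vge Q (- (hits (product_group HG) P Q)%:Z) w.
  rewrite hits_product -[(\sum_(_ <- _) _)%N%:Z]natz natr_sum -sumrN; apply: vge_prod => h.
  rewrite vge_actV natz; apply: vgeD.
    exact/pole_divisor_vge/generates_pole_divisor.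
  by rewrite vgeN; apply: vge_le (vge_cst _ c); clear; lia.
have nw : nonconst w.
  (* The zero [Q] of [f - c] lies outside the orbit of [P], so no factor of the
     norm has a pole there. *)
  have [Q fQ] := place_at_value c nf.
  have Qr h : h \in fsg_set H -> f - cst c \in reg (act h^-1%g Q).
    move=> hH; apply: contraT => nr.
    have nfr : f \notin reg (act h^-1%g Q).
      by apply: contra nr => fr; rewrite regB ?reg_cst.
    have /hits_gt0P[s sG sP] := generates_poles_conj gf fP nfr.
    have /cL : Q \in [seq act s P | s <- fsg_set (product_group HG)].
      apply/mapP; exists (h * s)%g; last by rewrite act_mul sP actKV.
      by apply/product_groupP; exists h => //; exists s.
    by rewrite fQ.
  apply: (mx_nonconst (P := Q) w0); rewrite mx_ord // ord_norm //.
  rewrite (big_rem 1%g) ?fsg1 //= invg1 act_one ltr_wpDr -?mx_ord //.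
  by rewrite big_seq sumr_ge0 // => h /mem_rem hH; rewrite -reg_ord // Qr.
have [gw wP] := minimal_pole_generates nw wG wv.
by exists w.
Qed.

(** The generator is the image of the coordinate of the line. *)
Lemma rational_generator G : curve_iso (quotient_curve G) (proj_line k) ->
  exists2 f : C, generates G f & nonconst f.
Proof.
move=> [phi [[psi phiK psiK] phic]].
pose e : {rmorphism proj_line k -> C} := (val : {rmorphism fixed_kfield G -> C}) \o phi.
have ec c : e (kf_const (proj_line k) c) = cst c by rewrite /e /= phic.
pose f := e (tofrac 'X).
have eX (p : {poly k}) : e (tofrac p) = (map_poly cst p).[f].
  rewrite -ratfun_horner -horner_map; congr (_.[_]).
  rewrite -[LHS](map_poly_comp e (kf_const (ratfun_kfield k))).
  by apply: eq_map_poly => c; apply: ec.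
exists f.
  move=> y; apply/idP/idP => [yG|/(kx_sub (const_fixed G))]; last by apply; apply: valP.
  have [p [q [q0 rE]]] := frac_numden (psi (SfElt yG : fixed_kfield G)).
  have yE : y = e (tofrac p / tofrac q) by rewrite -rE /e /= psiK.
  apply/asboolP; exists p, q; rewrite -!eX yE fmorph_div; split=> //.
  by rewrite fmorph_eq0 tofrac_eq0.
move=> c fc; have : e (tofrac ('X - c%:P)) = 0.
  by rewrite eX rmorphB /= map_polyX map_polyC hornerXsubC fc subrr.
by move/eqP; rewrite fmorph_eq0 tofrac_eq0 polyXsubC_eq0.
Qed.

End Norm.

Section Restriction.
Variables (k : closedFieldType) (C : curve k) (H : finsubgroup (aut C)).
Local Notation D := (quotient_curve H).
Implicit Types (P Q : cpoint C) (s t : aut C) (G : finsubgroup (aut C)).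

Definition conj_stable s := forall h, h \in fsg_set H -> (h ^ s)%g \in fsg_set H.

Lemma conj_stable_fixed s : conj_stable s -> forall f, f \in sf_mem (fixed H) ->
  s f \in sf_mem (fixed H).
Proof.
move=> sH f fH; apply/fixedP => h hH; rewrite -[in RHS](fixedP _ _ fH _ (sH h hH)).
by rewrite -[LHS]/((h * s)%g f) -[RHS]/((s * h ^ s)%g f) conjgE mulgA mulgV mul1g.
Qed.

Section OneAutomorphism.
Variables (s : aut C) (sH : conj_stable s) (sVH : conj_stable s^-1%g).

Definition restr_fun (f : fixed_kfield H) : fixed_kfield H :=
  SfElt (conj_stable_fixed sH (valP f)).
Definition restr_inv (f : fixed_kfield H) : fixed_kfield H :=
  SfElt (conj_stable_fixed sVH (valP f)).

Fact restr_zmod : zmod_morphism restr_fun.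
Proof. by move=> f g; apply: val_inj; rewrite /= rmorphB. Qed.
Fact restr_monoid : monoid_morphism restr_fun.
Proof. by split=> [|f g]; apply: val_inj; rewrite /= ?rmorph1 ?rmorphM. Qed.
HB.instance Definition _ := GRing.isZmodMorphism.Build _ _ restr_fun restr_zmod.
HB.instance Definition _ := GRing.isMonoidMorphism.Build _ _ restr_fun restr_monoid.

Fact restrK : cancel restr_fun restr_inv.
Proof. by move=> f; apply: val_inj; rewrite /= kautK. Qed.
Fact restrKV : cancel restr_inv restr_fun.
Proof. by move=> f; apply: val_inj; rewrite /= kautKV. Qed.
Fact restr_const c : restr_fun (kf_const D c) = kf_const D c.
Proof. by apply: val_inj; rewrite /= kaut_const. Qed.

Definition restr_kaut : aut D := @KAut _ D restr_fun restr_inv restrK restrKV restr_const.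
End OneAutomorphism.

Definition normalizing s := conj_stable s /\ conj_stable s^-1%g.

(** The automorphism induced on the quotient; the value 1 for those that do not
    normalize [H] makes it a total function. *)
Definition restr s : aut D :=
  if pselect (normalizing s) is left sN then restr_kaut (proj1 sN) (proj2 sN) else 1%g.

Lemma restrE s f : normalizing s -> val (restr s f) = s (val f).
Proof. by rewrite /restr; case: pselect. Qed.

Lemma restr_invE s f : normalizing s -> val (kaut_inv (restr s) f) = kaut_inv s (val f).
Proof. by move=> sN; rewrite -{2}[f](kautKV (restr s)) restrE // kautK. Qed.

Lemma restr_act s P : normalizing s ->
  act (restr s) (quo_map H P) = quo_map H (act s P).
Proof.
move=> sN; apply: cpoint_eq => f; rewrite reg_act.
by apply/regP/regP => /=; rewrite restr_invE.
Qed.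

Lemma restr_eq s t : normalizing s -> normalizing t -> restr s = restr t ->
  (s * t^-1)%g \in fsg_set H.
Proof.
move=> sN tN st; apply: fixing_fixed => f fH; have [_ tVH] := tN.
have uH := conj_stable_fixed tVH fH.
rewrite -[LHS]/(s (t^-1%g f)) -[t^-1%g f]/(val (SfElt uH : D)) -restrE // st restrE //=.
exact: kautKV.
Qed.

Section RestrictedGroup.
Variables (G : finsubgroup (aut C)) (HG : semidirect H G).

Lemma semidirect_normalizing s : s \in fsg_set G -> normalizing s.
Proof. by move=> sG; split=> h hH; apply: (semidirect_conj HG); rewrite ?fsgV. Qed.

Lemma restrM s t : s \in fsg_set G -> t \in fsg_set G ->
  restr (s * t)%g = (restr s * restr t)%g.
Proof.
move=> sG tG; apply: kaut_eq => f; apply: val_inj.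
rewrite -[(restr s * restr t)%g f]/(restr s (restr t f)) !restrE //;
  by apply: semidirect_normalizing; rewrite ?fsgM.
Qed.

Lemma restr1 : restr 1%g = 1%g.
Proof.
apply: kaut_eq => f; apply: val_inj; rewrite restrE //.
exact/semidirect_normalizing/fsg1.
Qed.

Lemma restrV s : s \in fsg_set G -> restr s^-1%g = (restr s)^-1%g.
Proof.
move=> sG; apply: (mulgI (restr s)).
by rewrite -restrM ?fsgV // !mulgV restr1.
Qed.

Lemma restr_inj : {in fsg_set G &, injective restr}.
Proof.
move=> s t sG tG st; have stG : (s * t^-1)%g \in fsg_set G by rewrite fsgM ?fsgV.
have : (s * t^-1)%g = 1%g.
  by apply: (semidirect_cap HG) => //; apply: restr_eq => //; apply: semidirect_normalizing.
by move/(congr1 (fun u => (u * t)%g)); rewrite -mulgA mulVg mulg1 mul1g.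
Qed.

Definition restr_set : {fset aut D} := [fset restr s | s in fsg_set G]%fset.

Lemma restr_group_closed : group_closed (mem restr_set).
Proof.
split=> [|_ _ /imfsetP[s sG ->] /imfsetP[t tG ->]]; apply/imfsetP.
  by exists 1%g; [exact: fsg1|rewrite restr1].
exists (s * t^-1)%g; first by rewrite /= fsgM ?fsgV.
by rewrite restrM ?fsgV // restrV.
Qed.

Definition restr_group : finsubgroup (aut D) := FinSubgroup restr_group_closed.

Lemma restr_groupP u : reflect (exists2 s, s \in fsg_set G & u = restr s)
  (u \in fsg_set restr_group).
Proof. exact: imfsetP. Qed.

Lemma restr_group_perm : perm_eq (fsg_set restr_group) [seq restr s | s <- fsg_set G].
Proof.
apply: uniq_perm; first exact: fset_uniq.
  by rewrite map_inj_in_uniq ?fset_uniq //; apply: restr_inj.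
by move=> u; apply/restr_groupP/mapP.
Qed.

Lemma restr_fixed f : (f \in sf_mem (fixed restr_group)) =
  (val f \in sf_mem (fixed (product_group HG))).
Proof.
apply/fixedP/fixedP => [fG _ /product_groupP[h hH [t tG ->]]|fG _ /restr_groupP[s sG ->]].
  rewrite -[LHS]/(h (t (val f))) -restrE; last exact: semidirect_normalizing.
  rewrite fG; last by apply/restr_groupP; exists t.
  by apply: (fixedP _ _ (valP f)).
apply: val_inj; rewrite restrE; last exact: semidirect_normalizing.
by apply: fG; apply/product_groupP; exists 1%g; [exact: fsg1|exists s; rewrite ?mul1g].
Qed.

Lemma kx_val (f y : D) : (val f \in sf_mem (kx (val y : C))) = (f \in sf_mem (kx y)).
Proof.
pose vl : {rmorphism fixed_kfield H -> C} := val.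
have evl p : vl (map_poly (kf_const D) p).[y] = (map_poly (kf_const C) p).[val y].
  rewrite -horner_map; congr (_.[_]).
  by rewrite -[LHS](map_poly_comp vl (kf_const (fixed_kfield H))); apply: eq_map_poly.
apply/asboolP/asboolP => -[p [q [q0 fE]]]; exists p, q.
  split; first by rewrite -(fmorph_eq0 vl) evl.
  by apply: val_inj; rewrite fE -!evl -fmorph_div.
by rewrite -!evl fmorph_eq0 fE -[LHS]/(vl _) fmorph_div.
Qed.

Lemma restr_generates (w : C) P : generates (product_group HG) w -> w \notin reg P ->
  exists2 y : D, generates restr_group y & y \notin reg (quo_map H P).
Proof.
move=> gw wP; have wH : w \in sf_mem (fixed H).
  apply/fixedP => h hH; apply: (fixedP _ _ (generates_fixed gw)).
  by apply/product_groupP; exists h => //; exists 1%g; rewrite ?fsg1 ?mulg1.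
exists (SfElt wH : D); first by move=> f; rewrite restr_fixed gw -kx_val.
by apply: contra wP => /regP; move/regP.
Qed.

End RestrictedGroup.
End Restriction.

(** * Divisors, orbits and groups on the quotient *)

Section Divisors.
Variables (k : closedFieldType) (C : curve k).
Implicit Types (P Q : cpoint C) (s t : aut C) (G H : finsubgroup (aut C)).

Lemma divisor_perm G1 G2 P1 P2 :
  pt_div P1 + \sum_(s <- fsg_set G1) pt_div (act s P2)
    = pt_div P2 + \sum_(t <- fsg_set G2) pt_div (act t P1) ->
  perm_eq (P1 :: [seq act s P2 | s <- fsg_set G1]) (P2 :: [seq act t P1 | t <- fsg_set G2]).
Proof.
have coef Q P P' G : freeg.coeff Q (pt_div P + \sum_(s <- fsg_set G) pt_div (act s P')) =
    (count_mem Q (P :: [seq act s P' | s <- fsg_set G]))%:Z.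
  rewrite coeffD raddf_sum /= coeffU mul1r PoszD natz; congr (_ + _).
  elim: (enum_fset _) => [|s l IH]; first by rewrite big_nil.
  by rewrite big_cons IH coeffU mul1r natz.
move=> e; apply/allP => Q _ /=; apply/eqP.
by have := congr1 (freeg.coeff Q) e; rewrite !coef => -[].
Qed.

(** A norm over [H] vanishing at [Q] and not at [P] is a function on the quotient
    that tells apart the images of two distinct orbits. *)
Lemma quo_map_orbit H P Q : quo_map H P = quo_map H Q -> pt_orbit H P = pt_orbit H Q.
Proof.
move=> e; have [/separating_norm[u [uH u0 oP oQ]]|] := posnP (hits H P Q).
  have uP : u^-1 \in reg P by rewrite reg_ord ?invr_eq0 // ordV oP.
  have uQ : u^-1 \notin reg Q by rewrite reg_ord ?invr_eq0 // ordV oppr_ge0 -ltNge.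
  have uVH : u^-1 \in sf_mem (fixed H) by rewrite rpredV.
  have eu := congr1 (fun R : cpoint (quotient_curve H) => pt_ring R (SfElt uVH)) e.
  by case/negP: uQ; apply/regP; move: eu => /= <-; apply/regP.
move=> /hits_gt0P[s sH <-]; apply/seteqP; split=> _ [t tH <-].
  exists (t * s^-1)%g; first by rewrite /= fsgM ?fsgV.
  by rewrite act_mul actK.
by exists (t * s)%g; [rewrite /= fsgM|rewrite act_mul].
Qed.

Lemma restr_group_iso H G (HG : semidirect H G) :
  group_iso [set` fsg_set (restr_group HG)]%classic [set` fsg_set G]%classic.
Proof.
have /choice[phi phiP] : forall u, exists s, u \in fsg_set (restr_group HG) ->
    s \in fsg_set G /\ restr H s = u.
  move=> u; have [/restr_groupP[s sG ->]|_] := boolP (u \in fsg_set (restr_group HG)).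
    by exists s.
  by exists 1%g.
exists phi; first split.
- by move=> u /= /phiP[].
- move=> u v /set_mem/= uG /set_mem/= vG e.
  by rewrite -(proj2 (phiP u uG)) e (proj2 (phiP v vG)).
- move=> s /= sG; have rG : restr H s \in fsg_set (restr_group HG).
    by apply/restr_groupP; exists s.
  exists (restr H s) => //; have [pG pE] := phiP _ rG.
  exact: (restr_inj HG).
move=> u v /= uG vG; have [uG' uE] := phiP u uG; have [vG' vE] := phiP v vG.
have [wG wE] := phiP _ (@fsgM _ (quotient_curve H) (restr_group HG) u v uG vG).
by apply: (restr_inj HG); rewrite ?fsgM // wE (restrM HG) // uE vE.
Qed.

End Divisors.

Theorem corollary1 (k : closedFieldType) (C : curve k)
    (G1 G2 : finsubgroup (aut C)) (P1 P2 : cpoint C) (H : finsubgroup (aut C)) :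
  P1 <> P2 ->
  curve_iso (quotient_curve G1) (proj_line k) ->
  curve_iso (quotient_curve G2) (proj_line k) ->
  (G1 `&` G2 = [fset 1%g])%fset ->
  pt_div P1 + \sum_(s <- fsg_set G1) pt_div (act s P2)
    = pt_div P2 + \sum_(t <- fsg_set G2) pt_div (act t P1) ->
  (H `&` mulset G1 G2 = [fset 1%g])%fset ->
  semidirect H G1 ->
  semidirect H G2 ->
  pt_orbit H P1 <> pt_orbit H P2 ->
  exists (psi : cpoint (quotient_curve H) -> plane_point k) (X : plane_curve k)
         (M : pc_function_field X),
    [/\ birational_embedding psi,
        range psi = pc_points X,
        pc_deg X = #|` fsg_set G1|.+1,
        psi (quo_map H P1) <> psi (quo_map H P2)
      & [/\ inner_galois_point M (psi (quo_map H P1)),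
            inner_galois_point M (psi (quo_map H P2)),
            group_iso (galois_group (proj_subfield M (psi (quo_map H P1))))
                      [set` fsg_set G1]
          & group_iso (galois_group (proj_subfield M (psi (quo_map H P2))))
                      [set` fsg_set G2]]].
Proof.
move=> _ rat1 rat2 G12 div HG12 HG1 HG2 orb.
have [f0 gf0 nf0] := rational_generator rat1; have [g0 gg0 ng0] := rational_generator rat2.
have [f1 gf1 f1P] := generates_pole P2 nf0 gf0; have [g1 gg1 g1P] := generates_pole P1 ng0 gg0.
have [f gf fP] := product_group_generator HG1 gf1 f1P.
have [g gg gP] := product_group_generator HG2 gg1 g1P.
have [y gy yP] := restr_generates gf fP; have [z gz zP] := restr_generates gg gP.
have triv s : s \in fsg_set (restr_group HG1) -> s \in fsg_set (restr_group HG2) -> s = 1%g.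
  move=> /restr_groupP[s1 s1G ->] /restr_groupP[s2 s2G e].
  have N1 := semidirect_normalizing HG1 s1G; have N2 := semidirect_normalizing HG2 s2G.
  have s12 : (s1 * s2^-1)%g = 1%g.
    apply/fset1P; rewrite -HG12 in_fsetI (restr_eq N1 N2 e) /=.
    by apply/imfset2P; exists s1 => //; exists s2^-1%g => //; apply: fsgV.
  have s1E : s1 = s2 by rewrite -[RHS]mul1g -s12 -mulgA mulVg mulg1.
  suff -> : s1 = 1%g by apply: restr1 HG1.
  by apply/fset1P; rewrite -G12 in_fsetI s1G s1E.
have divD : perm_eq (quo_map H P1 :: [seq act s (quo_map H P2) | s <- fsg_set (restr_group HG1)])
    (quo_map H P2 :: [seq act t (quo_map H P1) | t <- fsg_set (restr_group HG2)]).
  have push G (HG : semidirect H G) P Q :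
      perm_eq (quo_map H P :: [seq act s (quo_map H Q) | s <- fsg_set (restr_group HG)])
        [seq quo_map H R | R <- P :: [seq act s Q | s <- fsg_set G]].
    rewrite /= perm_cons (perm_trans (perm_map _ (restr_group_perm HG))) //.
    rewrite -!map_comp; apply/permP => a; rewrite !count_map; apply: eq_in_count => s sG /=.
    by rewrite restr_act //; apply: (semidirect_normalizing HG).
  rewrite (perm_trans (push _ HG1 P1 P2)) // perm_sym (perm_trans (push _ HG2 P2 P1)) //.
  by rewrite perm_sym perm_map // divisor_perm.
have P12 : quo_map H P1 != quo_map H P2 by apply/eqP => /quo_map_orbit.
have [x [X [X_div [x_full [degX psi12 in1 in2 [gal1 gal2]]]]]] :=
  galois_plane_model_exists P12 gy yP gz zP triv divD.
exists (plane_map x_full), X, (plane_field X_div x_full); split => //.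
- exact: plane_map_birational.
- exact: plane_map_range.
- by rewrite degX (perm_size (restr_group_perm HG1)) size_map.
split=> //; first by rewrite gal1; apply: restr_group_iso.
by rewrite gal2; apply: restr_group_iso.
Qed.
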